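(* Let $n\geq 2$ and let $\Omega\subset\mathbb{C}^n$ be a caltrop. Then $\Omega$ is a visibility domain with respect to the Kobayashi distance. However, $\Omega$ is not a Goldilocks domain.
   Context: Notation. $\|\cdot\|$ is the Euclidean norm and $\mathbb{D}\subset\mathbb{C}$ is the open unit disk. For a bounded domain $\Omega\subset\mathbb{C}^n$, $\delta_\Omega(z)$ is the Euclidean distance from $z\in\Omega$ to $\mathbb{C}^n\setminus\Omega$. The Kobayashi(--Royden) metric is $\kappa_\Omega(z;v)=\inf\{|\xi| : \xi\in\mathbb{C},\ \exists\,\varphi:\mathbb{D}\to\Omega \text{ holomorphic with } \varphi(0)=z,\ \varphi'(0)\xi=v\}$ for $z\in\Omega$, $v\in\mathbb{C}^n$. The Kobayashi distance is $\mathsf{k}_\Omega(z,w)=\inf_\gamma\int_0^1\kappa_\Omega(\gamma(t);\gamma'(t))\,dt$, the infimum being over piecewise $\mathcal{C}^1$ paths $\gamma:[0,1]\to\Omega$ from $z$ to $w$. Almost-geodesics. For $\lambda\geq 1$, $\kappa\geq 0$ and an interval $I\subset\mathbb{R}$, a curve $\sigma:I\to\Omega$ is a $(\lambda,\kappa)$-almost-geodesic if (i) $\lambda^{-1}|t-s|-\kappa\leq \mathsf{k}_\Omega(\sigma(s),\sigma(t))\leq\lambda|t-s|+\kappa$ for all $s,t\in I$; and (ii) $\sigma$ is absolutely continuous and $\kappa_\Omega(\sigma(t);\sigma'(t))\leq\lambda$ for almost every $t\in I$. Visibility domain. A bounded domain $\Omega\subset\mathbb{C}^n$ is a visibility domain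 with respect to the Kobayashi distance if, given any $\lambda\geq1$ and $\kappa\geq0$, for each pair of distinct points $\xi,\eta\in\partial\Omega$ and each pair of $\overline\Omega$-open neighbourhoods $V$ of $\xi$ and $W$ of $\eta$ with $\overline V\cap\overline W=\varnothing$, there is a compact set $K\subset\Omega$ such that the image of each $(\lambda,\kappa)$-almost-geodesic $\sigma:[0,L]\to\Omega$ with $\sigma(0)\in V$, $\sigma(L)\in W$ intersects $K$. Goldilocks domain. Put $M_\Omega(r)=\sup\{1/\kappa_\Omega(z;v) : z\in\Omega,\ \delta_\Omega(z)\leq r,\ \|v\|=1\}$. A bounded domain $\Omega$ is a Goldilocks domain if (1) for some (hence any) $\epsilon>0$, $\int_0^\epsilon \frac1r M_\Omega(r)\,dr<\infty$; and (2) for each $z_0\in\Omega$ there are constants $C,\alpha>0$ (depending on $z_0$) such that $\mathsf{k}_\Omega(z_0,z)\leq C+\alpha\log\frac{1}{\delta_\Omega(z)}$ for all $z\in\Omega$. Caltrop. A bounded domain $\Omega\subset\mathbb{C}^n$, $n\geq2$, is a caltrop if there is a finite set of exceptional points $\{q_1,\dots,q_N\}\subset\partial\Omega$ ($N\geq1$) such that $\partial\Omega\setminus\{q_1,\dots,q_N\}$ is $\mathcal{C}^2$-smooth, $\partial\Omega$ is strongly Levi-pseudoconvex at each point of $\partial\Omega\setminus\{q_1,\dots,q_N\}$, and for each $j=1,\dots,N$ there exist a connected open neighbourhood $V_j$ of $q_j$, constants $p_j\in(1,3/2)$, $C_j>1$, $A_j>0$, a unitary transformation $\mathsf{U}^{(j)}$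 of $\mathbb{C}^n$ and a continuous function $\psi_j:[0,A_j]\to[0,+\infty)$ such that, writing $\mathsf{U}_j(z)=\mathsf{U}^{(j)}(z-q_j)$, $$\mathsf{U}_j(\Omega\cap V_j)=\Big\{(z_1,\dots,z_n)\in\mathbb{C}^n : \mathrm{Re}(z_n)\in(0,A_j),\ \mathrm{Im}(z_n)^2+\sum_{1\leq k\leq n-1}|z_k|^2<\psi_j(\mathrm{Re}(z_n))^2\Big\},$$ where: $\psi_j$ is of class $\mathcal{C}^2$ on $(0,A_j)$; $(1/C_j)x^{p_j}\leq\psi_j(x)\leq C_jx^{p_j}$ for all $x\in[0,A_j]$; $\psi_j$ is strictly increasing and $\psi_j'$ is increasing on $(0,A_j)$; and $\lim_{x\to0^+}\psi_j(x)\psi_j''(x)=0$. *)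

(* Defs.v *)
From HB Require Import structures.
From mathcomp Require Import all_boot all_order all_algebra.
From mathcomp Require Import all_classical all_reals all_analysis.
From mathcomp Require Import complex.

Set Implicit Arguments.
Unset Strict Implicit.
Unset Printing Implicit Defensive.

Import Order.TTheory GRing.Theory Num.Theory.
Import numFieldNormedType.Exports.

Local Open Scope ring_scope.
Local Open Scope classical_set_scope.

(* The complex numbers over R, declared as a [numClosedFieldType]: the topology
   and the normed-module structure of MathComp-Analysis are attached to that
   structure, not to the bare type [R[i]]. *)
Definition Cplx (R : realType) : numClosedFieldType := R[i].

Section Euclidean.
Variables (R : realType) (n : nat).
Local Notation C := (Cplx R).
Implicit Types (z v w : 'cV[C]_n) (Om : set 'cV[C]_n).

(* In [C] the norm [`|x|] is a (real) complex number; [cabs] is its value in R. *)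
Definition cabs (x : C) : R := complex.Re `|x|.

(* The library norm on ['cV[C]_n] is the sup norm. *)
Definition enorm z : R := Num.sqrt (\sum_i cabs (z i 0) ^+ 2).

Definition bounded_domain Om : Prop :=
  [/\ open Om, connected Om, Om !=set0
    & exists M : R, forall z, Om z -> enorm z <= M].

Definition bdry Om : set 'cV[C]_n := closure Om `\` interior Om.

Definition delta Om z : R := inf [set enorm (z - w) | w in ~` Om].

Definition real_scale (t : R) v : 'cV[C]_n := (t%:C%C : C) *: v.

(* Derivative of a curve depending on a real parameter. *)
Definition is_velocity (g : R -> 'cV[C]_n) (t : R) v : Prop :=
  real_scale h^-1 (g (h + t) - g t) @[h --> 0^'] --> v.

Definition velocity (g : R -> 'cV[C]_n) (t : R) : 'cV[C]_n :=
  lim (real_scale h^-1 (g (h + t) - g t) @[h --> 0^']).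

(* Derivative at z of a real-valued function along the real line z + t v. *)
Definition ddir v (f : 'cV[C]_n -> R) z : R :=
  derive1 (fun t : R => f (z + real_scale t v)) 0.

End Euclidean.

Section Kobayashi.
Variables (R : realType) (n : nat).
Local Notation C := (Cplx R).
Local Notation mu := (@lebesgue_measure R).
Implicit Types (z v w : 'cV[C]_n) (Om : set 'cV[C]_n).

Definition holomorphic_disc Om (phi : C -> 'cV[C]_n) : Prop :=
  forall x : C, `|x| < 1 -> derivable phi x 1 /\ Om (phi x).

(* For Om open and z in Om the set below is nonempty, so that the real-valued
   [inf] is the genuine infimum; likewise, when Om is moreover bounded,
   [kobm Om z v] is positive for v != 0. *)
Definition kobm Om z v : R :=
  inf [set cabs xi | xi in [set xi : C | exists phi : C -> 'cV[C]_n,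
    [/\ holomorphic_disc Om phi, phi 0 = z & xi *: derive1 phi 0 = v]]].

(* [g] is the derivative of [gam] on the open interval and is continuous up to
   the end points; with the continuity of [gam] this means that [gam] is C^1 on
   the closed interval. *)
Definition C1_piece (gam : R -> 'cV[C]_n) (a b : R) : Prop :=
  exists2 g : R -> 'cV[C]_n, {within `[a, b], continuous g} &
    forall t : R, t \in `]a, b[%R -> is_velocity gam t (g t).

Definition piecewise_C1 (gam : R -> 'cV[C]_n) : Prop :=
  {within `[0, 1], continuous gam} /\
  exists (m : nat) (t : nat -> R), [/\ t 0%N = 0, t m = 1 &
    forall i, (i < m)%N -> t i < t i.+1 /\ C1_piece gam (t i) (t i.+1)].

Definition path_in Om z w (gam : R -> 'cV[C]_n) : Prop :=
  [/\ piecewise_C1 gam, forall t : R, t \in `[0, 1]%R -> Om (gam t),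
      gam 0 = z & gam 1 = w].

Definition kobd Om z w : \bar R :=
  ereal_inf [set (\int[mu]_(t in `[0%R, 1%R])
                    (kobm Om (gam t) (velocity gam t))%:E)%E
            | gam in path_in Om z w].

Definition absolutely_continuous_on (I : interval R) (sg : R -> 'cV[C]_n) :=
  forall e : R, 0 < e -> exists2 d : R, 0 < d &
    forall (m : nat) (a b : 'I_m -> R),
      (forall i, [/\ a i \in I, b i \in I & a i <= b i]) ->
      (forall i j, i != j -> b i <= a j \/ b j <= a i) ->
      \sum_i (b i - a i) < d ->
      \sum_i enorm (sg (b i) - sg (a i)) < e.

Definition almost_geodesic Om (lam kap : R) (I : interval R)
    (sg : R -> 'cV[C]_n) : Prop :=
  [/\ forall t, t \in I -> Om (sg t),
      forall s t, s \in I -> t \in I ->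
        ((lam^-1 * `|t - s| - kap)%:E <= kobd Om (sg s) (sg t)
           <= (lam * `|t - s| + kap)%:E)%E,
      absolutely_continuous_on I sg
    & {ae mu, forall t, t \in I ->
        exists2 v, is_velocity sg t v & kobm Om (sg t) v <= lam}].

Definition relatively_open (X V : set 'cV[C]_n) : Prop :=
  exists2 U : set 'cV[C]_n, open U & V = U `&` X.

Definition visibility_domain Om : Prop :=
  bounded_domain Om /\
  forall lam kap : R, 1 <= lam -> 0 <= kap ->
  forall xi eta, bdry Om xi -> bdry Om eta -> xi != eta ->
  forall V W : set 'cV[C]_n,
    relatively_open (closure Om) V -> V xi ->
    relatively_open (closure Om) W -> W eta ->
    closure V `&` closure W = set0 ->
  exists K : set 'cV[C]_n, [/\ compact K, K `<=` Om &
    forall (L : R) (sg : R -> 'cV[C]_n), 0 <= L ->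
      almost_geodesic Om lam kap `[0, L]%R sg -> V (sg 0) -> W (sg L) ->
      exists2 t : R, t \in `[0, L]%R & K (sg t)].

Definition goldilocks_M Om (r : R) : \bar R :=
  ereal_sup [set x | exists z v,
    [/\ Om z, delta Om z <= r, enorm v = 1 & x = ((kobm Om z v)^-1)%:E]].

Definition goldilocks_domain Om : Prop :=
  [/\ bounded_domain Om,
      exists2 eps : R, 0 < eps &
        (\int[mu]_(r in `]0%R, eps[) ((r^-1)%:E * goldilocks_M Om r) < +oo)%E
    & forall z0, Om z0 -> exists K al : R, [/\ 0 < K, 0 < al &
        forall z, Om z ->
          (kobd Om z0 z <= (K + al * ln (1 / delta Om z))%:E)%E]].

End Kobayashi.

Section Caltrop.
Variables (R : realType) (n : nat).
Local Notation C := (Cplx R).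
Implicit Types (z v w p q : 'cV[C]_n) (Om U : set 'cV[C]_n).

Definition C1_on U (f : 'cV[C]_n -> R) : Prop :=
  forall z, U z -> {for z, continuous f} /\
    forall v, derivable (fun t : R => f (z + real_scale t v)) 0 1 /\
              {for z, continuous (ddir v f)}.

Definition C2_on U (f : 'cV[C]_n -> R) : Prop :=
  C1_on U f /\ forall v, C1_on U (ddir v f).

Definition defining_function Om p U (rho : 'cV[C]_n -> R) : Prop :=
  [/\ open U, U p, C2_on U rho,
      Om `&` U = [set z | U z /\ rho z < 0]
    & forall z, U z -> bdry Om z -> exists v, ddir v rho z != 0].

Definition C2_boundary_at Om p : Prop :=
  exists U rho, defining_function Om p U rho.

(* Derivatives with respect to the real coordinates x_j and y_j, where
   z_j = x_j + i y_j. *)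
Definition dx (j : 'I_n) := ddir (delta_mx j 0 : 'cV[C]_n).
Definition dy (j : 'I_n) := ddir ('i *: delta_mx j 0 : 'cV[C]_n).

(* d/dz_j = (d/dx_j - i d/dy_j) / 2 *)
Definition wirtinger (rho : 'cV[C]_n -> R) z (j : 'I_n) : C :=
  (dx j rho z -i* dy j rho z)%C / 2.

(* d^2/(dz_j dzbar_k) = (d/dx_j - i d/dy_j) (d/dx_k + i d/dy_k) / 4 *)
Definition levi_coef (rho : 'cV[C]_n -> R) z (j k : 'I_n) : C :=
  ((dx j (dx k rho) z + dy j (dy k rho) z) +i*
   (dx j (dy k rho) z - dy j (dx k rho) z))%C / 4.

Definition levi_form (rho : 'cV[C]_n -> R) z v : C :=
  \sum_j \sum_k levi_coef rho z j k * v j 0 * (v k 0)^*.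

(* The order of [C] makes [0 < x] mean that x is a positive real number. *)
Definition strongly_levi_pseudoconvex_at Om p : Prop :=
  exists U rho, defining_function Om p U rho /\
    forall v, v != 0 -> \sum_j wirtinger rho p j * v j 0 = 0 ->
      0 < levi_form rho p v.

Definition cusp_profile (p K A : R) (psi : R -> R) : Prop :=
  [/\ {within `[0, A], continuous psi} /\
        (forall x : R, x \in `[0, A]%R -> 0 <= psi x),
      forall x : R, x \in `]0, A[%R -> [/\ derivable psi x 1,
        derivable (derive1 psi) x 1 & {for x, continuous (derive1n 2 psi)}],
      forall x : R, x \in `[0, A]%R -> 1 / K * x `^ p <= psi x <= K * x `^ p,
      {in `]0, A[%R &, {homo psi : x y / x < y}} /\
        {in `]0, A[%R &, {homo derive1 psi : x y / x <= y}}
    & psi x * derive1n 2 psi x @[x --> 0^'+] --> (0 : R)].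

(* [l] is the index of the last coordinate. *)
Definition cusp_region (l : 'I_n) (A : R) (psi : R -> R) : set 'cV[C]_n :=
  [set z | let x := complex.Re (z l 0) in let y := complex.Im (z l 0) in
    0 < x < A /\
    y ^+ 2 + \sum_(k < n | k != l) cabs (z k 0) ^+ 2 < psi x ^+ 2].

Definition cusp_at Om q : Prop :=
  exists (V : set 'cV[C]_n) (p K A : R) (T : 'M[C]_n) (psi : R -> R)
      (l : 'I_n),
    [/\ [/\ open V, connected V & V q],
        [/\ 1 < p < 3 / 2, 1 < K & 0 < A],
        T \is unitarymx /\ l.+1 = n,
        cusp_profile p K A psi
      & [set T *m (z - q) | z in Om `&` V] = cusp_region l A psi].

Definition caltrop Om : Prop :=
  bounded_domain Om /\
  exists Q : set 'cV[C]_n,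
    [/\ finite_set Q /\ Q !=set0, Q `<=` bdry Om,
        forall p, (bdry Om `\` Q) p -> C2_boundary_at Om p,
        forall p, (bdry Om `\` Q) p -> strongly_levi_pseudoconvex_at Om p
      & forall q, Q q -> cusp_at Om q].

End Caltrop.

(* Main.v *)
Require Import Defs.
From HB Require Import structures.
From mathcomp Require Import all_boot all_order all_algebra.
From mathcomp Require Import all_classical all_reals all_analysis measurable_realfun.
From mathcomp Require Import complex ring lra.

Set Implicit Arguments.
Unset Strict Implicit.
Unset Printing Implicit Defensive.

Import Order.TTheory GRing.Theory Num.Theory.
Import numFieldNormedType.Exports.

Local Open Scope ring_scope.
Local Open Scope classical_set_scope.

(* Visibility. A Levi polynomial composed with analytic discs gives the bound
   ||v|| <= K sqrt(delta(z)) kappa(z; v) near a strongly pseudoconvex boundary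
   point, and moving inwards gives k(z, z0) <= K (1 + log (1 + 1 / delta(z))).
   An almost-geodesic from V to W has to cross an annulus that contains none of
   the finitely many exceptional points, so it travels a definite Euclidean
   length away from them.  Were it to stay close to the boundary, the lower
   bound for almost-geodesics against the logarithmic upper bound would make
   delta decay exponentially on both sides of a point where delta is largest,
   so that the integral of sqrt(delta), hence that length, would be small.

   Failure of the Goldilocks condition. Near a tip a disc followed by the last
   coordinate has real part x > 0 and imaginary part at most K x^p, so Harnack's
   inequality and the Borel-Caratheodory estimate yield
   |v_n| <= C x^p kappa(z; v).  Hence k(z0, .) grows at least like x^(1-p)
   along the axis, whereas delta is at least of order x^p there, and x^(1-p)
   is not O(log (1/x)). *)

(** * Real analysis and Goursat's theorem *)

Section RealAnalysis.
Variable R : realType.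
Implicit Types (f F : R -> R) (a b x : R).

(** Three obstacles shape the proof. No contour integral enters: Goursat's bisection works with
    increments of primitives, and every estimate for discs is [max_principle] applied to a suitable
    quotient. Next, no measurability of [kobm] along a path is established. Upper bounds for [kobd]
    therefore use paths with a pointwise bound on their speed, and lower bounds use a measurable
    minorant, the positive part of the derivative of a test function. Finally, an almost-geodesic is
    only absolutely continuous, so its displacement is compared with an explicit primitive by a
    covering argument. The square root in the metric estimate arises because a disc through z
    satisfies |phi'(0)|^2 <= const * (- rho z), while - rho z <= const * delta z. A positive power
    of delta is what is wanted, since it stays integrable when delta decays exponentially. At a cusp
    p > 1 is decisive: the metric dominates x^(-p) |dx|, whose integral up to the tip grows like a
    power of 1/x and not like a logarithm. *)

Lemma mvt_closed f (df : R -> R) a b : a <= b ->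
  (forall x, a <= x <= b -> is_derive x 1 f (df x)) ->
  exists2 c, a <= c <= b & f b - f a = df c * (b - a).
Proof.
rewrite le_eqVlt => /predU1P[->|ab] dfE.
  by exists b; rewrite ?lexx// !subrr mulr0.
have [||c cab ->] := @MVT R f df a b ab.
- by move=> x /[!in_itv]/= /andP[/ltW ax /ltW xb]; apply: dfE; rewrite ax xb.
- apply: derivable_within_continuous => x /[!in_itv]/= xab.
  by have [] := dfE _ xab.
by exists c => //; move: cab; rewrite in_itv/= => /andP[/ltW-> /ltW->].
Qed.

Lemma primitive_exists f a b : continuous f ->
  exists F, forall x, a < x < b -> is_derive x 1 F (f x).
Proof.
move=> cf; exists (fun x => \int[lebesgue_measure]_(t in `[a, x]) f t).
move=> x /andP[ax xb].
have fi : lebesgue_measure.-integrable `[a, b] (EFin \o f).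
  apply: continuous_compact_integrable; first exact: segment_compact.
  exact: continuous_subspaceT.
have [dF <-] := @continuous_FTC1_closed R f a x b xb fi ax (cf x).
by rewrite derive1E; exact: DeriveDef.
Qed.

(** For fixed [a] and [b] the choice depends on [f] only as a function, so equal integrands have
    equal primitives; [max_principle] uses this to cancel two opposite sides of a rectangle. *)
Definition primitive a b f : R -> R :=
  xget (cst 0) [set F | forall x, a < x < b -> is_derive x 1 F (f x)].

Lemma primitiveP a b f x : continuous f -> a < x < b ->
  is_derive x 1 (primitive a b f) (f x).
Proof.
by move=> cf; move: x; exact: (@xgetPex _ (cst 0) _ (primitive_exists a b cf)).
Qed.

End RealAnalysis.

(** * Bisection of rectangles *)

Section Bisection.
Variable R : realType.

Lemma nested_halving (u : nat -> R) w : 0 <= w ->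
  (forall k, u k <= u k.+1 /\ u k.+1 + w / 2 ^+ k.+1 <= u k + w / 2 ^+ k) ->
  exists s, forall k, u k <= s <= u k + w / 2 ^+ k.
Proof.
move=> w0 hu.
have wk k : 0 <= w / 2 ^+ k by rewrite divr_ge0// exprn_ge0.
have mono j i : u j <= u (j + i)%N /\ u (j + i)%N + w / 2 ^+ (j + i) <= u j + w / 2 ^+ j.
  elim: i => [|i [IH1 IH2]]; first by rewrite addn0 !lexx.
  rewrite addnS; have [h1 h2] := hu (j + i)%N.
  by split; [exact: le_trans h1|exact: le_trans IH2].
have ub j k : u k <= u j + w / 2 ^+ j.
  have [/subnKC <-|/ltnW/subnKC <-] := leqP k j.
    apply: (le_trans (mono k (j - k)%N).1).
    by rewrite lerDl.
  apply: le_trans (mono j (k - j)%N).2.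
  by rewrite lerDl.
have hs : has_sup (range u).
  split; first by exists (u 0%N), 0%N.
  by exists (u 0%N + w / 2 ^+ 0) => _ [k _ <-].
exists (sup (range u)) => k; apply/andP; split.
  by apply: ub_le_sup; [exact: hs.2|exists k].
by apply: ge_sup; [exact: hs.1|move=> _ [j _ <-]].
Qed.

(** This quantity is additive under subdivision of the rectangle. For [E = B - A] as in [goursat] it
    is the integral of the form around the boundary. *)
Definition ddiff (E : R -> R -> R) s1 s2 t1 t2 :=
  E s2 t2 - E s2 t1 - E s1 t2 + E s1 t1.

(** Otherwise, among the four quarters of a rectangle one carries at least a quarter of the absolute
    value, and repeated choice gives nested rectangles shrinking to a point (s, t). The local bound
    there, taken with half of the initial value as [e], is violated by a late rectangle. *)
Lemma ddiff_bisect (E : R -> R -> R) s1 s2 t1 t2 : s1 <= s2 -> t1 <= t2 ->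
  (forall s t, s1 <= s <= s2 -> t1 <= t <= t2 -> forall e, 0 < e ->
    exists2 d : R, 0 < d & forall k a c, a <= s <= a + (s2 - s1) / 2 ^+ k ->
      c <= t <= c + (t2 - t1) / 2 ^+ k ->
      s1 <= a -> a + (s2 - s1) / 2 ^+ k <= s2 ->
      t1 <= c -> c + (t2 - t1) / 2 ^+ k <= t2 -> (2 ^+ k)^-1 < d ->
      `|ddiff E a (a + (s2 - s1) / 2 ^+ k) c (c + (t2 - t1) / 2 ^+ k)|
        <= e / 4 ^+ k) ->
  ddiff E s1 s2 t1 t2 = 0.
Proof.
move=> s12 t12 loc; apply: contrapT => /eqP; rewrite -normr_gt0 => eta_gt0.
set eta := `|_| in eta_gt0.
set w := s2 - s1 in loc; set h := t2 - t1 in loc.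
have w0 : 0 <= w by rewrite subr_ge0.
have h0 : 0 <= h by rewrite subr_ge0.
pose bad k (x : R * R) := [/\ s1 <= x.1, x.1 + w / 2 ^+ k <= s2, t1 <= x.2,
  x.2 + h / 2 ^+ k <= t2 &
  eta / 4 ^+ k <= `|ddiff E x.1 (x.1 + w / 2 ^+ k) x.2 (x.2 + h / 2 ^+ k)|].
have bad0 : bad 0%N (s1, t1).
  rewrite /bad /= !expr0 !divr1 /w /h.
  by rewrite !lexx (addrC s1) (addrC t1) !subrK !lexx.
have step k x : bad k x -> exists y, [/\ bad k.+1 y, x.1 <= y.1,
    y.1 + w / 2 ^+ k.+1 <= x.1 + w / 2 ^+ k, x.2 <= y.2 &
    y.2 + h / 2 ^+ k.+1 <= x.2 + h / 2 ^+ k].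
  case: x => a c [/= a1 a2 c1 c2 hE].
  have wE : w / 2 ^+ k = w / 2 ^+ k.+1 + w / 2 ^+ k.+1.
    by rewrite exprS; field; apply: expf_neq0.
  have hE' : h / 2 ^+ k = h / 2 ^+ k.+1 + h / 2 ^+ k.+1.
    by rewrite exprS; field; apply: expf_neq0.
  have eE : eta / 4 ^+ k = 4 * (eta / 4 ^+ k.+1).
    by rewrite exprS; field; apply: expf_neq0.
  rewrite wE hE' eE in a2 c2 hE.
  have w'0 : 0 <= w / 2 ^+ k.+1 by rewrite divr_ge0// exprn_ge0.
  have h'0 : 0 <= h / 2 ^+ k.+1 by rewrite divr_ge0// exprn_ge0.
  rewrite /bad /= wE hE'.
  move: (w / _) (h / _) (eta / _) w'0 h'0 a2 c2 hE {wE hE' eE}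
    => w' h' eta' w'0 h'0 a2 c2 hE.
  apply: contrapT => no.
  (* If no quarter were bad, the four double differences, each less than [eta'] in absolute value,
     would add up to less than [4 * eta']. *)
  have nob a' c' : (a' == a) || (a' == a + w') -> (c' == c) || (c' == c + h') ->
      `|ddiff E a' (a' + w') c' (c' + h')| < eta'.
    move=> ha hc; rewrite ltNge; apply/negP => hh; apply: no.
    exists (a', c') => /=.
    by move: ha hc => /orP[]/eqP ? /orP[]/eqP ?; subst a' c';
      do !split => //; clear - a1 a2 c1 c2 w'0 h'0; lra.
  have := nob a c; rewrite !eqxx => /(_ isT isT).
  have := nob (a + w') c; rewrite !eqxx orbT => /(_ isT isT).
  have := nob a (c + h'); rewrite !eqxx orbT => /(_ isT isT).
  have := nob (a + w') (c + h'); rewrite !eqxx !orbT => /(_ isT isT).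
  move: hE; rewrite /ddiff !addrA.
  rewrite !ltr_norml ler_normr.
  by move=> + /andP[] + + /andP[] + + /andP[] + + /andP[]; clear; lra.
pose nxt k x := xget x [set y | [/\ bad k.+1 y, x.1 <= y.1,
    y.1 + w / 2 ^+ k.+1 <= x.1 + w / 2 ^+ k, x.2 <= y.2 &
    y.2 + h / 2 ^+ k.+1 <= x.2 + h / 2 ^+ k]].
pose u := fix u k := if k is k'.+1 then nxt k' (u k') else (s1, t1).
have badu k : bad k (u k).
  elim: k => //= k IH; rewrite /nxt.
  by have [] := @xgetPex _ (u k) _ (step _ _ IH).
have uS k := @xgetPex _ (u k) _ (step _ _ (badu k)).
have [|s hs] := @nested_halving (fun k => (u k).1) w w0.
  by move=> k; have [] := uS k.
have [|t ht] := @nested_halving (fun k => (u k).2) h h0.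
  by move=> k; have [] := uS k.
have hs0 : s1 <= s <= s2.
  by have := hs 0%N; rewrite /= expr0 divr1 /w; lra.
have ht0 : t1 <= t <= t2.
  by have := ht 0%N; rewrite /= expr0 divr1 /h; lra.
have [|d d0 {}loc] := loc s t hs0 ht0 (eta / 2); first by rewrite divr_gt0.
have [k kd] : exists k, (2 ^+ k)^-1 < d.
  exists (Num.truncn d^-1).+1.
  rewrite invf_plt ?posrE ?exprn_gt0//.
  apply: (lt_le_trans (truncnS_gt _)).
  by rewrite -natrX ler_nat ltnW// ltn_expl.
have [b1 b2 b3 b4 b5] := badu k.
have := loc k _ _ (hs k) (ht k) b1 b2 b3 b4 kd.
apply/negP; rewrite -ltNge; apply: lt_le_trans b5.
rewrite ltr_pM2r ?invr_gt0 ?exprn_gt0//.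
by rewrite ltr_pdivrMr// ltr_pMr// ltr1n.
Qed.

End Bisection.

Section Goursat.
Variable R : realType.

(** Differentiability is taken relative to the closed rectangle, so that the integrand may be
    altered outside it, as [max_principle] does. *)
Definition rdiff_on (s1 s2 t1 t2 : R) (P : R -> R -> R) s t p q :=
  forall e, 0 < e -> exists2 d, 0 < d & forall s' t',
    s1 <= s' <= s2 -> t1 <= t' <= t2 -> `|s' - s| < d -> `|t' - t| < d ->
    `|P s' t' - P s t - p * (s' - s) - q * (t' - t)|
      <= e * (`|s' - s| + `|t' - t|).

(* The form P ds + Q dt integrates to zero around the rectangle; its integrals
   along the sides are written as increments of the primitives A and B. *)
Lemma goursat (P Q A B : R -> R -> R) (s1 s2 t1 t2 : R) : s1 <= s2 -> t1 <= t2 ->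
  (forall s t : R, s1 <= s <= s2 -> t1 <= t <= t2 ->
    is_derive s 1 (A ^~ t) (P s t)) ->
  (forall s t : R, s1 <= s <= s2 -> t1 <= t <= t2 ->
    is_derive t 1 (B s) (Q s t)) ->
  (forall s t : R, s1 <= s <= s2 -> t1 <= t <= t2 -> exists p q r,
    rdiff_on s1 s2 t1 t2 P s t p q /\ rdiff_on s1 s2 t1 t2 Q s t q r) ->
  ddiff (fun s t => B s t - A s t) s1 s2 t1 t2 = 0.
Proof.
move=> s12 t12 dA dB dPQ; apply: ddiff_bisect => // s t hs ht e e0.
have [p [q [r [dP dQ]]]] := dPQ s t hs ht.
set w := s2 - s1; set h := t2 - t1.
have w0 : 0 <= w by rewrite subr_ge0.
have h0 : 0 <= h by rewrite subr_ge0.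
(* A subrectangle with sides w' and h' will contribute an error of at most 2 e' (w' + h')^2, that is
   2 e' (w + h)^2 / 4^k; the summand 1 avoids a division by zero. *)
pose e' := e / (2 * (w + h) ^+ 2 + 1).
have De0 : 0 < 2 * (w + h) ^+ 2 + 1 by rewrite ltr_wpDl// mulr_ge0// sqr_ge0.
have e'0 : 0 < e' by rewrite divr_gt0.
have [d1 d10 {}dP] := dP e' e'0.
have [d2 d20 {}dQ] := dQ e' e'0.
exists (Num.min d1 d2 / (w + h + 1)).
  by rewrite divr_gt0 ?lt_min ?d10// ltr_wpDl// addr_ge0.
move=> k a c ha hc a1 a2 c1 c2 kd.
have wh1 : 0 < w + h + 1 by clear - w0 h0; lra.
have k0 : 0 < (2 ^+ k)^-1 :> R by rewrite invr_gt0 exprn_gt0.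
have [w' w'E] : exists w', w' = w / 2 ^+ k by exists (w / 2 ^+ k).
have [h' h'E] : exists h', h' = h / 2 ^+ k by exists (h / 2 ^+ k).
rewrite -w'E -h'E in ha hc a2 c2 *.
have w'0 : 0 <= w' by rewrite w'E divr_ge0// exprn_ge0.
have h'0 : 0 <= h' by rewrite h'E divr_ge0// exprn_ge0.
have kd' : (w + h + 1) / 2 ^+ k < Num.min d1 d2.
  by move: kd; rewrite ltr_pdivlMr// mulrC.
have wd : w' + h' < Num.min d1 d2.
  apply: le_lt_trans kd'; rewrite w'E h'E -mulrDl ler_pM2r//; clear; lra.
move: wd; rewrite lt_min => /andP[wd1 wd2].
have dP' s' t' : a <= s' <= a + w' -> c <= t' <= c + h' ->
    `|P s' t' - P s t - p * (s' - s) - q * (t' - t)| <= e' * (w' + h').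
  move=> hs' ht'.
  have h1 : `|s' - s| <= w' by rewrite ler_norml; clear - hs' ha; lra.
  have h2 : `|t' - t| <= h' by rewrite ler_norml; clear - ht' hc; lra.
  apply: (le_trans (dP s' t' _ _ _ _));
    [clear - hs' a1 a2; lra|clear - ht' c1 c2; lra|clear - h1 wd1 h'0; lra|
     clear - h2 wd1 w'0; lra|].
  by rewrite ler_pM2l// lerD.
have dQ' s' t' : a <= s' <= a + w' -> c <= t' <= c + h' ->
    `|Q s' t' - Q s t - q * (s' - s) - r * (t' - t)| <= e' * (w' + h').
  move=> hs' ht'.
  have h1 : `|s' - s| <= w' by rewrite ler_norml; clear - hs' ha; lra.
  have h2 : `|t' - t| <= h' by rewrite ler_norml; clear - ht' hc; lra.
  apply: (le_trans (dQ s' t' _ _ _ _));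
    [clear - hs' a1 a2; lra|clear - ht' c1 c2; lra|clear - h1 wd2 h'0; lra|
     clear - h2 wd2 w'0; lra|].
  by rewrite ler_pM2l// lerD.
(* The mean value theorem is applied to the difference of two opposite sides, which yields the
   increments of P and of Q across the rectangle at a common point. Their main parts are q h' and q
   w' with the same q, because the form is closed; multiplied by w' and h' they cancel. *)
have [||x hx Ax] := @mvt_closed R (fun x => A x (c + h') - A x c)
   (fun x => P x (c + h') - P x c) a (a + w').
- by clear - w'0; lra.
- by move=> x hx; apply: is_deriveB; apply: dA;
    [clear - hx a1 a2|clear - c1 c2 h'0|clear - hx a1 a2|clear - c1 c2 h'0]; lra.
have [||y hy By] := @mvt_closed R (fun x => B (a + w') x - B a x)
   (fun x => Q (a + w') x - Q a x) c (c + h').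
- by clear - h'0; lra.
- by move=> y hy; apply: is_deriveB; apply: dB;
    [clear - w'0 a1 a2|clear - c1 c2 hy|clear - w'0 a1 a2|clear - c1 c2 hy]; lra.
have cc : c <= c <= c + h' by rewrite lexx lerDl.
have cc' : c <= c + h' <= c + h' by rewrite lexx lerDl h'0.
have aa : a <= a <= a + w' by rewrite lexx lerDl.
have aa' : a <= a + w' <= a + w' by rewrite lexx lerDl w'0.
have Pc := dP' x c hx cc; have Pc' := dP' x (c + h') hx cc'.
have Qa := dQ' a y aa hy; have Qa' := dQ' (a + w') y aa' hy.
have e1 : `|P x (c + h') - P x c - q * h'| <= 2 * (e' * (w' + h')).
  by clear - Pc Pc'; move: Pc Pc'; rewrite !ler_norml; lra.
have e2 : `|Q (a + w') y - Q a y - q * w'| <= 2 * (e' * (w' + h')).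
  by clear - Qa Qa'; move: Qa Qa'; rewrite !ler_norml; lra.
have -> : ddiff (fun s0 t0 => B s0 t0 - A s0 t0) a (a + w') c (c + h') =
    h' * (Q (a + w') y - Q a y - q * w') - w' * (P x (c + h') - P x c - q * h').
  by rewrite /ddiff; move: Ax By; clear; lra.
apply: (le_trans (ler_normB _ _)); rewrite !normrM (ger0_norm w'0) (ger0_norm h'0).
apply: (@le_trans _ _ (h' * (2 * (e' * (w' + h'))) + w' * (2 * (e' * (w' + h'))))).
  by rewrite lerD// ler_wpM2l.
have -> : h' * (2 * (e' * (w' + h'))) + w' * (2 * (e' * (w' + h'))) =
    e' * (2 * (w + h) ^+ 2) / 4 ^+ k.
  rewrite w'E h'E (_ : 4 = 2 * 2 :> R); last by rewrite -natrM.
  by rewrite exprMn; field; rewrite expf_neq0.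
rewrite ler_pM2r ?invr_gt0 ?exprn_gt0//.
rewrite /e' mulrAC ler_pdivrMr// ler_pM2l//; clear; lra.
Qed.

End Goursat.

Section EpsilonDerivative.

Lemma is_derive_eps (K : numFieldType) (f : K -> K) (x a : K) :
  is_derive x 1 f a -> forall e, 0 < e -> exists2 d : K, 0 < d &
    forall y, `|y - x| < d -> `|f y - f x - a * (y - x)| <= e * `|y - x|.
Proof.
case=> dfx aE e e0; have : h^-1 *: (f (h *: 1 + x) - f x) @[h --> 0^'] --> a.
  by rewrite -aE; exact: dfx.
move=> /cvgrPdist_le /(_ _ e0) /nbhs_ballP[d /= d0 hd]; exists d => // y yx.
have [->|yx0] := eqVneq y x; first by rewrite !subrr mulr0 subr0 normr0 mulr0.
have := hd (y - x); rewrite /ball /= sub0r normrN => /(_ yx).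
rewrite subr_eq0 => /(_ yx0); rewrite /GRing.scale /= mulr1 subrK => h.
have yx0' : y - x != 0 by rewrite subr_eq0.
have -> : f y - f x - a * (y - x) = (y - x) * - (a - (y - x)^-1 * (f y - f x)).
  by field.
by rewrite normrM normrN mulrC ler_wpM2r.
Qed.

Variable R : realType.

Lemma is_derive_prod_eps (F G : R -> R) (s t F' G' : R) :
  is_derive s 1 F F' -> is_derive t 1 G G' ->
  forall e, 0 < e -> exists2 d, 0 < d & forall s' t',
    `|s' - s| < d -> `|t' - t| < d ->
    `|F s' * G t' - F s * G t - F' * G t * (s' - s) - F s * G' * (t' - t)|
      <= e * (`|s' - s| + `|t' - t|).
Proof.
move=> /is_derive_eps dF /is_derive_eps dG e e0.
pose M := 1 + `|F s| + `|G t|.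
have M0 : 0 < M by rewrite /M -addrA ltr_pwDl// addr_ge0.
pose N := (1 + `|F'|) * (1 + `|G'|).
have N0 : 0 < N by rewrite mulr_gt0// ltr_pwDl.
pose e1 := Num.min 1 (e / 2 / M).
have e10 : 0 < e1 by rewrite lt_min ltr01 !divr_gt0.
have e11 : e1 <= 1 by rewrite ge_min lexx.
have e1M : e1 * M <= e / 2 by rewrite -ler_pdivlMr// ge_min lexx orbT.
have [d1 d10 {}dF] := dF e1 e10; have [d2 d20 {}dG] := dG e1 e10.
exists (Num.min (e / 2 / N) (Num.min d1 d2)).
  by rewrite !lt_min d10 d20 !divr_gt0.
move=> s' t'; rewrite !lt_min => /andP[sN /andP[sd1 _]] /andP[_ /andP[_ td2]].
have := dF s' sd1; have := dG t' td2.
set A := F s' - _ - _; set B := G t' - _ - _ => hB hA.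
have -> : F s' * G t' - F s * G t - F' * G t * (s' - s) - F s * G' * (t' - t) =
  A * G t + F s * B + (A + F' * (s' - s)) * (B + G' * (t' - t)).
  by rewrite /A /B; ring.
set u := `|s' - s| in sN sd1 hA *; set v := `|t' - t| in td2 hB *.
have u0 : 0 <= u by exact: normr_ge0.
have v0 : 0 <= v by exact: normr_ge0.
have h1 : `|A * G t| <= e1 * `|G t| * u.
  by rewrite normrM mulrAC ler_wpM2r.
have h2 : `|F s * B| <= e1 * `|F s| * v.
  by rewrite normrM mulrAC mulrC ler_wpM2r.
have h3 : `|A + F' * (s' - s)| <= (1 + `|F'|) * u.
  rewrite (le_trans (ler_normD _ _))// mulrDl normrM lerD// mul1r.
  by rewrite (le_trans hA)// ler_piMl.
have h4 : `|B + G' * (t' - t)| <= (1 + `|G'|) * v.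
  rewrite (le_trans (ler_normD _ _))// mulrDl normrM lerD// mul1r.
  by rewrite (le_trans hB)// ler_piMl.
have h5 : `|(A + F' * (s' - s)) * (B + G' * (t' - t))| <= e / 2 * v.
  rewrite normrM (le_trans (ler_pM _ _ h3 h4))//.
  rewrite mulrACA -/N mulrA ler_wpM2r// mulrC -ler_pdivlMr//; exact: ltW.
have h6 : e1 * `|G t| * u <= e / 2 * u.
  rewrite ler_wpM2r// (le_trans _ e1M)// ler_wpM2l ?ltW// /M; have := normr_ge0 (F s); clear; lra.
have h7 : e1 * `|F s| * v <= e / 2 * v.
  rewrite ler_wpM2r// (le_trans _ e1M)// ler_wpM2l ?ltW// /M; have := normr_ge0 (G t); clear; lra.
apply: (le_trans (ler_normD _ _)); apply: (le_trans (lerD (ler_normD _ _) (lexx _))).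
have eu : 0 <= e / 2 * u by rewrite mulr_ge0// divr_ge0// ltW.
clear - h1 h2 h5 h6 h7 eu; lra.
Qed.

End EpsilonDerivative.

(** * Estimates for holomorphic functions on discs *)

Section ComplexBasics.
Variable R : realType.
Local Notation C := (Cplx R).
Implicit Types x y : C.

Lemma cReD x y : complex.Re (x + y) = complex.Re x + complex.Re y.
Proof. by case: x; case: y. Qed.
Lemma cImD x y : complex.Im (x + y) = complex.Im x + complex.Im y.
Proof. by case: x; case: y. Qed.
Lemma cReN x : complex.Re (- x) = - complex.Re x.
Proof. by case: x. Qed.
Lemma cImN x : complex.Im (- x) = - complex.Im x.
Proof. by case: x. Qed.
Lemma cReM x y : complex.Re (x * y) =
  complex.Re x * complex.Re y - complex.Im x * complex.Im y.
Proof. by case: x; case: y. Qed.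
Lemma cImM x y : complex.Im (x * y) =
  complex.Re x * complex.Im y + complex.Im x * complex.Re y.
Proof. by case: x; case: y. Qed.
Lemma cRe_conj x : complex.Re x^* = complex.Re x.
Proof. by case: x. Qed.
Lemma cIm_conj x : complex.Im x^* = - complex.Im x.
Proof. by case: x. Qed.

Lemma complex_ext x y : complex.Re x = complex.Re y ->
  complex.Im x = complex.Im y -> x = y.
Proof. by case: x => a b; case: y => c d /= -> ->. Qed.

Lemma cabsE x : cabs x = Num.sqrt (complex.Re x ^+ 2 + complex.Im x ^+ 2).
Proof. by case: x. Qed.
Lemma cabs_sqr x : cabs x ^+ 2 = complex.Re x ^+ 2 + complex.Im x ^+ 2.
Proof. by rewrite cabsE sqr_sqrtr// addr_ge0// sqr_ge0. Qed.
Lemma cabs_ge0 x : 0 <= cabs x.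
Proof. by rewrite cabsE sqrtr_ge0. Qed.
Lemma normc_cabs x : `|x| = ((cabs x)%:C)%C :> C.
Proof. by apply: complex_ext => //=; rewrite normc_def. Qed.
Lemma le_real (a b : R) : ((a%:C)%C <= (b%:C)%C :> C) = (a <= b).
Proof. by rewrite lecR. Qed.
Lemma lt_real (a b : R) : ((a%:C)%C < (b%:C)%C :> C) = (a < b).
Proof. by rewrite ltcR. Qed.
Lemma cabs_real (a : R) : cabs ((a%:C)%C : C) = `|a|.
Proof. by rewrite cabsE /= expr0n /= addr0 sqrtr_sqr. Qed.
Lemma cabsM x y : cabs (x * y) = cabs x * cabs y.
Proof. by rewrite {1}/cabs normrM !normc_cabs cReM /= mulr0 subr0. Qed.
Lemma cabsD x y : cabs (x + y) <= cabs x + cabs y.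
Proof.
by have := ler_normD x y; rewrite !normc_cabs -rmorphD /= le_real.
Qed.
Lemma cabsN x : cabs (- x) = cabs x.
Proof. by rewrite /cabs normrN. Qed.
Lemma cabsB x y : cabs (x - y) = cabs (y - x).
Proof. by rewrite -cabsN opprB. Qed.
Lemma cabs0 : cabs (0 : C) = 0.
Proof. by rewrite /cabs normr0. Qed.
Lemma cabs1 : cabs (1 : C) = 1.
Proof. by rewrite /cabs normr1. Qed.
Lemma cabs_gt0 x : (0 < cabs x) = (x != 0).
Proof. by rewrite -normr_gt0 normc_cabs lt_real. Qed.
Lemma cabs_eq0 x : (cabs x == 0) = (x == 0).
Proof. by rewrite -[RHS]negbK -cabs_gt0 lt_def cabs_ge0 andbT negbK. Qed.
Lemma cabsV x : cabs x^-1 = (cabs x)^-1.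
Proof. by rewrite {1}/cabs normfV normc_cabs -fmorphV. Qed.
Lemma cabs_conj x : cabs x^* = cabs x.
Proof. by rewrite !cabsE cRe_conj cIm_conj sqrrN. Qed.
Lemma Re_le_cabs x : `|complex.Re x| <= cabs x.
Proof.
by rewrite -sqrtr_sqr cabsE ler_sqrt ?addr_ge0 ?sqr_ge0// lerDl sqr_ge0.
Qed.
Lemma Im_le_cabs x : `|complex.Im x| <= cabs x.
Proof.
by rewrite -sqrtr_sqr cabsE ler_sqrt ?addr_ge0 ?sqr_ge0// lerDr sqr_ge0.
Qed.
Lemma cabs_le_ReIm x : cabs x <= `|complex.Re x| + `|complex.Im x|.
Proof.
have n0 : 0 <= `|complex.Re x| + `|complex.Im x| by rewrite addr_ge0.
rewrite -(ler_pXn2r (n := 2)) ?nnegrE ?cabs_ge0// cabs_sqr sqrrD.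
rewrite !real_normK ?num_real// -addrA (addrC (_ *+ 2)) addrA lerDl.
by rewrite mulrn_wge0// mulr_ge0.
Qed.
Lemma normC_lt x (a : R) : (`|x| < (a%:C)%C) = (cabs x < a).
Proof. by rewrite normc_cabs lt_real. Qed.

Lemma realC_gt0 (e : C) : 0 < e -> e = ((complex.Re e)%:C)%C /\ 0 < complex.Re e.
Proof. by case: e => a b; rewrite ltcE /= => /andP[/eqP -> ->]. Qed.

Lemma nbhs_cabs x (P : set C) :
  nbhs x P <-> exists2 e : R, 0 < e & forall y, cabs (y - x) < e -> P y.
Proof.
split.
  move=> /nbhs_ballP[e /= /realC_gt0[-> e0] hP]; exists (complex.Re e) => // y yx.
  by apply: hP; rewrite /ball /= normC_lt cabsB.
move=> [e e0 hP]; apply/nbhs_ballP; exists ((e%:C)%C) => /=.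
  by rewrite -[0]/((0%:C)%C) lt_real.
by move=> y; rewrite /ball /= normC_lt cabsB; exact: hP.
Qed.

Lemma is_derive_cabs (f : C -> C) (x a : C) :
  is_derive x 1 f a -> forall e : R, 0 < e -> exists2 d : R, 0 < d &
    forall y, cabs (y - x) < d -> cabs (f y - f x - a * (y - x)) <= e * cabs (y - x).
Proof.
move=> /is_derive_eps df e e0.
have [|d /realC_gt0[-> d0] hd] := df ((e%:C)%C).
  by rewrite -[0]/((0%:C)%C) lt_real.
exists (complex.Re d) => // y yx.
have := hd y; rewrite normC_lt => /(_ yx).
by rewrite !normc_cabs -rmorphM /= le_real.
Qed.

Definition cpx (a b : R) : C := (a +i* b)%C.
Lemma Re_cpx a b : complex.Re (cpx a b) = a.
Proof. by []. Qed.
Lemma Im_cpx a b : complex.Im (cpx a b) = b.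
Proof. by []. Qed.
Definition cexp (s t : R) : C := cpx (expR s * cos t) (expR s * sin t).

Lemma cabs_cexp s t : cabs (cexp s t) = expR s.
Proof.
rewrite cabsE /= !exprMn -mulrDr cos2Dsin2 mulr1 sqrtr_sqr ger0_norm// expR_ge0.
Qed.

Lemma cexp_eps s t e : 0 < e -> exists2 d, 0 < d & forall s' t',
  `|s' - s| < d -> `|t' - t| < d ->
  cabs (cexp s' t' - cexp s t - cexp s t * cpx (s' - s) (t' - t))
    <= e * (`|s' - s| + `|t' - t|).
Proof.
move=> e0; have e20 : 0 < e / 2 by rewrite divr_gt0.
have [d1 d10 h1] := is_derive_prod_eps (is_derive_expR s) (is_derive_cos t) e20.
have [d2 d20 h2] := is_derive_prod_eps (is_derive_expR s) (is_derive_sin t) e20.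
exists (Num.min d1 d2); first by rewrite lt_min d10.
move=> s' t'; rewrite !lt_min => /andP[s1 s2] /andP[t1 t2].
apply: (le_trans (cabs_le_ReIm _)).
have := h1 s' t' s1 t1; have := h2 s' t' s2 t2.
rewrite /cexp /=.
set a := `|_| => ha; set b := `|_| => hb; set c := `|_|; set d := `|_|.
have -> : c = b by rewrite /b /c; congr `|_|; rewrite -[LHS]/(_ + _); ring.
have -> : d = a by rewrite /a /d; congr `|_|; ring.
move: (`|s' - s|) (`|t' - t|) ha hb => u v; clear; lra.
Qed.

End ComplexBasics.

(** * Maximum principle on a punctured disc *)

Section MaxPrinciple.
Variable R : realType.
Local Notation C := (Cplx R).

Lemma eps_is_derive (f : R -> R) (x a : R) :
  (forall e, 0 < e -> exists2 d, 0 < d & forall y,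
    `|y - x| < d -> `|f y - f x - a * (y - x)| <= e * `|y - x|) ->
  is_derive x 1 f a.
Proof.
move=> H.
have cv : h^-1 *: (f (h *: (1 : R) + x) - f x) @[h --> 0^'] --> a.
  apply/cvgrPdist_le => e e0; have [d d0 hd] := H e e0.
  apply/nbhs_ballP; exists d => //= h; rewrite /ball /= sub0r normrN => hd' h0.
  have := hd (h + x); rewrite addrK => /(_ hd') hh.
  rewrite /GRing.scale /= mulr1 distrC.
  have -> : h^-1 * (f (h + x) - f x) - a = h^-1 * (f (h + x) - f x - a * h).
    by field.
  by rewrite normrM normfV mulrC ler_pdivrMr ?normr_gt0.
by apply: DeriveDef; [apply/cvg_ex; exists a|exact: cvg_lim cv].
Qed.

Lemma is_derive_continuous (f : R -> R) (x a : R) :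
  is_derive x 1 f a -> {for x, continuous f}.
Proof. by case=> d _; apply: differentiable_continuous; apply/derivable1_diffP. Qed.

(** In logarithmic polar coordinates the differential is still multiplication by a complex number,
    here [a * cexp s t]. This is the form in which the Cauchy-Riemann equations enter Goursat's
    theorem. *)
Lemma polar_eps (f : C -> C) (a : C) s t : is_derive (cexp s t) 1 f a ->
  forall e, 0 < e -> exists2 d, 0 < d & forall s' t',
    `|s' - s| < d -> `|t' - t| < d ->
    cabs (f (cexp s' t') - f (cexp s t) -
          a * cexp s t * cpx (s' - s) (t' - t))
      <= e * (`|s' - s| + `|t' - t|).
Proof.
move=> df e e0; set z := cexp s t.
pose M := cabs z + 1; have M0 : 0 < M by rewrite ltr_wpDl// cabs_ge0.
pose N := cabs a + 1; have N0 : 0 < N by rewrite ltr_wpDl// cabs_ge0.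
have [d1 d10 h1] := is_derive_cabs df (divr_gt0 (divr_gt0 e0 (ltr0Sn _ 1)) M0).
have e1 : 0 < Num.min 1 (e / 2 / N) by rewrite lt_min ltr01 !divr_gt0.
have [d2 d20 h2] := cexp_eps s t e1.
exists (Num.min d2 (d1 / 2 / M)); first by rewrite lt_min d20 !divr_gt0.
move=> s' t'; rewrite !lt_min => /andP[s2 s1] /andP[t2 t1].
have := h2 s' t' s2 t2; rewrite -/z.
set w := cexp s' t' - z; set k := cpx _ _.
set S := `|_| + `|_| => hw.
have S0 : 0 <= S by rewrite addr_ge0.
have hk : cabs k <= S by exact: cabs_le_ReIm.
have hw' : cabs (w - z * k) <= S.
  by rewrite (le_trans hw)// ler_piMl// ge_min lexx.
have hw'' : cabs w <= M * S.
  rewrite -(subrK (z * k) w) (le_trans (cabsD _ _))//.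
  rewrite /M mulrDl mul1r addrC lerD// cabsM ler_wpM2l//; exact: cabs_ge0.
have wd : cabs w < d1.
  apply: (le_lt_trans hw''); rewrite mulrC -ltr_pdivlMr// /S.
  by rewrite (_ : d1 / M = d1 / 2 / M + d1 / 2 / M) ?ltrD//; field; exact: lt0r_neq0.
have := h1 _ wd; rewrite -/w => hf.
have -> : f (cexp s' t') - f z - a * z * k =
  (f (cexp s' t') - f z - a * w) + a * (w - z * k) by ring.
apply: (le_trans (cabsD _ _)); rewrite cabsM.
have hA : e / 2 / M * cabs w <= e / 2 * S.
  apply: le_trans (ler_wpM2l _ hw'') _; first by rewrite !divr_ge0// ltW.
  by rewrite mulrA mulfVK ?gt_eqF.
have hB : cabs a * cabs (w - z * k) <= e / 2 * S.
  apply: (@le_trans _ _ (N * (e / 2 / N * S))).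
    apply: ler_pM; rewrite ?cabs_ge0//; first by rewrite /N lerDl.
    by rewrite (le_trans hw)// ler_wpM2r// ge_min lexx orbT.
  by rewrite mulrA mulrC (mulrC N) mulfVK ?gt_eqF// mulrC.
rewrite (_ : e * S = e / 2 * S + e / 2 * S); last by field.
by rewrite lerD// (le_trans hf).
Qed.

(* In the coordinates x = exp(s + it), Goursat's theorem makes the mean of Re f
   over a circle independent of the radius; on small circles the mean is close
   to Re l. *)
Lemma max_principle (f : C -> C) (l : C) (r c : R) : 0 < r < 1 ->
  (forall x, 0 < cabs x < 1 -> derivable f x 1) ->
  f x @[x --> 0^'] --> l ->
  (forall x, cabs x = r -> complex.Re (f x) <= c) -> complex.Re l <= c.
Proof.
move=> /andP[r0 r1] df fl fc; rewrite leNgt; apply/negP => lc.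
have [d0 d00 hd0] : exists2 d : R, 0 < d & forall x, 0 < cabs x < d -> c < complex.Re (f x).
  have : nbhs l [set y | c < complex.Re y].
    apply/nbhs_cabs; exists (complex.Re l - c); first by rewrite subr_gt0.
    move=> y /=; have := Re_le_cabs (y - l); rewrite cReD cReN ler_norml.
    move: (cabs _) (complex.Re y : R) (complex.Re l : R); clear => a b d.
    by move=> /andP[? ?] ?; lra.
  move=> /fl /nbhs_cabs[d d0 hd]; exists d => // x /andP[x0 xd].
  by apply: hd; rewrite ?subr0// -cabs_gt0.
(* The outer circle has radius r. The inner radius is smaller than both r and d0, so that Re f
   exceeds c on the inner circle. *)
pose s1 := ln r; pose s0 := ln (Num.min r d0 / 2).
have m0 : 0 < Num.min r d0 / 2 by rewrite divr_gt0// lt_min r0.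
have minr : Num.min r d0 <= r by rewrite ge_min lexx.
have mind : Num.min r d0 <= d0 by rewrite ge_min lexx orbT.
have s10 : s1 < 0 by apply: ln_lt0; rewrite r0.
have s01 : s0 < s1.
  rewrite ltr_ln ?posrE// ltr_pdivrMr//.
  by rewrite (le_lt_trans minr)// ltr_pMr// ltr1n.
have cz s t : s <= s1 -> 0 < cabs (cexp s t) < 1.
  by move=> ss; rewrite cabs_cexp expR_gt0 expR_lt1 (le_lt_trans ss).
(* Freezing the radius beyond s1 keeps the point in the punctured disc for every s, so that [V] and
   [U] are continuous on the whole line, as [primitiveP] demands. *)
pose z s t := cexp (Num.min s s1) t.
pose U s t := complex.Re (f (z s t)); pose V s t := complex.Im (f (z s t)).
have dz s t : s <= s1 -> is_derive (cexp s t) 1 f ('D_1 f (cexp s t)).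
  by move=> ss; apply: derivableP; apply/df/cz.
have eps s t : s <= s1 -> exists b : C, forall e, 0 < e ->
    exists2 d, 0 < d & forall s' t', `|s' - s| < d -> `|t' - t| < d ->
    cabs (f (cexp s' t') - f (cexp s t) - b * cpx (s' - s) (t' - t))
      <= e * (`|s' - s| + `|t' - t|).
  by move=> ss; eexists; exact: polar_eps (dz s t ss).
have ctn s t : s <= s1 ->
   [/\ {for s, continuous (fun s => complex.Im (f (cexp s t)))} &
   {for t, continuous (fun t => complex.Re (f (cexp s t)))}].
  move=> ss; have [b hb] := eps s t ss; split.
    apply: (@is_derive_continuous _ _ (complex.Im b)); apply: eps_is_derive => e e0.
    have [d dd hd] := hb e e0; exists d => // y yd.
    have := hd y t yd; rewrite !subrr normr0 addr0 => /(_ dd).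
    apply: le_trans; apply: le_trans (Im_le_cabs _).
    by rewrite !(cImD, cImN, cImM) /= mulr0 add0r.
  apply: (@is_derive_continuous _ _ (- complex.Im b)); apply: eps_is_derive => e e0.
  have [d dd hd] := hb e e0; exists d => // y yd.
  have := hd s y; rewrite !subrr normr0 add0r => /(_ dd yd).
  apply: le_trans; apply: le_trans (Re_le_cabs _).
  by rewrite !(cReD, cReN, cReM) /= mulr0 sub0r mulNr opprK.
have cV t : continuous (V ^~ t).
  move=> s; rewrite /V /z.
  apply: (@continuous_comp _ _ _ (fun s => Num.min s s1)
    (fun s => complex.Im (f (cexp s t)))).
    by apply: continuous_min => //; exact: cvg_cst.
  by apply: (ctn _ t _).1; rewrite ge_min lexx orbT.
have cU s : continuous (U s).
  by move=> t; apply: (ctn _ t _).2; rewrite ge_min lexx orbT.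
(* The intervals are larger than the rectangle, which gives two-sided derivatives on its edges
   too. *)
pose A s t := primitive (s0 - 1) (s1 + 1) (V ^~ t) s.
pose B s t := primitive (- 1) (2 * pi + 1) (U s) t.
have pi0 := pi_gt0 R.
have zE s t : s <= s1 -> z s t = cexp s t by move=> ss; rewrite /z min_l.
(* V ds + U dt is the imaginary part of f(x) dx / x, which in these coordinates is f (ds + i dt).
   Its closedness is the equality of dV/dt and dU/ds, both being the real part of b. *)
have : ddiff (fun s t => B s t - A s t) s0 s1 0 (2 * pi) = 0.
  apply: (@goursat R V U A B _ _ _ _ (ltW s01)).
  - by clear - pi0; lra.
  - move=> s t /andP[h1 h2] _; apply: primitiveP => //; clear - h1 h2; lra.
  - move=> s t _ /andP[h1 h2]; apply: primitiveP => //; clear - h1 h2; lra.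
  - move=> s t /andP[_ ss] _; have [b hb] := eps s t ss.
    exists (complex.Im b), (complex.Re b), (- complex.Im b); split=> e e0.
      have [d dd hd] := hb e e0; exists d => // s' t' /andP[_ s's1] _ h1 h2.
      apply: le_trans (hd s' t' h1 h2); apply: le_trans (Im_le_cabs _).
      rewrite /V !zE// !(cImD, cImN, cImM) /= le_eqVlt; apply/orP; left; apply/eqP.
      congr `|_|; ring.
    have [d dd hd] := hb e e0; exists d => // s' t' /andP[_ s's1] _ h1 h2.
    apply: le_trans (hd s' t' h1 h2); apply: le_trans (Re_le_cabs _).
    rewrite /U !zE// !(cReD, cReN, cReM) /= le_eqVlt; apply/orP; left; apply/eqP.
    congr `|_|; ring.
(* The sides at angles 0 and 2 pi have the same integrand, hence the same chosen primitive, and they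
   cancel. What remains is the equality of the integrals of Re f over the two circles. *)
have AE s : A s (2 * pi) = A s 0.
  rewrite /A (_ : V ^~ (2 * pi) = V ^~ 0)//; apply/funext => s'.
  by rewrite /V /z /cexp mulr_natl cos2pi sin2pi cos0 sin0.
rewrite /ddiff !AE.
have mvtB s : s <= s1 -> exists t, B s (2 * pi) - B s 0 = U s t * (2 * pi).
  move=> ss; have [||t _ tE] := @mvt_closed R (B s) (U s) 0 (2 * pi).
  - by clear - pi0; lra.
  - move=> t /andP[h1 h2]; apply: primitiveP => //; clear - h1 h2; lra.
  by exists t; rewrite tE subr0.
have [t tE] := mvtB s1 (lexx _); have [t' t'E] := mvtB s0 (ltW s01).
have : U s1 t <= c.
  rewrite /U; apply: fc; rewrite zE// cabs_cexp lnK//.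
have : c < U s0 t'.
  rewrite /U; apply: hd0; rewrite zE 1?ltW// cabs_cexp lnK ?posrE// m0 /=.
  by rewrite ltr_pdivrMr// (le_lt_trans mind)// ltr_pMr// ltr1n.
move=> h1 h2 h3.
have : U s1 t * (2 * pi) = U s0 t' * (2 * pi) by clear - h3 tE t'E; lra.
move/mulIf; have pi20 : 2 * pi != 0 :> R by rewrite mulf_neq0 ?gt_eqF.
by move=> /(_ pi20) h4; move: h1 h2; rewrite h4; clear; lra.
Qed.

End MaxPrinciple.

Section DiscEstimates.

Lemma is_derive_affine (K : numFieldType) (f : K -> K) (w s a x : K) :
  is_derive (w + s * x) 1 f a -> is_derive x 1 (fun y => f (w + s * y)) (s * a).
Proof.
move=> /is_derive_eps df.
have cv : h^-1 *: (f (w + s * (h *: (1 : K) + x)) - f (w + s * x)) @[h --> 0^'] --> s * a.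
  apply/cvgrPdist_le => e e0.
  have s1 : 0 < `|s| + 1 by rewrite ltr_wpDl.
  have [d d0 hd] := df (e / (`|s| + 1)) (divr_gt0 e0 s1).
  apply/nbhs_ballP; exists (d / (`|s| + 1)) => /=; first exact: divr_gt0.
  move=> h; rewrite /ball /= sub0r normrN => hh h0.
  have E : w + s * (h + x) - (w + s * x) = s * h by ring.
  have := hd (w + s * (h + x)); rewrite E => hd'.
  have Hs : `|s * h| < d.
    rewrite normrM (@le_lt_trans _ _ ((`|s| + 1) * `|h|))//.
      by rewrite ler_wpM2r// lerDl.
    by rewrite mulrC -ltr_pdivlMr.
  have {Hs}hd' := hd' Hs; rewrite /GRing.scale /= mulr1 distrC.
  have -> : h^-1 * (f (w + s * (h + x)) - f (w + s * x)) - s * a =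
    h^-1 * (f (w + s * (h + x)) - f (w + s * x) - a * (s * h)) by field.
  rewrite normrM normfV mulrC ler_pdivrMr ?normr_gt0//.
  apply: le_trans hd' _; rewrite normrM mulrA ler_wpM2r//.
  rewrite mulrAC ler_pdivrMr//; apply: ler_wpM2l; first exact: ltW.
  by rewrite lerDl.
by apply: DeriveDef; [apply/cvg_ex; exists (s * a)|exact: cvg_lim cv].
Qed.

Lemma derivable_cmul (K : numFieldType) (f : K -> K) (k x : K) :
  derivable f x 1 -> derivable (fun y => k * f y) x 1.
Proof.
by move=> df; exact: (@derivableM _ _ (fun=> k) f x 1 (derivable_cst _ _ _) df).
Qed.

Lemma derivable_addc (K : numFieldType) (f : K -> K) (k x : K) :
  derivable f x 1 -> derivable (fun y => f y + k) x 1.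
Proof.
by move=> df; exact: (@derivableD _ _ _ f (fun=> k) x 1 df (derivable_cst _ _ _)).
Qed.

Variable R : realType.
Local Notation C := (Cplx R).

(* The maximum principle for (lam / x + mu x + kap) (f (w + x) - f w), which
   tends to lam D at 0.  The terms mu x + kap serve to make the first factor real
   or imaginary on |x| = r, so that only Re f or only Im f is involved. *)
Lemma quotient_principle (f : C -> C) (w lam mu kap D : C) (r s c : R) :
  0 < r < s -> (forall x, cabs (x - w) < s -> derivable f x 1) ->
  is_derive w 1 f D ->
  (forall x, cabs x = r ->
    complex.Re ((lam / x + mu * x + kap) * (f (w + x) - f w)) <= c) ->
  complex.Re (lam * D) <= c.
Proof.
move=> /andP[r0 rs] df dfw hc.
have s0 : 0 < s by exact: lt_trans rs.
pose S : C := cpx s 0.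
have cS : cabs S = s by rewrite /S cabs_real gtr0_norm.
have S0 : S != 0 by rewrite -cabs_gt0 cS.
pose F x := f (w + S * x).
have dF x : cabs x < 1 -> derivable F x 1.
  move=> x1.
  have : is_derive (w + S * x) 1 f ('D_1 f (w + S * x)).
    apply: derivableP; apply: df.
    by rewrite addrAC subrr add0r cabsM cS -[ltRHS]mulr1 ltr_pM2l.
  by move=> /is_derive_affine[].
have F0 : F 0 = f w by rewrite /F mulr0 addr0.
have dF0 : is_derive (0 : C) 1 F (S * D).
  by apply: is_derive_affine; rewrite mulr0 addr0.
pose G x := (lam / S * x^-1 + mu * S * x + kap) * (F x - F 0).
refine (@max_principle R G (lam * D) (r / s) c _ _ _ _).
- by rewrite divr_gt0//= ltr_pdivrMr// mul1r.
- move=> x /andP[x0 x1].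
  have xn : x != 0 by rewrite -cabs_gt0.
  have dV : derivable (fun y : C => y^-1) x 1.
    by apply: (@derivableV _ _ id) => //; exact: derivable_id.
  have d1 := @derivable_cmul _ _ (lam / S) _ dV.
  have d2 := @derivable_cmul _ _ (mu * S) _ (@derivable_id _ _ x 1).
  have d3 := @derivable_addc _ _ (- F 0) _ (dF x x1).
  exact: (derivableM (@derivable_addc _ _ kap _ (derivableD d1 d2)) d3).
- have q : x^-1 * (F x - F 0) @[x --> 0^'] --> S * D.
    have : h^-1 *: (F (h *: (1 : C) + 0) - F 0) @[h --> 0^'] --> S * D.
      by case: dF0 => d0 <-; exact: d0.
    apply: cvg_trans; apply: near_eq_cvg; apply: nearW => h /=.
    by rewrite /GRing.scale /= mulr1 addr0.
  have x0 : (x : C) @[x --> 0^'] --> (0 : C) by exact: nbhs_dnbhs.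
  have F0' : F x - F 0 @[x --> 0^'] --> (0 : C).
    have FF : Filter ((0 : C)^') by exact: _.
    have H := @cvgM _ _ _ FF _ _ _ _ x0 q; rewrite mul0r in H.
    apply: (cvg_trans _ H); apply: near_eq_cvg.
    near=> x; rewrite /= mulrA mulfV ?mul1r//.
    by near: x; exact: nbhs_dnbhs_neq.
  have FF : Filter ((0 : C)^') by exact: _.
  have c1 := @cvgM _ _ _ FF _ _ _ _ (@cvg_cst _ (lam / S) _ _ FF) q.
  have c2 := @cvgM _ _ _ FF _ _ _ _
    (@cvgM _ _ _ FF _ _ _ _ (@cvg_cst _ (mu * S) _ _ FF) x0) F0'.
  have c3 := @cvgM _ _ _ FF _ _ _ _ (@cvg_cst _ kap _ _ FF) F0'.
  have := @cvgD _ _ _ _ FF _ _ _ _ (@cvgD _ _ _ _ FF _ _ _ _ c1 c2) c3.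
  have -> : lam / S * (S * D) + mu * S * 0 * 0 + kap * 0 = lam * D.
    by rewrite !mulr0 !addr0 mulrA divfK.
  move=> H; apply: cvg_trans H; apply: near_eq_cvg; apply: nearW => x.
  rewrite -[LHS]/(lam / S * (x^-1 * (F x - F 0)) + mu * S * x * (F x - F 0) +
    kap * (F x - F 0)) /G; move: (F x - F 0) => u.
  by rewrite [RHS]mulrDl [X in _ = X + _]mulrDl mulrA.
- move=> x xr; rewrite /G F0 /F.
  have Sx : cabs (S * x) = r by rewrite cabsM cS xr mulrC divfK// gt_eqF.
  have := hc (S * x) Sx; congr (complex.Re (_ * _) <= _).
  have x0 : x != 0 by rewrite -cabs_gt0 xr divr_gt0.
  by field; rewrite x0 S0.
Unshelve. all: by end_near. Qed.

End DiscEstimates.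

Section DerivativeEstimates.
Variable R : realType.
Local Notation C := (Cplx R).
Variables (f : C -> C) (w D : C) (s : R).
Hypothesis s0 : 0 < s.
Hypothesis df : forall x, cabs (x - w) < s -> derivable f x 1.
Hypothesis dfw : is_derive w 1 f D.

(** The choice lam = D^* in [quotient_principle] turns Re (lam D) into |D|^2, and one factor |D| is
    then divided out. *)
Lemma quotient_bound (mu kap : C) (B : R) : 0 <= B ->
  (forall x, cabs x = s / 2 ->
    complex.Re ((D^* / x + mu * x + kap) * (f (w + x) - f w)) <= B * cabs D) ->
  cabs D <= B.
Proof.
move=> B0 h; have r0 : 0 < s / 2 < s.
  by rewrite divr_gt0//= ltr_pdivrMr// ltr_pMr// ltr1n.
have := quotient_principle r0 df dfw h.
rewrite cReM cRe_conj cIm_conj mulNr opprK -!expr2 -cabs_sqr expr2.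
have := cabs_ge0 D; rewrite le_eqVlt => /predU1P[<-//|D0].
by rewrite ler_pM2r.
Qed.

Lemma cauchy_estimate M : (forall x, cabs (x - w) < s -> cabs (f x) <= M) ->
  cabs D <= 4 * M / s.
Proof.
move=> fM; have M0 : 0 <= M.
  by apply: le_trans (fM w _); rewrite ?cabs_ge0// subrr cabs0.
apply: (@quotient_bound 0 0); first by rewrite divr_ge0 ?mulr_ge0// ltW.
move=> x xs; rewrite mul0r !addr0.
apply: le_trans (ler_norm _) _; apply: le_trans (Re_le_cabs _) _.
rewrite !cabsM cabsV xs cabs_conj.
have : cabs (f (w + x) - f w) <= M + M.
  rewrite (le_trans (cabsD _ _))// cabsN lerD// fM ?subrr ?cabs0//.
  by rewrite addrAC subrr add0r xs ltr_pdivrMr// ltr_pMr// ltr1n.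
have -> : 4 * M / s * cabs D = cabs D / (s / 2) * (M + M).
  by field; rewrite gt_eqF.
by apply: ler_wpM2l; rewrite divr_ge0 ?cabs_ge0// divr_ge0// ltW.
Qed.

(** On the circle the term [mu * x] can be made plus or minus the conjugate of v = D^* / x, so that
    the first factor becomes 2 Re v or 2 i Im v. *)
Let conj_quotient x : cabs x = s / 2 ->
  D / cpx (s / 2) 0 ^+ 2 * x = (D^* / x)^*.
Proof.
move=> xs; have x0 : x != 0 by rewrite -cabs_gt0 xs divr_gt0.
have xx : cpx (s / 2) 0 ^+ 2 = x * x^*.
  by rewrite -normCK normc_cabs xs.
have x0' : x^* != 0 by rewrite -cabs_gt0 cabs_conj cabs_gt0.
by rewrite rmorphM /= conjCK fmorphV xx; field; rewrite x0 x0'.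
Qed.

Lemma borel_caratheodory : (forall x, cabs (x - w) < s -> 0 <= complex.Re (f x)) ->
  cabs D <= 8 * complex.Re (f w) / s.
Proof.
move=> fM; have M0 : 0 <= complex.Re (f w) by apply: fM; rewrite subrr cabs0.
(* With this constant the factor is 2 Re v - 2 |v| <= 0. The term with Re f (w + x) >= 0 can then be
   dropped, and the term with Re f w is at most 4 |v| Re f w. *)
apply: (@quotient_bound (D / cpx (s / 2) 0 ^+ 2) (cpx (- (2 * (cabs D / (s / 2)))) 0)).
  by rewrite divr_ge0 ?mulr_ge0// ltW.
move=> x xs; rewrite (conj_quotient xs); set v := D^* / x.
have cv : cabs v = cabs D / (s / 2) by rewrite cabsM cabsV xs cabs_conj.
have fx : 0 <= complex.Re (f (w + x)).
  by rewrite fM// addrAC subrr add0r xs ltr_pdivrMr// ltr_pMr// ltr1n.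
have -> : 8 * complex.Re (f w) / s * cabs D = 4 * complex.Re (f w) * cabs v.
  by rewrite cv; field; rewrite gt_eqF.
rewrite -cv; move: fx M0; rewrite cReM !(cReD, cImD, cReN) cRe_conj cIm_conj /=.
rewrite subrr add0r mul0r subr0.
have := Re_le_cabs v; rewrite ler_norml.
move: (complex.Re v : R) (complex.Re (f w) : R) (complex.Re (f (w + x)) : R) (cabs v).
move=> a b c d /andP[h1 h2] c0 b0.
have : 0 <= (d - a) * c + b * (d + a).
  by rewrite addr_ge0// mulr_ge0//; lra.
by lra.
Qed.

Lemma imaginary_part_estimate M :
  (forall x, cabs (x - w) < s -> `|complex.Im (f x)| <= M) ->
  cabs D <= 8 * M / s.
Proof.
move=> fM; have M0 : 0 <= M.
  by apply: le_trans (fM w _); rewrite ?normr_ge0// subrr cabs0.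
(* The minus sign makes the factor v - v^* purely imaginary, so that only Im f contributes to the
   real part of the product. *)
apply: (@quotient_bound (- (D / cpx (s / 2) 0 ^+ 2)) 0).
  by rewrite divr_ge0 ?mulr_ge0// ltW.
move=> x xs; rewrite mulNr (conj_quotient xs) addr0; set v := D^* / x.
have cv : cabs v = cabs D / (s / 2) by rewrite cabsM cabsV xs cabs_conj.
have fx : `|complex.Im (f (w + x))| <= M.
  by rewrite fM// addrAC subrr add0r xs ltr_pdivrMr// ltr_pMr// ltr1n.
have fw : `|complex.Im (f w)| <= M by rewrite fM// subrr cabs0.
have -> : 8 * M / s * cabs D = 4 * M * cabs v.
  by rewrite cv; field; rewrite gt_eqF.
rewrite cReM !(cReD, cImD, cReN, cImN) cRe_conj cIm_conj.
rewrite subrr mul0r sub0r opprK.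
apply: le_trans (ler_norm _) _; rewrite normrN normrM.
have h1 : `|complex.Im v + complex.Im v| <= 2 * cabs v.
  have := Im_le_cabs v; rewrite -mulr2n normrMn mulr2n; move: (`|_|) (cabs v).
  by move=> a b; lra.
have h2 : `|complex.Im (f (w + x)) - complex.Im (f w)| <= 2 * M.
  by apply: le_trans (ler_normB _ _) _; move: fx fw; move: (`|_|) (`|_|) => a b; lra.
apply: le_trans (ler_pM _ _ h1 h2) _; rewrite ?normr_ge0//.
by rewrite le_eqVlt; apply/orP; left; apply/eqP; ring.
Qed.

End DerivativeEstimates.

(** * Growth along radii of the disc *)

Section DiscGrowth.
Variable R : realType.
Local Notation C := (Cplx R).

Lemma is_derive_radial (f : C -> C) (lam x a : C) (t : R) :
  is_derive (cpx t 0 * x) 1 f a ->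
  is_derive t 1 (fun t => complex.Re (lam * f (cpx t 0 * x)))
    (complex.Re (lam * (x * a))).
Proof.
move=> /is_derive_cabs df; apply: eps_is_derive => e e0.
pose N := cabs lam * cabs x + 1.
have N0 : 0 < N by rewrite ltr_wpDl// mulr_ge0// cabs_ge0.
have [d d0 hd] := df (e / N) (divr_gt0 e0 N0).
have x1 : 0 < cabs x + 1 by rewrite ltr_wpDl// cabs_ge0.
exists (d / (cabs x + 1)); first by rewrite divr_gt0.
move=> y yt.
have E : cpx y 0 * x - cpx t 0 * x = cpx (y - t) 0 * x.
  by rewrite -mulrBl; congr (_ * x); apply: complex_ext => //=; rewrite subrr.
have := hd (cpx y 0 * x); rewrite E cabsM cabs_real => hd'.
have {hd'}/hd' : `|y - t| * cabs x < d.
  move: yt; rewrite ltr_pdivlMr// => /(le_lt_trans _); apply.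
  by rewrite ler_wpM2l// lerDl.
set y' := f (cpx y 0 * x); set t' := f (cpx t 0 * x) => h.
have -> : complex.Re (lam * y') - complex.Re (lam * t') -
    complex.Re (lam * (x * a)) * (y - t) =
    complex.Re (lam * (y' - t' - a * (cpx (y - t) 0 * x))).
  rewrite !(cReM, cReD, cReN, cImM, cImD, cImN) /= !(mul0r, mulr0, subr0, addr0).
  ring.
apply: le_trans (Re_le_cabs _) _; rewrite cabsM.
apply: le_trans (ler_wpM2l (cabs_ge0 _) h) _.
have -> : cabs lam * (e / N * (`|y - t| * cabs x)) =
  (cabs lam * cabs x) / N * (e * `|y - t|) by ring.
apply: ler_piMl; first by rewrite mulr_ge0// ltW.
by rewrite ler_pdivrMr// mul1r /N lerDl.
Qed.

Lemma radial_cabs (x : C) (t : R) : 0 <= t <= 1 -> cabs x <= 1 / 2 ->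
  cabs (cpx t 0 * x) <= 1 / 2.
Proof.
move=> /andP[t0 t1] x2; rewrite cabsM cabs_real ger0_norm//.
by apply: le_trans x2; rewrite ler_piMl// cabs_ge0.
Qed.

Variable f : C -> C.
Hypothesis df : forall x, cabs x < 1 -> derivable f x 1.

Let half_disc (y x : C) : cabs y <= 1 / 2 -> cabs (x - y) < 1 / 2 -> cabs x < 1.
Proof.
move=> hy hx; rewrite -(subrK y x) (le_lt_trans (cabsD _ _))//; lra.
Qed.

Let dfx (y : C) : cabs y <= 1 / 2 -> is_derive y 1 f ('D_1 f y).
Proof. by move=> hy; apply/derivableP/df/(le_lt_trans hy); lra. Qed.

(** Borel-Caratheodory on the disc of radius 1/2 about t x bounds the derivative of f by 16 Re f. As
    |x| <= 1/2, the function u satisfies u' <= 8 u along the radius, and exp (- 8 t) u t does not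
    increase. *)
Lemma harnack : (forall x, cabs x < 1 -> 0 <= complex.Re (f x)) ->
  forall x, cabs x <= 1 / 2 -> complex.Re (f x) <= expR 8 * complex.Re (f 0).
Proof.
move=> f0 x x2.
pose u t := complex.Re (1 * f (cpx t 0 * x)).
pose u' t := complex.Re (1 * (x * 'D_1 f (cpx t 0 * x))).
have du (t : R) : 0 <= t <= 1 -> is_derive t 1 u (u' t).
  by move=> t01; apply: is_derive_radial; apply: dfx; exact: radial_cabs.
have u'u t : 0 <= t <= 1 -> u' t <= 8 * u t.
  move=> t01; have y2 := radial_cabs t01 x2.
  rewrite /u' /u !mul1r; apply: le_trans (ler_norm _) _.
  apply: le_trans (Re_le_cabs _) _; rewrite cabsM.
  have h : (0 : R) < 1 / 2 by lra.
  have := borel_caratheodory h (fun z hz => df (half_disc y2 hz)) (dfx y2)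
    (fun z hz => f0 _ (half_disc y2 hz)).
  move=> hD; apply: le_trans (ler_pM (cabs_ge0 _) (cabs_ge0 _) x2 hD) _.
  by rewrite le_eqVlt; apply/orP; left; apply/eqP; field.
have dh (t : R) : 0 <= t <= 1 ->
    is_derive t 1 (fun t => expR (- 8 * t) * u t) (expR (- 8 * t) * (u' t - 8 * u t)).
  move=> t01; have d1 := du t t01.
  have d2 : is_derive t 1 (fun t : R => - 8 * t) (- 8).
    by apply: is_derive_eq; rewrite /GRing.scale /= mulr1.
  have d3 := is_derive1_comp (is_derive_expR (- 8 * t)) d2.
  have := is_deriveM d3 d1; move/is_derive_eq; apply.
  by rewrite /GRing.scale /=; ring.
have [c c01] := mvt_closed (@ler01 R) dh.
rewrite mulr1 mulr0 expR0 mul1r subr0 mulr1 => hc.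
have {hc} : expR (- 8) * u 1 <= u 0.
  rewrite -subr_le0 hc; apply: mulr_ge0_le0; first exact: expR_ge0.
  by rewrite subr_le0 u'u.
rewrite expRN mulrC ler_pdivrMr ?expR_gt0// (mulrC (u 0)) /u !mul1r.
have -> : cpx 0 0 * x = 0 by rewrite -[cpx 0 0]/(0 : C) mul0r.
by [].
Qed.

(** The real mean value theorem is applied to Re (lam^* f), where lam is the increment itself, so
    that the increment of this function is |lam|^2. Cauchy's estimate with radius 1/2 gives the
    constant 8 M. *)
Lemma disc_lipschitz M : (forall x, cabs x < 1 -> cabs (f x) <= M) ->
  forall x, cabs x <= 1 / 2 -> cabs (f x - f 0) <= 8 * M * cabs x.
Proof.
move=> fM x x2; have M0 : 0 <= M by rewrite (le_trans (cabs_ge0 _) (fM 0 _))// cabs0.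
set lam := f x - f 0.
pose u t := complex.Re (lam^* * f (cpx t 0 * x)).
pose u' t := complex.Re (lam^* * (x * 'D_1 f (cpx t 0 * x))).
have du (t : R) : 0 <= t <= 1 -> is_derive t 1 u (u' t).
  by move=> t01; apply: is_derive_radial; apply: dfx; exact: radial_cabs.
have [c c01] := mvt_closed (@ler01 R) du; rewrite subr0 mulr1 => hc.
have y2 := radial_cabs c01 x2.
have h : (0 : R) < 1 / 2 by lra.
have hD := cauchy_estimate h (fun z hz => df (half_disc y2 hz)) (dfx y2)
    (fun z hz => fM _ (half_disc y2 hz)).
have : cabs lam ^+ 2 <= cabs lam * (8 * M * cabs x).
  have -> : cabs lam ^+ 2 = u 1 - u 0.
    rewrite /u -[cpx 1 0]/(1 : C) -[cpx 0 0]/(0 : C) mul1r mul0r.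
    rewrite -cReN -cReD -mulrN -mulrDr -/lam cabs_sqr cReM cRe_conj cIm_conj.
    by rewrite mulNr opprK.
  rewrite hc; apply: le_trans (ler_norm _) _; apply: le_trans (Re_le_cabs _) _.
  rewrite !cabsM cabs_conj; apply: ler_wpM2l; first exact: cabs_ge0.
  rewrite mulrC; apply: ler_wpM2r; first exact: cabs_ge0.
  by apply: le_trans hD _; rewrite le_eqVlt; apply/orP; left; apply/eqP; field.
have := cabs_ge0 lam; rewrite le_eqVlt => /predU1P[<- _|l0].
  by rewrite !mulr_ge0// cabs_ge0.
by rewrite expr2 ler_pM2l.
Qed.

End DiscGrowth.

(** * Euclidean geometry and the Kobayashi metric *)

Section EuclideanNorm.
Variables (R : realType) (n : nat).
Local Notation C := (Cplx R).
Implicit Types (z w u v : 'cV[C]_n).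

Lemma cauchy_schwarz_sum (I : finType) (a b : I -> R) :
  (\sum_i a i * b i) ^+ 2 <= (\sum_i a i ^+ 2) * (\sum_i b i ^+ 2).
Proof.
set A := \sum_i a i ^+ 2; set B := \sum_i b i ^+ 2; set P := \sum_i a i * b i.
have A0 : 0 <= A by apply: sumr_ge0 => i _; exact: sqr_ge0.
have B0 : 0 <= B by apply: sumr_ge0 => i _; exact: sqr_ge0.
have : 0 <= \sum_i (B * a i - P * b i) ^+ 2.
  by apply: sumr_ge0 => i _; exact: sqr_ge0.
have -> : \sum_i (B * a i - P * b i) ^+ 2 = B * (A * B - P ^+ 2).
  transitivity (\sum_i (B ^+ 2 * a i ^+ 2 + (- (2 * B * P)) * (a i * b i) +
     P ^+ 2 * b i ^+ 2)); first by apply: eq_bigr => i _; ring.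
  by rewrite !big_split /= -!mulr_sumr -/A -/B -/P; ring.
move: B0; rewrite le_eqVlt => /predU1P[B0|B0]; last first.
  by rewrite pmulr_rge0// subr_ge0.
move=> _; rewrite -B0 mulr0 le_eqVlt; apply/orP; left.
have b0 i : b i = 0.
  have /(_ i isT) := psumr_eq0P (fun i _ => sqr_ge0 (b i)) (esym B0).
  by move/eqP; rewrite sqrf_eq0 => /eqP.
by rewrite /P big1 ?expr0n// => i _; rewrite b0 mulr0.
Qed.

Lemma enorm_ge0 z : 0 <= enorm z.
Proof. exact: sqrtr_ge0. Qed.

Lemma enorm_sqr z : enorm z ^+ 2 = \sum_i cabs (z i 0) ^+ 2.
Proof. by rewrite sqr_sqrtr// sumr_ge0// => i _; exact: sqr_ge0. Qed.

Lemma enormD z w : enorm (z + w) <= enorm z + enorm w.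
Proof.
rewrite -(ler_pXn2r (n := 2)) ?nnegrE ?addr_ge0 ?enorm_ge0//.
rewrite sqrrD !enorm_sqr.
apply: (@le_trans _ _ (\sum_i (cabs (z i 0) + cabs (w i 0)) ^+ 2)).
  apply: ler_sum => i _; rewrite mxE ler_pXn2r ?nnegrE ?addr_ge0 ?cabs_ge0//.
  exact: cabsD.
rewrite (eq_bigr (fun i => cabs (z i 0) ^+ 2 + (cabs (z i 0) * cabs (w i 0)) *+ 2 +
  cabs (w i 0) ^+ 2)); last by move=> i _; rewrite sqrrD.
rewrite big_split big_split /= lerD2r lerD2l sumrMnl lerMn2r /=.
rewrite -(ler_pXn2r (n := 2)) ?nnegrE ?mulr_ge0 ?enorm_ge0//; last first.
  by apply: sumr_ge0 => i _; rewrite mulr_ge0// cabs_ge0.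
by rewrite exprMn !enorm_sqr cauchy_schwarz_sum.
Qed.

Lemma enormZ (a : C) z : enorm (a *: z) = cabs a * enorm z.
Proof.
rewrite /enorm (eq_bigr (fun i => cabs a ^+ 2 * cabs (z i 0) ^+ 2)); last first.
  by move=> i _; rewrite mxE cabsM exprMn.
by rewrite -mulr_sumr sqrtrM ?sqr_ge0// sqrtr_sqr ger0_norm// cabs_ge0.
Qed.

Lemma enormN z : enorm (- z) = enorm z.
Proof. by rewrite -scaleN1r enormZ cabsN cabs1 mul1r. Qed.

Lemma enormB z w : enorm (z - w) = enorm (w - z).
Proof. by rewrite -enormN opprB. Qed.

Lemma enorm0 : enorm (0 : 'cV[C]_n) = 0.
Proof. by rewrite -(scale0r 0) enormZ cabs0 mul0r. Qed.

Lemma enorm_triangle u z w : enorm (z - w) <= enorm (z - u) + enorm (u - w).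
Proof. by rewrite -(subrKA u) enormD. Qed.

Lemma cabs_le_enorm z i : cabs (z i 0) <= enorm z.
Proof.
rewrite -(ler_pXn2r (n := 2)) ?nnegrE ?cabs_ge0 ?enorm_ge0// enorm_sqr.
by rewrite (bigD1 i)//= lerDl sumr_ge0// => j _; exact: sqr_ge0.
Qed.

Lemma enorm_le_sum z : enorm z <= \sum_i cabs (z i 0).
Proof.
have s0 : 0 <= \sum_i cabs (z i 0) by apply: sumr_ge0 => i _; exact: cabs_ge0.
rewrite -(ler_pXn2r (n := 2)) ?nnegrE ?enorm_ge0// enorm_sqr expr2 mulr_suml.
apply: ler_sum => i _; rewrite expr2 ler_wpM2l ?cabs_ge0//.
by rewrite (bigD1 i)//= lerDl sumr_ge0// => j _; exact: cabs_ge0.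
Qed.

Lemma enorm_le_coord z (b : R) : (forall i, cabs (z i 0) <= b) -> enorm z <= n%:R * b.
Proof.
move=> h; apply: le_trans (enorm_le_sum z) _.
apply: le_trans (ler_sum _ (fun i _ => h i)) _.
by rewrite sumr_const card_ord mulr_natl.
Qed.

Lemma enorm_eq0 z : (enorm z == 0) = (z == 0).
Proof.
apply/eqP/eqP => [z0|->]; last exact: enorm0.
apply/matrixP => i j; rewrite ord1 mxE; apply/eqP; rewrite -cabs_eq0.
by rewrite eq_le cabs_ge0 andbT -z0 cabs_le_enorm.
Qed.

Lemma enorm_gt0 z : (0 < enorm z) = (z != 0).
Proof. by rewrite lt_def enorm_ge0 andbT enorm_eq0. Qed.

Lemma enorm_real_scale (t : R) v : enorm (real_scale t v) = `|t| * enorm v.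
Proof. by rewrite enormZ cabs_real. Qed.

(** Matrix neighbourhoods are given entrywise; through this equivalence the later topological
    arguments only see Euclidean balls. *)
Lemma nbhs_enorm z (P : set 'cV[C]_n) :
  nbhs z P <-> exists2 e : R, 0 < e & forall w, enorm (w - z) < e -> P w.
Proof.
split.
  move=> [Q hQ QP].
  have hQ' (i : 'I_n) : exists2 e : R, 0 < e & forall y, cabs (y - z i 0) < e -> Q i 0 y.
    by apply/nbhs_cabs; exact: hQ.
  have [e he] : exists e : 'I_n -> R, forall i, 0 < e i /\
      forall y, cabs (y - z i 0) < e i -> Q i 0 y.
    exists (fun i => s2val (cid2 (hQ' i))) => i; split.
      exact: (s2valP (cid2 (hQ' i))).
    exact: (s2valP' (cid2 (hQ' i))).
  exists (\big[Num.min/1]_i e i).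
    by apply: lt_bigmin => // i _; have [] := he i.
  move=> w wz; apply: QP => i j; rewrite ord1; apply: (he i).2.
  have -> : w i 0 - z i 0 = (w - z) i 0 by rewrite !mxE.
  apply: le_lt_trans (cabs_le_enorm _ i) _; apply: lt_le_trans wz _.
  exact: bigmin_le_cond.
move=> [e e0 h].
have n1 : 0 < n.+1%:R :> R by rewrite ltr0Sn.
exists (fun i j => [set y | cabs (y - z i j) < e / n.+1%:R]).
  move=> i j; apply/nbhs_cabs; exists (e / n.+1%:R) => //; exact: divr_gt0.
move=> w hw; apply: h.
apply: le_lt_trans (@enorm_le_coord _ (e / n.+1%:R) _) _.
  by move=> i; rewrite !mxE ltW//; exact: hw.
by rewrite mulrA ltr_pdivrMr// mulrC ltr_pM2l// ltr_nat.
Qed.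

End EuclideanNorm.

(** * Topology in terms of Euclidean balls *)

Section EuclideanTopology.
Variables (R : realType) (n : nat).
Local Notation C := (Cplx R).
Implicit Types (z w u v : 'cV[C]_n) (A Om : set 'cV[C]_n).

Lemma open_enorm A z : open A -> A z ->
  exists2 e : R, 0 < e & forall w, enorm (w - z) < e -> A w.
Proof. by move=> oA Az; apply/nbhs_enorm; exact: open_nbhs_nbhs. Qed.

Lemma closure_enorm A z :
  closure A z <-> forall e : R, 0 < e -> exists2 w, A w & enorm (w - z) < e.
Proof.
split=> [h e e0|h B /nbhs_enorm[e e0 hB]].
  have [|w [Aw wB]] := h [set w | enorm (w - z) < e].
    by apply/nbhs_enorm; exists e.
  by exists w.
by have [w Aw wz] := h e e0; exists w; split=> //; exact: hB.
Qed.

Lemma closed_enorm A :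
  (forall z, (forall e : R, 0 < e -> exists2 w, A w & enorm (w - z) < e) -> A z) ->
  closed A.
Proof. by move=> h z /closure_enorm; exact: h. Qed.

(** Compactness in its near-covering form along the filter at [+oo]. It is the source of the uniform
    constants below: for forms on the unit sphere, for the separation of two sets, and for the
    estimates near the boundary. *)
Lemma compact_uniform (K : set 'cV[C]_n) (P : R -> 'cV[C]_n -> Prop) :
  compact K -> (forall M M' z, M <= M' -> P M z -> P M' z) ->
  (forall z, K z -> exists (M e : R), 0 < e /\ forall w, enorm (w - z) < e -> P M w) ->
  exists M : R, forall z, K z -> P M z.
Proof.
move=> /compact_near_coveringP cK mono loc.
have [|M [_ hM]] := cK R +oo%R P _.
  move=> z Kz; have [M [e [e0 h]]] := loc z Kz.
  exists ([set w | enorm (w - z) < e], [set M' | M < M']).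
    split; first by apply/nbhs_enorm; exists e.
    by exists M; split => //; exact: num_real.
  by move=> [w M'] /= [/h Pw /ltW MM']; exact: mono Pw.
by exists (M + 1) => z Kz; apply: hM => //; rewrite ltrDl.
Qed.

(** Real boxes are compact by [rV_compact], and [A] is a closed subset of the image of a box under
    the continuous identification [F] of R^(2n) with C^n. *)
Lemma heine_borel A (M : R) : closed A -> (forall z, A z -> enorm z <= M) ->
  compact A.
Proof.
move=> cA bA.
pose F (v : 'rV[R]_(n + n)) : 'cV[C]_n :=
  \col_i cpx (v ord0 (lshift n i)) (v ord0 (rshift n i)).
pose box := [set v : 'rV[R]_(n + n) | forall i, `[- M, M] (v ord0 i)].
have cbox : compact box.
  by apply: (@rV_compact _ _ (fun=> `[- M, M]%classic)) => _; exact: segment_compact.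
have cF : continuous F.
  move=> v B /nbhs_enorm[e e0 hB].
  have n1 : 0 < (n.+1)%:R :> R by rewrite ltr0Sn.
  have e1 : 0 < e / 2 / n.+1%:R by rewrite !divr_gt0.
  exists (fun _ j => [set y | `|y - v ord0 j| < e / 2 / n.+1%:R]).
    move=> i j; rewrite ord1; apply/nbhs_ballP; exists (e / 2 / n.+1%:R) => //= y.
    by rewrite /ball /= distrC.
  move=> v' hv'; apply: hB.
  apply: le_lt_trans (@enorm_le_coord _ _ _ (e / n.+1%:R) _) _.
    move=> i; apply: le_trans (cabs_le_ReIm _) _; rewrite !mxE /=.
    rewrite (_ : e / n.+1%:R = e / 2 / n.+1%:R + e / 2 / n.+1%:R); last first.
      by rewrite -mulrDl -splitr.
    by rewrite lerD// ltW//; apply: hv'.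
  by rewrite mulrA ltr_pdivrMr// mulrC ltr_pM2l// ltr_nat.
have cim : compact (F @` box).
  by apply: continuous_compact => //; apply: continuous_subspaceT.
apply: subclosed_compact cA cim _ => z Az.
exists (\row_(j < n + n) match fintype.split j with
  inl i => complex.Re (z i 0) | inr i => complex.Im (z i 0) end).
  move=> j; rewrite mxE /=; have zM i : cabs (z i 0) <= M.
    exact: le_trans (cabs_le_enorm _ _) (bA _ Az).
  case: splitP => i _ /=; rewrite in_itv /= -ler_norml.
    exact: le_trans (Re_le_cabs _) (zM _).
  exact: le_trans (Im_le_cabs _) (zM _).
apply/matrixP => i j; rewrite ord1 !mxE.
have -> : fintype.split (lshift n i) = inl i by exact: (unsplitK (inl i)).
have -> : fintype.split (rshift n i) = inr i by exact: (unsplitK (inr i)).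
exact: complex_ext.
Qed.

Lemma is_velocity_eps (g : R -> 'cV[C]_n) (t : R) v :
  is_velocity g t v <-> forall e, 0 < e -> exists2 d, 0 < d & forall s,
    `|s - t| < d -> enorm (g s - g t - real_scale (s - t) v) <= e * `|s - t|.
Proof.
have E s : s != t -> enorm (g s - g t - real_scale (s - t) v) =
    `|s - t| * enorm (real_scale (s - t)^-1 (g s - g t) - v).
  move=> st; rewrite -enorm_real_scale /real_scale scalerBr scalerA.
  congr (enorm (_ - _)); rewrite -rmorphM /= mulfV ?subr_eq0//.
  by rewrite -[(1%:C)%C]/(1 : C) scale1r.
split=> [h e e0|h B /nbhs_enorm[e e0 hB]].
  have /h : nbhs v [set w | enorm (w - v) < e] by apply/nbhs_enorm; exists e.
  move=> /nbhs_ballP[d /= d0 hd]; exists d => // s st.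
  have [->|st0] := eqVneq s t.
    by rewrite !subrr normr0 mulr0 /real_scale scale0r subr0 enorm0.
  rewrite E// mulrC ler_wpM2r// ltW//.
  have := hd (s - t); rewrite /ball /= sub0r normrN subr_eq0 subrK.
  by apply.
have [|d d0 hd] := h (e / 2); first by rewrite divr_gt0.
apply/nbhs_ballP; exists d => //= s; rewrite /ball /= sub0r normrN => sd s0.
apply: hB; have sd' : `|s + t - t| < d by rewrite addrK.
have st : s + t != t by rewrite -subr_eq0 addrK.
have := hd _ sd'; rewrite (E _ st) addrK mulrC ler_pM2r ?normr_gt0//.
move=> /le_lt_trans; apply.
by rewrite ltr_pdivrMr// ltr_pMr// ltr1n.
Qed.

End EuclideanTopology.

Section Domains.
Variables (R : realType) (n : nat).
Local Notation C := (Cplx R).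
Implicit Types (z w u v p : 'cV[C]_n) (Om : set 'cV[C]_n).

Lemma delta_le Om z w : ~ Om w -> delta Om z <= enorm (z - w).
Proof.
move=> Omw; apply: ge_inf; last by exists w.
by exists 0 => _ [x _ <-]; exact: enorm_ge0.
Qed.

Lemma delta_ge Om z w (e : R) : ~ Om w ->
  (forall w', ~ Om w' -> e <= enorm (z - w')) -> e <= delta Om z.
Proof.
move=> Omw h; apply: lb_le_inf; first by exists (enorm (z - w)), w.
by move=> _ [x Omx <-]; exact: h.
Qed.

Lemma delta_lt Om z w (e : R) : ~ Om w -> delta Om z < e ->
  exists2 w', ~ Om w' & enorm (z - w') < e.
Proof.
move=> Omw; have hi : has_inf [set enorm (z - w) | w in ~` Om].
  split; first by exists (enorm (z - w)), w.
  by exists 0 => _ [x _ <-]; exact: enorm_ge0.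
by move=> /(inf_lt hi.1)[_ [x Omx <-] xe]; exists x.
Qed.

Lemma delta_gt0 Om z w : open Om -> Om z -> ~ Om w -> 0 < delta Om z.
Proof.
move=> oOm Omz Omw; have [e e0 he] := open_enorm oOm Omz.
apply: (lt_le_trans e0); apply: (@delta_ge _ _ w) => // w' Omw'.
by rewrite leNgt enormB; apply/negP => /he.
Qed.

Lemma delta_ball Om z w : enorm (w - z) < delta Om z -> Om w.
Proof.
move=> h; apply: contrapT => Omw; move: h; apply/negP; rewrite -leNgt enormB.
exact: delta_le.
Qed.

Lemma bdryP Om p : open Om -> (bdry Om p <-> closure Om p /\ ~ Om p).
Proof. by move=> /interior_id; rewrite /bdry => ->. Qed.

(** A point of the complement makes the infimum in [delta] range over a nonempty set; in dimension 0
    there would be none. *)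
Lemma bounded_domain_compl Om : (0 < n)%N -> bounded_domain Om -> exists w, ~ Om w.
Proof.
move=> n0 [_ _ _ [M hM]].
pose N := `|M| + 1.
exists (const_mx (cpx N 0)) => /hM; apply/negP; rewrite -ltNge.
apply: lt_le_trans (cabs_le_enorm _ (Ordinal n0)).
rewrite mxE cabs_real /N ger0_norm; last by rewrite addr_ge0.
by rewrite (le_lt_trans (ler_norm M))// ltrDl.
Qed.

Lemma real_scaleDl (a b : R) v :
  real_scale (a + b) v = real_scale a v + real_scale b v.
Proof. by rewrite /real_scale rmorphD /= scalerDl. Qed.

Lemma real_scale0 v : real_scale 0 v = 0.
Proof. exact: scale0r. Qed.

Lemma real_scale1 v : real_scale 1 v = v.
Proof. exact: scale1r. Qed.

(** The boundary point is the first exit of the segment: as [Om] is open, the infimum of the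
    exterior parameters is positive and is itself an exterior parameter. *)
Lemma segment_meets_bdry Om z w : open Om -> Om z -> ~ Om w ->
  exists2 p, bdry Om p & enorm (z - p) <= enorm (z - w).
Proof.
move=> oOm Omz Omw; pose g (t : R) := z + real_scale t (w - z).
have gB s t : enorm (g s - g t) = `|s - t| * enorm (w - z).
  rewrite /g opprD addrACA subrr add0r -enorm_real_scale.
  by rewrite /real_scale -scalerBl -rmorphB.
pose T := [set t | 0 <= t <= 1 /\ ~ Om (g t)].
have T1 : T 1 by split; [rewrite ler01 lexx|rewrite /g real_scale1 addrC subrK].
have Tlb : has_lbound T by exists 0 => t [/andP[]].
have hi : has_inf T by split=> //; exists 1.
have i0 : 0 <= inf T by apply: lb_le_inf; [exists 1|move=> t [/andP[]]].
have i1 : inf T <= 1 by exact: ge_inf.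
have N0 : 0 < enorm (w - z) + 1 by rewrite ltr_wpDl// enorm_ge0.
have gclose s t e : 0 < e -> `|s - t| < e / (enorm (w - z) + 1) ->
    enorm (g s - g t) < e.
  move=> e0 st; rewrite gB.
  apply: (@le_lt_trans _ _ (`|s - t| * (enorm (w - z) + 1))).
    by rewrite ler_wpM2l// lerDl.
  by rewrite -ltr_pdivlMr.
have nOm : ~ Om (g (inf T)).
  move=> /(open_enorm oOm)[e e0 he].
  have d0 : 0 < e / (enorm (w - z) + 1) by rewrite divr_gt0.
  have [t Tt tlt] := inf_adherent d0 hi.
  have tge := ge_inf Tlb Tt.
  case: (Tt) => _; apply; apply: he; apply: gclose => //.
  by rewrite ger0_norm ?subr_ge0// ltrBlDl.
have ipos : 0 < inf T.
  rewrite lt_def i0 andbT; apply/eqP => i00; apply: nOm.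
  by rewrite i00 /g real_scale0 addr0.
exists (g (inf T)).
  apply/(bdryP _ oOm); split; last exact: nOm.
  apply/closure_enorm => e e0.
  have d0 : 0 < e / (enorm (w - z) + 1) by rewrite divr_gt0.
  pose t := Num.max 0 (inf T - e / (enorm (w - z) + 1) / 2).
  have tlt : t < inf T by rewrite gt_max ipos ltrBlDr ltrDl divr_gt0.
  exists (g t); last first.
    apply: gclose => //; rewrite distrC ger0_norm ?subr_ge0 ?ltW//.
    have : inf T - e / (enorm (w - z) + 1) / 2 <= t by rewrite le_max lexx orbT.
    by move: d0; move: (e / _) t {tlt} => d t; lra.
  apply: contrapT => nOmt.
  have : T t by split=> //; rewrite le_max lexx (le_trans (ltW tlt)).
  by move=> /(ge_inf Tlb); rewrite leNgt tlt.
rewrite enormB /g addrAC subrr add0r enorm_real_scale ger0_norm//.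
by rewrite enormB ler_piMl// enorm_ge0.
Qed.

Lemma near_bdry Om z w (e : R) : open Om -> Om z -> ~ Om w -> delta Om z < e ->
  exists2 p, bdry Om p & enorm (z - p) < e.
Proof.
move=> oOm Omz Omw /(delta_lt Omw)[w' Omw' h].
have [p hp pz] := segment_meets_bdry oOm Omz Omw'.
by exists p => //; exact: le_lt_trans h.
Qed.

(** These superlevel sets of [delta] serve as the compact sets of the visibility condition. *)
Lemma compact_deep Om (e : R) : bounded_domain Om -> 0 < e ->
  compact [set z | forall w, ~ Om w -> e <= enorm (z - w)].
Proof.
move=> [oOm _ _ [M hM]] e0; apply: (@heine_borel _ _ _ M).
  apply: closed_enorm => z hz w Omw; rewrite leNgt; apply/negP => zw.
  have [|y hy yz] := hz (e - enorm (z - w)); first by rewrite subr_gt0.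
  have := hy _ Omw; apply/negP; rewrite -ltNge.
  by apply: le_lt_trans (enorm_triangle z _ _) _; rewrite -ltrBrDr.
move=> z hz; apply: hM; apply: contrapT => /hz.
by rewrite subrr enorm0 leNgt e0.
Qed.

End Domains.

(** * First bounds for the Kobayashi metric *)

Section KobayashiMetric.
Variables (R : realType) (n : nat).
Local Notation C := (Cplx R).
Implicit Types (z w u v p : 'cV[C]_n) (Om : set 'cV[C]_n) (phi : C -> 'cV[C]_n).

Lemma holomorphic_discP Om phi : holomorphic_disc Om phi <->
  forall x : C, cabs x < 1 -> derivable phi x 1 /\ Om (phi x).
Proof.
have E (x : C) : (`|x| < 1) = (cabs x < 1) by exact: (normC_lt x 1).
by split=> h x hx; apply: h; rewrite ?E// -E.
Qed.

Lemma is_derive_component phi (x : C) i : derivable phi x 1 ->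
  is_derive x 1 (fun y => phi y i 0) (derive1 phi x i 0).
Proof.
move=> dphi; rewrite derive1E.
have cv : h^-1 *: (phi (h *: (1 : C) + x) - phi x) @[h --> 0^'] --> 'D_1 phi x.
  exact: dphi.
have cv' : h^-1 *: (phi (h *: (1 : C) + x) i 0 - phi x i 0) @[h --> 0^']
    --> 'D_1 phi x i 0.
  have := cvg_comp _ _ cv (@coord_continuous _ _ _ i 0 ('D_1 phi x)).
  apply: cvg_trans; apply: near_eq_cvg; apply: nearW => h /=.
  by rewrite !mxE.
by apply: DeriveDef; [apply/cvg_ex; exists ('D_1 phi x i 0)|exact: cvg_lim cv'].
Qed.

(** The linear disc of radius r in the direction of v. It yields the upper bound [kobm_le], and it
    shows that the infimum in [kobm] is over a nonempty set, so that no default value of [inf]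
    intervenes. *)
Lemma affine_disc Om z v (r : R) : 0 < r ->
  (forall w, enorm (w - z) < r -> Om w) ->
  exists phi, [/\ holomorphic_disc Om phi, phi 0 = z &
    cpx (enorm v / r) 0 *: derive1 phi 0 = v].
Proof.
move=> r0 hr.
pose u : 'cV[C]_n := cpx (r / enorm v) 0 *: v.
have [->|v0] := eqVneq v 0.
  exists (fun=> z); split=> //.
    move=> x _; split; first exact: derivable_cst.
    by apply: hr; rewrite subrr enorm0.
  by rewrite derive1_cst scaler0.
have e0 : 0 < enorm v by rewrite enorm_gt0.
have nu : enorm u = r.
  rewrite /u enormZ cabs_real ger0_norm; last by rewrite divr_ge0// ltW.
  by rewrite divfK// gt_eqF.
have dphi (x : C) : is_derive x 1 (fun x : C => x *: u + z) u.
  have cv : h^-1 *: (((h *: (1 : C) + x) *: u + z) - (x *: u + z)) @[h --> 0^'] --> u.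
    have FF : Filter ((0 : C)^') by exact: _.
    apply: (cvg_trans _ (@cvg_cst _ u C _ FF)); apply: near_eq_cvg.
    near=> h; have h0 : h != 0 by near: h; exact: nbhs_dnbhs_neq.
    rewrite /= opprD addrACA subrr addr0 -scalerBl addrK scalerA.
    by rewrite (_ : h *: (1 : C) = h) ?mulVf ?scale1r//; exact: mulr1.
  by apply: DeriveDef; [apply/cvg_ex; exists u|exact: cvg_lim cv].
exists (fun x => x *: u + z); split.
- apply/holomorphic_discP => x x1; split; first by case: (dphi x).
  apply: hr; rewrite addrK enormZ nu.
  by rewrite -[ltRHS]mul1r ltr_pM2r.
- by rewrite scale0r add0r.
rewrite derive1E; case: (dphi 0) => _ ->.
rewrite /u scalerA (_ : _ * _ = 1) ?scale1r//.
apply: complex_ext; rewrite ?cReM ?cImM /= ?mulr0 ?mul0r ?subr0 ?addr0//.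
by field; rewrite !gt_eqF.
Unshelve. all: by end_near. Qed.

Lemma kobm_le Om z v (r : R) : 0 < r ->
  (forall w, enorm (w - z) < r -> Om w) -> kobm Om z v <= enorm v / r.
Proof.
move=> r0 hr; have [phi [h1 h2 h3]] := affine_disc v r0 hr.
apply: ge_inf; first by exists 0 => _ [x _ <-]; exact: cabs_ge0.
exists (cpx (enorm v / r) 0); first by exists phi.
by rewrite cabs_real ger0_norm// divr_ge0 ?enorm_ge0// ltW.
Qed.

(** [N] is left general because it will be the Euclidean norm at a pseudoconvex point and the
    modulus of one rotated coordinate at a cusp. *)
Lemma kobm_ge Om z (N : 'cV[C]_n -> R) (c : R) v : open Om -> Om z -> 0 < c ->
  (forall (a : C) u, N (a *: u) = cabs a * N u) ->
  (forall phi, holomorphic_disc Om phi -> phi 0 = z -> N (derive1 phi 0) <= c) ->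
  N v <= c * kobm Om z v.
Proof.
move=> oOm Omz c0 NZ h; rewrite mulrC -ler_pdivrMr//; apply: lb_le_inf.
  have [r r0 hr] := open_enorm oOm Omz.
  have [phi [h1 h2 h3]] := affine_disc v r0 hr.
  by exists (cabs (cpx (enorm v / r) 0)), (cpx (enorm v / r) 0) => //; exists phi.
move=> _ [xi [phi [h1 h2 <-]] <-]; rewrite NZ ler_pdivrMr//.
by apply: ler_wpM2l; [exact: cabs_ge0|exact: h].
Qed.

Lemma kobm_ge0 Om z v : 0 <= kobm Om z v.
Proof.
rewrite /kobm; set S := (X in inf X).
have [->|S0] := eqVneq S set0; first by rewrite inf0.
by apply: lb_le_inf; [exact/set0P|move=> _ [x _ <-]; exact: cabs_ge0].
Qed.

End KobayashiMetric.

(** * The Kobayashi metric near strongly pseudoconvex points *)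

Section DirectionalDerivative.
Variables (R : realType) (n : nat).
Local Notation C := (Cplx R).
Implicit Types (z w u v p h y : 'cV[C]_n) (U : set 'cV[C]_n) (f : 'cV[C]_n -> R).

Lemma real_scaleA (a b : R) v : real_scale a (real_scale b v) = real_scale (a * b) v.
Proof. by rewrite /real_scale scalerA -rmorphM. Qed.

Lemma is_derive_line U f z v (t : R) : C1_on U f -> U (z + real_scale t v) ->
  is_derive t 1 (fun t => f (z + real_scale t v)) (ddir v f (z + real_scale t v)).
Proof.
move=> C1 Uz; have [_ /(_ v)[d _]] := C1 _ Uz.
set y := z + real_scale t v in d *.
have d' : is_derive (0 : R) 1 (fun s : R => f (y + real_scale s v)) (ddir v f y).
  by rewrite /ddir derive1E; exact: derivableP.
apply: eps_is_derive => e e0; have [r r0 hr] := is_derive_eps d' e0.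
have E0 : y + real_scale 0 v = y by rewrite real_scale0 addr0.
have E s : y + real_scale (s - t) v = z + real_scale s v.
  rewrite /y -addrA -real_scaleDl; congr (z + real_scale _ v).
  by rewrite addrC subrK.
exists r; first exact: r0; move=> s st; have st' : `|s - t - 0| < r by rewrite subr0.
by have := hr (s - t) st'; rewrite (E s) E0 (subr0 (s - t)).
Qed.

Lemma mvt_line U f y w : C1_on U f ->
  (forall s : R, 0 <= s <= 1 -> U (y + real_scale s w)) ->
  exists2 c : R, 0 <= c <= 1 & f (y + w) - f y = ddir w f (y + real_scale c w).
Proof.
move=> C1 hU.
have [c c01 hc] := mvt_closed (@ler01 R)
  (fun (s : R) (hs : 0 <= s <= 1) => is_derive_line C1 (hU s hs)).
by exists c => //; move: hc; rewrite real_scale0 addr0 real_scale1 subr0 mulr1.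
Qed.

Lemma ddirZ U f z v (c : R) : C1_on U f -> U z ->
  ddir (real_scale c v) f z = c * ddir v f z.
Proof.
move=> C1 Uz.
have E0 w : z + real_scale 0 w = z by rewrite real_scale0 addr0.
have U0 : U (z + real_scale 0 v) by rewrite E0.
have U0' : U (z + real_scale 0 (real_scale c v)) by rewrite E0.
have d0 : is_derive (0 + c * 0 : R) (1 : R) (fun t => f (z + real_scale t v)) (ddir v f z).
  have := is_derive_line C1 U0; rewrite E0.
  by rewrite (_ : 0 + c * 0 = 0 :> R)// mulr0 addr0.
have [_ <-] := is_derive_affine d0.
have := is_derive_line C1 U0'; rewrite E0 => -[_ <-].
congr ('D_(1 : R) _ (0 : R)); apply/funext => t.
by rewrite real_scaleA (add0r (c * t)) (mulrC t).
Qed.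

Lemma ddir0 U f z : C1_on U f -> U z -> ddir 0 f z = 0.
Proof. by move=> C1 Uz; rewrite -(real_scale0 0) (ddirZ _ _ C1 Uz) mul0r. Qed.

(** [C1_on] only speaks of directional derivatives, so their additivity has to be derived: the
    increment along t u + t v is taken in two legs, and the mean value theorem on the second leg is
    combined with the continuity of [ddir v f]. *)
Lemma ddirD U f z u v : open U -> C1_on U f -> U z ->
  ddir (u + v) f z = ddir u f z + ddir v f z.
Proof.
move=> oU C1 Uz.
have U0 : U (z + real_scale 0 u) by rewrite real_scale0 addr0.
suff [_] : is_derive (0 : R) 1 (fun t => f (z + real_scale t (u + v)))
    (ddir u f z + ddir v f z).
  by move=> <-; rewrite /ddir derive1E.
apply: eps_is_derive => e e0.
have e2 : 0 < e / 2 by rewrite divr_gt0.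
have := is_derive_eps (is_derive_line C1 U0) e2; rewrite real_scale0 addr0.
move=> [d1 d10 hd1].
have [_ /(_ v)[_ cv]] := C1 z Uz.
have [d2 d20 hd2] : exists2 d : R, 0 < d & forall y, enorm (y - z) < d ->
    U y /\ `|ddir v f y - ddir v f z| <= e / 2.
  apply/nbhs_enorm; apply: filterI; first exact: open_nbhs_nbhs.
  have /cvgrPdist_le/(_ _ e2) := cv.
  by apply: filterS => y; rewrite distrC.
have N0 : 0 < enorm u + enorm v + 1 by rewrite ltr_wpDl// addr_ge0// enorm_ge0.
exists (Num.min d1 (d2 / (enorm u + enorm v + 1))).
  by rewrite lt_min d10 divr_gt0.
move=> t; rewrite subr0 lt_min => /andP[t1 t2].
have seg s : 0 <= s <= 1 -> enorm (z + real_scale t u + real_scale s (real_scale t v) - z) < d2.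
  move=> /andP[s0 s1]; rewrite -(addrA z) (addrC (z + _)) addKr.
  apply: le_lt_trans (enormD _ _) _; rewrite !enorm_real_scale.
  move: t2; rewrite ltr_pdivlMr//; apply: le_lt_trans.
  rewrite !mulrDr mulr1 -addrA lerD2l (@le_trans _ _ (`|t| * enorm v))//.
    by rewrite ger0_norm// ler_piMl// mulr_ge0// enorm_ge0.
  by rewrite lerDl.
have [c c01] := mvt_line C1 (fun s hs => (hd2 _ (seg s hs)).1).
have [Uy hy] := hd2 _ (seg c c01).
rewrite (ddirZ _ _ C1 Uy) => Ev.
have := hd1 t; rewrite subr0 => /(_ t1) Eu.
have -> : z + real_scale t (u + v) = z + real_scale t u + real_scale t v.
  by rewrite /real_scale scalerDr addrA.
rewrite real_scale0 addr0.
move: Ev Eu hy; set A := f (_ + _ + _); set B := f (z + real_scale t u).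
set D := ddir v f _; set Dv := ddir v f z; set Du := ddir u f z => Ev Eu hy.
have -> : A - f z - (Du + Dv) * t = (B - f z - Du * t) + t * (D - Dv).
  by rewrite mulrBr -Ev; ring.
apply: le_trans (ler_normD _ _) _; rewrite normrM.
rewrite [leRHS](_ : _ = e / 2 * `|t| + `|t| * (e / 2)); last by field.
by rewrite lerD// ler_wpM2l.
Qed.

Lemma coord_decomp h : h = \sum_j
  (real_scale (complex.Re (h j 0)) (delta_mx j 0) +
   real_scale (complex.Im (h j 0)) ('i *: delta_mx j 0)).
Proof.
rewrite {1}(matrix_sum_delta h); apply: eq_bigr => j _.
rewrite big_ord1 /real_scale scalerA -scalerDl; congr (_ *: _).
by apply: complex_ext; rewrite ?cReD ?cImD ?cReM ?cImM /=
  ?(mulr0, mulr1, mul0r, subr0, addr0, add0r).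
Qed.

Lemma ddir_coord U f z h : open U -> C1_on U f -> U z ->
  ddir h f z = \sum_j (complex.Re (h j 0) * dx j f z + complex.Im (h j 0) * dy j f z).
Proof.
move=> oU C1 Uz; rewrite {1}(coord_decomp h).
rewrite (big_morph (fun v => ddir v f z)
  (fun u v => ddirD u v oU C1 Uz) (ddir0 C1 Uz)).
by apply: eq_bigr => j _; rewrite (ddirD _ _ oU C1 Uz) !(ddirZ _ _ C1 Uz).
Qed.

#[local] Opaque ddir dx dy real_scale.

Lemma is_derive_bigsum (F : 'I_n -> R -> R) (F' : 'I_n -> R) (t : R) :
  (forall j, is_derive t 1 (F j) (F' j)) ->
  is_derive t 1 (fun t => \sum_j F j t) (\sum_j F' j).
Proof.
move=> dF; have -> : (fun t => \sum_j F j t) = \sum_j F j.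
  by apply/funext => s; rewrite fct_sumE.
exact: is_derive_sum.
Qed.

Lemma sum_quadratic (a b : 'I_n -> R) (XX XY YX YY : 'I_n -> 'I_n -> R) :
  \sum_j \sum_k (a j * a k * XX j k + a j * b k * XY j k +
                 b j * a k * YX j k + b j * b k * YY j k) =
  \sum_k (a k * (\sum_j (a j * XX j k + b j * YX j k)) +
          b k * (\sum_j (a j * XY j k + b j * YY j k))).
Proof.
rewrite exchange_big; apply: eq_bigr => k _ /=.
rewrite !mulr_sumr -big_split; apply: eq_bigr => j _ /=; ring.
Qed.

Definition hess f h y := \sum_j \sum_k
  (complex.Re (h j 0) * complex.Re (h k 0) * dx j (dx k f) y +
   complex.Re (h j 0) * complex.Im (h k 0) * dx j (dy k f) y +
   complex.Im (h j 0) * complex.Re (h k 0) * dy j (dx k f) y +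
   complex.Im (h j 0) * complex.Im (h k 0) * dy j (dy k f) y).

Lemma is_derive_line2 U f z h (t : R) : open U -> C2_on U f ->
  U (z + real_scale t h) ->
  is_derive t 1 (fun t => \sum_j (complex.Re (h j 0) * dx j f (z + real_scale t h) +
     complex.Im (h j 0) * dy j f (z + real_scale t h)))
    (hess f h (z + real_scale t h)).
Proof.
move=> oU [C1 C2] Uz; set y := z + real_scale t h in Uz *.
have -> : hess f h y = \sum_k (complex.Re (h k 0) * ddir h (dx k f) y +
    complex.Im (h k 0) * ddir h (dy k f) y).
  apply: etrans (sum_quadratic (fun j => complex.Re (h j 0))
    (fun j => complex.Im (h j 0)) (fun j k => dx j (dx k f) y)
    (fun j k => dx j (dy k f) y) (fun j k => dy j (dx k f) y)
    (fun j k => dy j (dy k f) y)) _.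
  apply: eq_bigr => k _; congr (complex.Re (h k 0) * _ + complex.Im (h k 0) * _).
    exact: esym (ddir_coord h oU (C2 (delta_mx k 0)) Uz).
  exact: esym (ddir_coord h oU (C2 ('i *: delta_mx k 0)) Uz).
apply: is_derive_bigsum => k; apply: is_deriveD.
  have C1x : C1_on U (dx k f) := C2 (delta_mx k 0).
  have d := is_derive_line C1x Uz.
  exact: (@is_deriveZ _ _ _ (fun t => dx k f (z + real_scale t h))
    (complex.Re (h k 0)) t 1 _ d).
have C1y : C1_on U (dy k f) := C2 ('i *: delta_mx k 0).
have d := is_derive_line C1y Uz.
exact: (@is_deriveZ _ _ _ (fun t => dy k f (z + real_scale t h))
  (complex.Im (h k 0)) t 1 _ d).
Qed.

Lemma taylor_lower U f z h (m : R) : open U -> C2_on U f ->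
  (forall s : R, 0 <= s <= 1 -> U (z + real_scale s h)) ->
  (forall s : R, 0 <= s <= 1 -> m <= hess f h (z + real_scale s h)) ->
  f z + ddir h f z + m / 2 <= f (z + h).
Proof.
move=> oU C2 hU hm; have [C1 _] := C2.
pose th1 (t : R) := \sum_j (complex.Re (h j 0) * dx j f (z + real_scale t h) +
     complex.Im (h j 0) * dy j f (z + real_scale t h)).
have U0 : U z by have := hU 0; rewrite lexx ler01 real_scale0 addr0; exact.
have th0 : th1 0 = ddir h f z.
  by rewrite (ddir_coord _ oU C1 U0) /th1 real_scale0 addr0.
have dth (t : R) : 0 <= t <= 1 -> is_derive t 1
   (fun t => f (z + real_scale t h)) (th1 t).
  move=> ht; have := is_derive_line C1 (hU t ht).
  by rewrite (ddir_coord _ oU C1 (hU t ht)).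
have th1_lower (t : R) : 0 <= t <= 1 -> m * t <= th1 t - th1 0.
  move=> /andP[t0 t1].
  have [|c /andP[c0 ct] ->] := @mvt_closed R th1
    (fun s => hess f h (z + real_scale s h)) 0 t t0.
    move=> s /andP[s0 st]; apply: (is_derive_line2 oU C2).
    by apply: hU; rewrite s0 (le_trans st).
  by rewrite subr0 ler_wpM2r// hm// c0 (le_trans ct).
(* After subtraction of the quadratic polynomial the derivative is nonnegative on the unit interval,
   by [th1_lower]. *)
have dg (t : R) : 0 <= t <= 1 -> is_derive t 1
    (fun t => f (z + real_scale t h) - (th1 0 * t + m / 2 * (t * t)))
    (th1 t - (th1 0 + m * t)).
  move=> ht; apply: is_deriveB; first exact: dth.
  by apply: is_derive_eq; rewrite /GRing.scale /= !mulr1; field.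
have [c c01] := mvt_closed (@ler01 R) dg.
rewrite real_scale0 addr0 real_scale1 !mulr1 !mulr0 !addr0 !subr0 => E.
have := th1_lower c c01; rewrite -th0.
by move: E; move: (f z) (f (z + h)) (th1 0) (th1 c) => a b d e; clear; lra.
Qed.

Lemma taylor_bound U f z h (m : R) : open U -> C2_on U f ->
  (forall s : R, 0 <= s <= 1 -> U (z + real_scale s h)) ->
  (forall s : R, 0 <= s <= 1 -> `|hess f h (z + real_scale s h)| <= m) ->
  `|f (z + h) - f z - ddir h f z| <= m.
Proof.
move=> oU C2 hU hm; have [C1 _] := C2.
have [c c01 ->] := mvt_line C1 hU; case/andP: (c01) => c0 c1.
have U0 : U z by have := hU 0; rewrite lexx ler01 real_scale0 addr0; exact.
rewrite (ddir_coord _ oU C1 U0) (ddir_coord _ oU C1 (hU c c01)).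
pose th1 (t : R) := \sum_j (complex.Re (h j 0) * dx j f (z + real_scale t h) +
     complex.Im (h j 0) * dy j f (z + real_scale t h)).
have [|d /andP[d0 dc]] := @mvt_closed R th1
    (fun s => hess f h (z + real_scale s h)) 0 c c0.
  move=> s /andP[s0 st]; apply: (is_derive_line2 oU C2).
  by apply: hU; rewrite s0 (le_trans st).
rewrite {2}/th1 real_scale0 addr0 -/(th1 c) => ->.
have d01 : 0 <= d <= 1 by rewrite d0 (le_trans dc).
rewrite subr0 normrM (le_trans _ (hm d d01))// ler_piMr//.
by rewrite ger0_norm.
Qed.

End DirectionalDerivative.

(** * Real linear and quadratic forms on C^n *)

Section QuadraticForms.
Variables (R : realType) (n : nat).
Local Notation C := (Cplx R).
Implicit Types (h z p y : 'cV[C]_n).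

(** The coefficients are arguments, here and in [quadform], so that differentials and Hessians at
    different points can be compared coefficient by coefficient. *)
Definition linform (X Y : 'I_n -> R) h : R :=
  \sum_j (complex.Re (h j 0) * X j + complex.Im (h j 0) * Y j).

Definition quadform (XX XY YX YY : 'I_n -> 'I_n -> R) h : R := \sum_j \sum_k
  (complex.Re (h j 0) * complex.Re (h k 0) * XX j k +
   complex.Re (h j 0) * complex.Im (h k 0) * XY j k +
   complex.Im (h j 0) * complex.Re (h k 0) * YX j k +
   complex.Im (h j 0) * complex.Im (h k 0) * YY j k).

Lemma Re_le_enorm h j : `|complex.Re (h j 0)| <= enorm h.
Proof. exact: le_trans (Re_le_cabs _) (cabs_le_enorm _ _). Qed.

Lemma Im_le_enorm h j : `|complex.Im (h j 0)| <= enorm h.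
Proof. exact: le_trans (Im_le_cabs _) (cabs_le_enorm _ _). Qed.

Lemma sum_ord_const (b : R) : \sum_(j < n) b = n%:R * b.
Proof. by rewrite sumr_const card_ord mulr_natl. Qed.

Lemma linform_close X Y X' Y' (e : R) h :
  (forall j, `|X j - X' j| <= e /\ `|Y j - Y' j| <= e) ->
  `|linform X Y h - linform X' Y' h| <= n%:R * 2 * e * enorm h.
Proof.
move=> H; rewrite /linform -sumrB; apply: le_trans (ler_norm_sum _ _ _) _.
apply: (@le_trans _ _ (\sum_(j < n) 2 * e * enorm h)); last first.
  by rewrite sum_ord_const !mulrA.
apply: ler_sum => j _; have [h1 h2] := H j.
set a := complex.Re _; set b := complex.Im _.
have -> : a * X j + b * Y j - (a * X' j + b * Y' j) =
  a * (X j - X' j) + b * (Y j - Y' j) by ring.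
apply: le_trans (ler_normD _ _) _; rewrite !normrM.
rewrite (_ : 2 * e * enorm h = enorm h * e + enorm h * e); last by ring.
by rewrite lerD// ler_pM// ?Re_le_enorm ?Im_le_enorm.
Qed.

Lemma quadform_close XX XY YX YY XX' XY' YX' YY' (e : R) h :
  (forall j k, [/\ `|XX j k - XX' j k| <= e, `|XY j k - XY' j k| <= e,
     `|YX j k - YX' j k| <= e & `|YY j k - YY' j k| <= e]) ->
  `|quadform XX XY YX YY h - quadform XX' XY' YX' YY' h|
    <= n%:R * n%:R * 4 * e * enorm h ^+ 2.
Proof.
move=> H; rewrite /quadform -sumrB; apply: le_trans (ler_norm_sum _ _ _) _.
apply: (@le_trans _ _ (\sum_(j < n) \sum_(k < n) 4 * e * enorm h ^+ 2)); last first.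
  by rewrite !sum_ord_const !mulrA.
apply: ler_sum => j _; rewrite -sumrB; apply: le_trans (ler_norm_sum _ _ _) _.
apply: ler_sum => k _; have [h1 h2 h3 h4] := H j k.
have Nj := Re_le_enorm h j; have Nk := Re_le_enorm h k.
have Mj := Im_le_enorm h j; have Mk := Im_le_enorm h k.
move: (complex.Re (h j 0) : R) (complex.Re (h k 0) : R) (complex.Im (h j 0) : R)
  (complex.Im (h k 0) : R) Nj Nk Mj Mk => a a' b b' Nj Nk Mj Mk.
set N := enorm h in Nj Nk Mj Mk *.
have T (u v x : R) : `|u| <= N -> `|v| <= N -> `|x| <= e -> `|u * v * x| <= e * N ^+ 2.
  move=> hu hv hx; rewrite !normrM mulrC expr2 ler_pM ?mulr_ge0//.
  exact: ler_pM.
have -> : a * a' * XX j k + a * b' * XY j k + b * a' * YX j k + b * b' * YY j k -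
  (a * a' * XX' j k + a * b' * XY' j k + b * a' * YX' j k + b * b' * YY' j k) =
  a * a' * (XX j k - XX' j k) + a * b' * (XY j k - XY' j k) +
  b * a' * (YX j k - YX' j k) + b * b' * (YY j k - YY' j k) by ring.
rewrite (_ : 4 * e * N ^+ 2 = e * N ^+ 2 + e * N ^+ 2 + e * N ^+ 2 + e * N ^+ 2).
  by do 3 ! (apply: le_trans (ler_normD _ _) _; apply: lerD; last exact: T); exact: T.
by ring.
Qed.

Lemma cRe_sum (I : finType) (F : I -> C) :
  complex.Re (\sum_i F i) = \sum_i complex.Re (F i).
Proof. by apply: (big_morph (fun x : C => complex.Re x) (@cReD R)). Qed.

Definition hermform (P Q : 'I_n -> 'I_n -> R) h : C :=
  \sum_j \sum_k cpx (P j k) (Q j k) * h j 0 * (h k 0)^*.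

Definition holform (P Q : 'I_n -> 'I_n -> R) h : C :=
  \sum_j \sum_k cpx (P j k) (Q j k) * h j 0 * h k 0.

(** The splitting into types (2,0) + (0,2) and (1,1). It holds for each pair of indices separately,
    so the mixed second derivatives need not commute; for a Hessian the second summand is twice the
    Levi form. *)
Lemma quadform_split XX XY YX YY h :
  quadform XX XY YX YY h =
  2 * complex.Re (holform (fun j k => (XX j k - YY j k) / 4)
                          (fun j k => - (XY j k + YX j k) / 4) h) +
  2 * complex.Re (hermform (fun j k => (XX j k + YY j k) / 4)
                          (fun j k => (XY j k - YX j k) / 4) h).
Proof.
rewrite /holform /hermform !cRe_sum !mulr_sumr -big_split; apply: eq_bigr => j _ /=.
rewrite !cRe_sum !mulr_sumr -big_split; apply: eq_bigr => k _ /=.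
rewrite !(cReM, cImM) cRe_conj cIm_conj !Re_cpx !Im_cpx.
move: (complex.Re (h j 0) : R) (complex.Re (h k 0) : R) (complex.Im (h j 0) : R)
  (complex.Im (h k 0) : R) => a a' b b'; by field.
Qed.

Lemma linform_Re X Y h : linform X Y h =
  2 * complex.Re (\sum_j cpx (X j / 2) (- Y j / 2) * h j 0).
Proof.
rewrite /linform cRe_sum mulr_sumr; apply: eq_bigr => j _.
rewrite cReM Re_cpx Im_cpx.
by move: (complex.Re (h j 0) : R) (complex.Im (h j 0) : R) => a b; field.
Qed.

(* The scalar part of [levi_peak], which is Taylor's formula for
   rho + M rho ^ 2: m = rho z, r = rho (z + h), x and y are the differentials of
   rho at z and at p applied to h, ReS + L is half the Hessian at p split into
   its holomorphic and Hermitian parts, and w2, Rw2 are |w|^2 and Re w^2 where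
   y = 2 Re w. *)
Lemma levi_peak_real (m r x y q N eta B M c ReS L w2 Rw2 T : R) :
  0 <= M -> 0 <= B -> 0 <= eta <= 1 -> M * eta <= 1 -> 0 <= N <= 2 * eta -> q = N ^+ 2 ->
  - eta <= m <= 0 -> - eta <= r <= 0 ->
  m + x + (ReS + L) - eta * q <= r -> `|r - m - x| <= B * q ->
  `|x - y| <= eta * N -> `|y| <= B * N ->
  c * q <= L + 2 * M * w2 -> y ^+ 2 = 2 * w2 + 2 * Rw2 ->
  T = 1 + 2 * M * (1 + 2 * (B + 1)) * B + M * (2 * B + 1) -> eta * T <= c / 2 ->
  m + ((1 + 2 * M * m) * x + ReS + 2 * M * Rw2) + c / 2 * q <= 0.
Proof.
move=> M0 B0 /andP[eta0 eta1] Meta /andP[N0 N1] qE /andP[m1 m0] /andP[r1 r0] T1 T2 xy yB Lc yE TE Tc.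
have q0 : 0 <= q by rewrite qE sqr_ge0.
set e := r - m - x in T2.
have rE : r = m + x + e by rewrite /e; ring.
have xB : `|x| <= (B + 1) * N.
  rewrite -(subrK y x) (le_trans (ler_normD _ _))// mulrDl mul1r addrC lerD//.
  by rewrite (le_trans xy)// ler_piMl.
have mx : `|m + x| <= eta * (1 + 2 * (B + 1)).
  apply: le_trans (ler_normD _ _) _; rewrite mulrDr mulr1 lerD//.
    by rewrite ler_norml; lra.
  apply: le_trans xB _; rewrite (_ : eta * _ = (B + 1) * (2 * eta)); last by ring.
  by apply: ler_wpM2l => //; rewrite addr_ge0.
have h1 : `|(m + x) * e| <= eta * (1 + 2 * (B + 1)) * B * q.
  by rewrite normrM -mulrA ler_pM.
have h2 : `|(x - y) * (x + y)| <= eta * (2 * B + 1) * q.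
  rewrite normrM qE expr2 mulrACA; apply: ler_pM => //.
  by rewrite (le_trans (ler_normD _ _))// (_ : _ * N = (B + 1) * N + B * N) ?lerD//; ring.
(* Expanding the square of r = m + x + e leaves 2 m x + y^2 up to terms of order eta q. The term y^2
   supplies the |w|^2 by which the Levi form has to be completed. *)
have r2 : 2 * m * x + y ^+ 2 - 2 * (eta * (1 + 2 * (B + 1)) * B * q) -
    eta * (2 * B + 1) * q <= r ^+ 2.
  have -> : r ^+ 2 = m ^+ 2 + 2 * m * x + y ^+ 2 + (x - y) * (x + y) +
    2 * ((m + x) * e) + e ^+ 2 by rewrite rE; ring.
  have := sqr_ge0 m; have := sqr_ge0 e.
  move: h1 h2; rewrite !ler_norml => /andP[h1 _] /andP[h2 _].
  by move: (m ^+ 2) (e ^+ 2) (y ^+ 2) (_ * (x + y)) (_ * e) h1 h2 => *; lra.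
(* [M * eta <= 1] and [- eta <= r] keep 1 + M r nonnegative, so rho + M rho^2 is still at most 0 in
   the domain. *)
have rr : r + M * r ^+ 2 <= 0.
  have -> : r + M * r ^+ 2 = r * (1 + M * r) by ring.
  apply: mulr_le0_ge0 => //.
  have : M * (- eta) <= M * r by rewrite ler_wpM2l.
  by lra.
have Mr2 := ler_wpM2l M0 r2.
have Tq : eta * T * q <= c / 2 * q by rewrite ler_wpM2r.
have E : eta * T * q = eta * q + M * (2 * (eta * (1 + 2 * (B + 1)) * B * q)) +
   M * (eta * (2 * B + 1) * q) by rewrite TE; ring.
have E2 : M * (2 * m * x + y ^+ 2 - 2 * (eta * (1 + 2 * (B + 1)) * B * q) -
    eta * (2 * B + 1) * q) = 2 * M * m * x + 2 * M * w2 + 2 * M * Rw2 -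
    M * (2 * (eta * (1 + 2 * (B + 1)) * B * q)) - M * (eta * (2 * B + 1) * q).
  by rewrite yE; ring.
rewrite E2 in Mr2; rewrite E in Tq.
rewrite (_ : (1 + 2 * M * m) * x = x + 2 * M * m * x); last by ring.
clear - Mr2 Tq rr T1 Lc.
move: (M * (2 * _)) (M * (eta * _ * q)) (M * r ^+ 2) (2 * M * m * x) (2 * M * w2)
  (2 * M * Rw2) Mr2 Tq rr T1 Lc => *; lra.
Qed.

End QuadraticForms.

Section FormPositivity.
Variables (R : realType) (n : nat).
Local Notation C := (Cplx R).
Implicit Types (h z p y : 'cV[C]_n).

Lemma continuous_enorm_lip (F : 'cV[C]_n -> R) (K : R) : 0 < K ->
  (forall h h', `|F h - F h'| <= K * enorm (h - h')) -> continuous F.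
Proof.
move=> K0 H h B /nbhs_ballP[e /= e0 hB]; apply/nbhs_enorm.
exists (e / K); first exact: divr_gt0.
move=> h' hh; apply: hB; apply: le_lt_trans (H _ _) _.
by rewrite mulrC -ltr_pdivlMr// enormB.
Qed.

Lemma continuous_Re j : continuous (fun h : 'cV[C]_n => complex.Re (h j 0) : R).
Proof.
apply: (@continuous_enorm_lip _ 1) => // h h'; rewrite mul1r.
have -> : complex.Re (h j 0) - complex.Re (h' j 0) = complex.Re ((h - h') j 0).
  by rewrite !mxE cReD cReN.
exact: Re_le_enorm.
Qed.

Lemma continuous_Im j : continuous (fun h : 'cV[C]_n => complex.Im (h j 0) : R).
Proof.
apply: (@continuous_enorm_lip _ 1) => // h h'; rewrite mul1r.
have -> : complex.Im (h j 0) - complex.Im (h' j 0) = complex.Im ((h - h') j 0).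
  by rewrite !mxE cImD cImN.
exact: Im_le_enorm.
Qed.

Lemma continuous_fin_sum (I : finType) (F : I -> 'cV[C]_n -> R) :
  (forall i, continuous (F i)) -> continuous (fun h => \sum_i F i h).
Proof.
move=> cF; apply: continuous_big; first exact: add_continuous.
by move=> i _; exact: cF.
Qed.

Lemma continuous_mul_cV (F G : 'cV[C]_n -> R) :
  continuous F -> continuous G -> continuous (fun h => F h * G h).
Proof. by move=> cF cG h; exact: (cvgM (cF h) (cG h)). Qed.

Lemma continuous_add_cV (F G : 'cV[C]_n -> R) :
  continuous F -> continuous G -> continuous (fun h => F h + G h).
Proof. by move=> cF cG h; exact: (cvgD (cF h) (cG h)). Qed.

Lemma continuous_scale_cV (F : 'cV[C]_n -> R) (a : R) :
  continuous F -> continuous (fun h => F h * a).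
Proof.
by move=> cF; apply: (continuous_mul_cV cF (G := fun=> a)); exact: cst_continuous.
Qed.

Lemma continuous_linform X Y : continuous (@linform R n X Y).
Proof.
apply: continuous_fin_sum => j.
by apply: continuous_add_cV; apply: continuous_scale_cV;
  [exact: continuous_Re|exact: continuous_Im].
Qed.

Lemma continuous_quadform XX XY YX YY : continuous (@quadform R n XX XY YX YY).
Proof.
apply: continuous_fin_sum => j; apply: continuous_fin_sum => k.
have r := continuous_Re; have i := continuous_Im.
apply: continuous_add_cV; [apply: continuous_add_cV; [apply: continuous_add_cV|]|];
  apply: continuous_scale_cV.
- exact: continuous_mul_cV (r j) (r k).
- exact: continuous_mul_cV (r j) (i k).
- exact: continuous_mul_cV (i j) (r k).
- exact: continuous_mul_cV (i j) (i k).
Qed.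

Lemma Re_real_scale (t : R) h j : complex.Re (real_scale t h j 0) = t * complex.Re (h j 0).
Proof. by rewrite mxE cReM /= mul0r subr0. Qed.

Lemma Im_real_scale (t : R) h j : complex.Im (real_scale t h j 0) = t * complex.Im (h j 0).
Proof. by rewrite mxE cImM /= mul0r addr0. Qed.

Lemma linform_scale X Y (t : R) h : linform X Y (real_scale t h) = t * linform X Y h.
Proof.
rewrite /linform mulr_sumr; apply: eq_bigr => j _.
by rewrite Re_real_scale Im_real_scale mulrDr !mulrA.
Qed.

Lemma quadform_scale XX XY YX YY (t : R) h :
  quadform XX XY YX YY (real_scale t h) = t ^+ 2 * quadform XX XY YX YY h.
Proof.
rewrite /quadform mulr_sumr; apply: eq_bigr => j _.
rewrite mulr_sumr; apply: eq_bigr => k _.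
by rewrite !Re_real_scale !Im_real_scale; ring.
Qed.

(** On the unit sphere F is bounded below near the zeros of G, while elsewhere a large multiple of G
    outweighs F. Homogeneity of degree 2 extends the inequality from the sphere. *)
Lemma form_positive (F G : 'cV[C]_n -> R) : continuous F -> continuous G ->
  (forall (t : R) h, F (real_scale t h) = t ^+ 2 * F h) ->
  (forall (t : R) h, G (real_scale t h) = t ^+ 2 * G h) ->
  (forall h, 0 <= G h) -> (forall h, h != 0 -> G h = 0 -> 0 < F h) ->
  exists M c : R, [/\ 0 <= M, 0 < c & forall h, c * enorm h ^+ 2 <= F h + M * G h].
Proof.
move=> cF cG FZ GZ G0 FG.
pose S := [set h : 'cV[C]_n | enorm h = 1].
have cS : compact S.
  apply: (@heine_borel _ _ _ 1); last by move=> z /= ->.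
  apply: closed_enorm => z hz; apply/eqP; rewrite eq_le; apply/andP; split.
    apply/ler_addgt0Pr => e e0; have [w /= w1 wz] := hz e e0.
    by rewrite -w1 -(subrK w z) (le_trans (enormD _ _))// addrC lerD2l enormB ltW.
  apply/ler_addgt0Pr => e e0; have [w /= w1 wz] := hz e e0.
  by rewrite -w1 -(subrK z w) (le_trans (enormD _ _))// addrC lerD2l ltW.
(* A single constant plays both parts, as the multiplier of G and through its inverse as the lower
   bound, because [compact_uniform] carries one parameter. *)
pose P (M : R) h := 0 < M /\ M^-1 <= F h + M * G h.
have [||M hM] := compact_uniform cS (P := P).
- move=> M M' h MM' [M0 hM]; have M'0 := lt_le_trans M0 MM'.
  split=> //; apply: (@le_trans _ _ M^-1); first by rewrite lef_pV2.
  by apply: le_trans hM _; rewrite lerD2l ler_wpM2r.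
- move=> h0 /= h01; have h00 : h0 != 0 by rewrite -enorm_gt0 h01.
  have [Gz|Gz] := eqVneq (G h0) 0.
    have F0 := FG _ h00 Gz.
    have [e e0 he] : exists2 e : R, 0 < e & forall h, enorm (h - h0) < e -> F h0 / 2 <= F h.
      apply/nbhs_enorm; have /cvgrPdist_le/(_ (F h0 / 2)) := cF h0.
      move=> /(_ ltac:(by rewrite divr_gt0)); apply: filterS => h.
      by rewrite ler_norml => /andP[_]; rewrite lerBlDr; lra.
    exists (2 / F h0), e; split=> // h /he hF; split; first by rewrite divr_gt0.
    rewrite invf_div; apply: le_trans hF _; rewrite lerDl mulr_ge0// divr_ge0//.
    exact: ltW.
  have Gp : 0 < G h0 by rewrite lt_def Gz G0.
  have [e e0 he] : exists2 e : R, 0 < e & forall h, enorm (h - h0) < e ->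
      F h0 - 1 <= F h /\ G h0 / 2 <= G h.
    apply/nbhs_enorm; apply: filterI.
      have /cvgrPdist_le/(_ 1 ltr01) := cF h0; apply: filterS => h.
      by rewrite ler_norml => /andP[_]; rewrite lerBlDr; lra.
    have /cvgrPdist_le/(_ (G h0 / 2)) := cG h0.
    move=> /(_ ltac:(by rewrite divr_gt0)); apply: filterS => h.
    by rewrite ler_norml => /andP[_]; rewrite lerBlDr; lra.
  (* Near h0 the term M G is then at least |F h0| + 2, while F is at least F h0 - 1, so the sum is
     at least 1. *)
  pose M := 1 + (`|F h0| + 2) / (G h0 / 2).
  have M1 : 1 <= M by rewrite lerDl divr_ge0 ?addr_ge0// divr_ge0// ltW.
  exists M, e; split=> // h /he[hF hG].
  have M0 : 0 < M by exact: lt_le_trans M1.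
  split=> //; apply: (@le_trans _ _ 1); first by rewrite invf_le1.
  have : M * (G h0 / 2) <= M * G h by rewrite ler_wpM2l// ltW.
  have -> : M * (G h0 / 2) = G h0 / 2 + (`|F h0| + 2).
    by rewrite /M mulrDl mul1r divfK// gt_eqF// divr_gt0.
  have := ler_norm (- F h0); rewrite normrN.
  move: hF Gp; clear; move: (F h0) (F h) (G h0) (M * _) `|_| => a b c d f; lra.
pose M' := Num.max 1 M.
have M'0 : 0 < M' by rewrite lt_max ltr01.
exists M', M'^-1; split; [exact: ltW|by rewrite invr_gt0|].
move=> h; have [->|h0] := eqVneq h 0.
  rewrite enorm0 expr0n mulr0.
  have -> : (0 : 'cV[C]_n) = real_scale 0 0 by rewrite real_scale0.
  by rewrite FZ GZ expr0n /= !mul0r mulr0 addr0.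
have eh : 0 < enorm h by rewrite enorm_gt0.
pose u := real_scale (enorm h)^-1 h.
have hu : h = real_scale (enorm h) u.
  by rewrite /u real_scaleA mulfV ?gt_eqF// real_scale1.
have Su : S u.
  by rewrite /S /= /u enorm_real_scale ger0_norm ?invr_ge0 ?enorm_ge0// mulVf ?gt_eqF.
have [M0 PM] := hM _ Su.
have FE : F h = enorm h ^+ 2 * F u by rewrite {1}hu FZ.
have GE : G h = enorm h ^+ 2 * G u by rewrite {1}hu GZ.
rewrite FE GE (mulrCA M') -mulrDr [leLHS]mulrC ler_wpM2l ?sqr_ge0//.
apply: (@le_trans _ _ M^-1); first by rewrite lef_pV2 ?posrE// le_max lexx orbT.
by apply: le_trans PM _; rewrite lerD2l ler_wpM2r// le_max lexx orbT.
Qed.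

End FormPositivity.

(** * The Levi polynomial *)

Section LeviPeak.
Variables (R : realType) (n : nat).
Local Notation C := (Cplx R).
Implicit Types (h z p y w : 'cV[C]_n) (Om : set 'cV[C]_n) (rho : 'cV[C]_n -> R).

Lemma cpx_div (a b c : R) : ((a +i* b)%C : C) / ((c%:C)%C : C) = cpx (a / c) (b / c).
Proof.
rewrite -fmorphV; apply: complex_ext.
  by rewrite cReM /= mulr0 subr0.
by rewrite cImM /= mulr0 add0r.
Qed.

Lemma levi_coefE rho z (j k : 'I_n) : levi_coef rho z j k =
  cpx ((dx j (dx k rho) z + dy j (dy k rho) z) / 4)
      ((dx j (dy k rho) z - dy j (dx k rho) z) / 4).
Proof.
rewrite /levi_coef -(cpx_div _ _ 4); congr (_ / _).
by rewrite rmorph_nat.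
Qed.

Lemma wirtingerE rho z (j : 'I_n) : wirtinger rho z j =
  cpx (dx j rho z / 2) (- dy j rho z / 2).
Proof.
rewrite /wirtinger -(cpx_div _ _ 2); congr (_ / _).
by rewrite rmorph_nat.
Qed.

Lemma Re_hermform (P Q : 'I_n -> 'I_n -> R) h :
  complex.Re (hermform P Q h) = quadform P Q (fun j k => - Q j k) P h.
Proof.
rewrite /hermform /quadform cRe_sum; apply: eq_bigr => j _.
rewrite cRe_sum; apply: eq_bigr => k _.
rewrite !(cReM, cImM) cRe_conj cIm_conj !Re_cpx !Im_cpx.
by move: (complex.Re (h j 0) : R) (complex.Re (h k 0) : R) (complex.Im (h j 0) : R)
  (complex.Im (h k 0) : R) => a a' b b'; ring.
Qed.

Lemma cIm_sum (I : finType) (F : I -> C) :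
  complex.Im (\sum_i F i) = \sum_i complex.Im (F i).
Proof. by apply: (big_morph (fun x : C => complex.Im x) (@cImD R)). Qed.

Lemma cabs_sqr_linear (a b : 'I_n -> R) h :
  cabs (\sum_j cpx (a j) (b j) * h j 0) ^+ 2 =
  linform a (fun j => - b j) h * linform a (fun j => - b j) h +
  linform b a h * linform b a h.
Proof.
rewrite cabs_sqr !expr2 cRe_sum cIm_sum /linform.
congr (_ * _ + _ * _); apply: eq_bigr => j _;
 rewrite ?cReM ?cImM Re_cpx Im_cpx;
 by move: (complex.Re (h j 0) : R) (complex.Im (h j 0) : R) => u v; ring.
Qed.

Lemma finite_bound (I : finType) (F : I -> R) :
  exists2 E : R, 0 <= E & forall i, `|F i| <= E.
Proof.
exists (\sum_i `|F i|); first by rewrite sumr_ge0.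
by move=> i; rewrite (bigD1 i)//= lerDl sumr_ge0.
Qed.

Lemma continuous_close (f : 'cV[C]_n -> R) p (e : R) : 0 < e ->
  {for p, continuous f} -> nbhs p [set y | `|f y - f p| <= e].
Proof.
move=> e0 /cvgrPdist_le/(_ _ e0); apply: filterS => y.
by rewrite distrC.
Qed.

(** Strong pseudoconvexity concerns complex tangential vectors only; a multiple of the squared
    complex differential makes the form positive in all directions. The same M becomes the
    coefficient of rho^2 in [levi_peak]. *)
Lemma levi_positive rho p :
  (forall v : 'cV[C]_n, v != 0 -> \sum_j wirtinger rho p j * v j 0 = 0 ->
    0 < levi_form rho p v) ->
  exists M c : R, [/\ 0 <= M, 0 < c & forall h, c * enorm h ^+ 2 <=
    complex.Re (levi_form rho p h) +
    2 * M * cabs (\sum_j wirtinger rho p j * h j 0) ^+ 2].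
Proof.
move=> pos.
pose P (j k : 'I_n) := (dx j (dx k rho) p + dy j (dy k rho) p) / 4.
pose Q (j k : 'I_n) := (dx j (dy k rho) p - dy j (dx k rho) p) / 4.
pose a (j : 'I_n) := dx j rho p / 2; pose b (j : 'I_n) := - dy j rho p / 2.
have LE h : levi_form rho p h = hermform P Q h.
  apply: eq_bigr => j _; apply: eq_bigr => k _.
  by congr (_ * _ * _); exact: levi_coefE.
have WE h : \sum_j wirtinger rho p j * h j 0 = \sum_j cpx (a j) (b j) * h j 0.
  by apply: eq_bigr => j _; congr (_ * _); exact: wirtingerE.
have := @form_positive R n (fun h => complex.Re (levi_form rho p h))
  (fun h => cabs (\sum_j wirtinger rho p j * h j 0) ^+ 2).
case.
- rewrite (_ : (fun h => _) = quadform P Q (fun j k => - Q j k) P).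
    exact: continuous_quadform.
  by apply/funext => h; rewrite LE Re_hermform.
- rewrite (_ : (fun h => _) = fun h =>
      linform a (fun j => - b j) h * linform a (fun j => - b j) h +
      linform b a h * linform b a h).
    by apply: continuous_add_cV; apply: continuous_mul_cV; exact: continuous_linform.
  by apply/funext => h; rewrite WE cabs_sqr_linear.
- by move=> t h; rewrite !LE !Re_hermform quadform_scale.
- by move=> t h; rewrite !WE !cabs_sqr_linear !linform_scale; ring.
- by move=> h; exact: sqr_ge0.
- move=> h h0 /eqP; rewrite sqrf_eq0 cabs_eq0 => /eqP W0.
  by have := pos h h0 W0; rewrite ltcE => /andP[].
move=> M [c [M0 c0 H]]; exists (M / 2), c; split=> //; first by rewrite divr_ge0.
by move=> h; rewrite (_ : 2 * (M / 2) = M); [exact: H|field].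
Qed.

Lemma defining_function_bdry0 Om p U rho : open Om -> bdry Om p ->
  defining_function Om p U rho -> rho p = 0.
Proof.
move=> oOm /(bdryP _ oOm)[cl nOm] [oU Up [C1 _] OmU _].
apply/eqP; rewrite eq_le; apply/andP; split; last first.
  rewrite leNgt; apply/negP => r0; apply: nOm.
  have : (Om `&` U) p by rewrite OmU.
  by case.
rewrite leNgt; apply/negP => r0.
have [cr _] := C1 _ Up.
have r2 : 0 < rho p / 2 by rewrite divr_gt0.
have [e e0 he] := (nbhs_enorm _ _).1
  (filterI (open_nbhs_nbhs (conj oU Up)) (continuous_close r2 cr)).
have [w Omw /he[Uw rw]] := (closure_enorm _ _).1 cl e e0.
have : [set z | U z /\ rho z < 0] w by rewrite -OmU.
move=> /= [_ rw0].
move: rw; rewrite /= ler_norml => /andP[h _].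
by move: (rho w) (rho p) r0 rw0 h; clear => a b; lra.
Qed.

Lemma linear_sqr_quadratic (w : 'I_n -> C) h :
  (\sum_j w j * h j 0) ^+ 2 = \sum_j \sum_k w j * w k * h j 0 * h k 0.
Proof.
rewrite expr2 mulr_suml; apply: eq_bigr => j _.
by rewrite mulr_sumr; apply: eq_bigr => k _; ring.
Qed.

End LeviPeak.

Section LeviPeakMain.
Variables (R : realType) (n : nat).
Local Notation C := (Cplx R).
Implicit Types (h z p y w : 'cV[C]_n) (Om : set 'cV[C]_n) (rho : 'cV[C]_n -> R).

Lemma linform_bound (X Y : 'I_n -> R) (E : R) h :
  (forall j, `|X j| <= E) -> (forall j, `|Y j| <= E) ->
  `|linform X Y h| <= n%:R * 2 * E * enorm h.
Proof.
move=> HX HY; have Z : linform (fun=> 0) (fun=> 0) h = 0 :> R.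
  by rewrite /linform big1// => j _; rewrite !mulr0 addr0.
rewrite -[linform X Y h]subr0 -Z; apply: linform_close => j.
by rewrite !subr0; split.
Qed.

Lemma quadform_bound (XX XY YX YY : 'I_n -> 'I_n -> R) (E : R) h :
  (forall j k, [/\ `|XX j k| <= E, `|XY j k| <= E, `|YX j k| <= E & `|YY j k| <= E]) ->
  `|quadform XX XY YX YY h| <= n%:R * n%:R * 4 * E * enorm h ^+ 2.
Proof.
move=> H; pose O (j k : 'I_n) : R := 0.
have Z : quadform O O O O h = 0 :> R.
  rewrite /quadform big1// => j _; rewrite big1// => k _.
  by rewrite /O !mulr0 !addr0.
rewrite -[quadform XX _ _ _ h]subr0 -Z; apply: quadform_close => j k.
by rewrite !subr0; exact: H.
Qed.

Lemma filter_forall2 (F : set_system 'cV[C]_n) {FF : Filter F}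
    (P : 'I_n -> 'I_n -> set 'cV[C]_n) :
  (forall j k, F (P j k)) -> F [set y | forall j k, P j k y].
Proof.
move=> H; have H' (jk : 'I_n * 'I_n) : F (P jk.1 jk.2) by exact: H.
have := @filter_forall _ _ (fun jk y => P jk.1 jk.2 y) F FF H'.
by apply: filterS => y Hy j k; exact: (Hy (j, k)).
Qed.

Lemma filter_forall1 (F : set_system 'cV[C]_n) {FF : Filter F}
    (P : 'I_n -> set 'cV[C]_n) :
  (forall j, F (P j)) -> F [set y | forall j, P j y].
Proof.
move=> H; have := @filter_forall _ _ (fun j y => P j y) F FF H.
by apply: filterS => y Hy j; exact: Hy.
Qed.

(** The polynomial is centred at interior points z, with [eps] and [c] independent of z, because the
    discs to be estimated start at z. Its linear part is computed at z and its quadratic part at p,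
    so that continuity of the second derivatives at p controls the error. *)
Lemma levi_peak Om p : open Om -> bdry Om p -> strongly_levi_pseudoconvex_at Om p ->
  exists (rho : 'cV[C]_n -> R) (eps c K : R), [/\ 0 < eps, 0 < c, 0 < K,
    (forall z, enorm (z - p) < eps -> (Om z <-> rho z < 0)) &
    (forall z w, enorm (z - p) < eps -> enorm (w - p) < eps ->
       `|rho w - rho z| <= K * enorm (w - z)) /\
    (forall z, enorm (z - p) < eps -> Om z ->
      exists (A : 'I_n -> C) (B : 'I_n -> 'I_n -> C), forall h, enorm h < eps ->
        Om (z + h) ->
        rho z + complex.Re (\sum_j A j * h j 0 +
          \sum_j \sum_k B j k * h j 0 * h k 0) + c * enorm h ^+ 2 <= 0)].
Proof.
move=> oOm bp [U [rho [def /levi_positive[M [c [M0 c0 Mc]]]]]].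
have rp := defining_function_bdry0 oOm bp def.
case: def => oU Up C2 OmU _; have [C1 C2'] := C2.
pose X y j := dx j rho y; pose Y y j := dy j rho y.
pose XX y j k := dx j (dx k rho) y; pose XY y j k := dx j (dy k rho) y.
pose YX y j k := dy j (dx k rho) y; pose YY y j k := dy j (dy k rho) y.
have ddirE h y : U y -> ddir h rho y = linform (X y) (Y y) h.
  by move=> Uy; rewrite (ddir_coord h oU C1 Uy).
have hessE h y : hess rho h y = quadform (XX y) (XY y) (YX y) (YY y) h by [].
pose Wp h := \sum_j wirtinger rho p j * h j 0.
have WE y h : linform (X y) (Y y) h = 2 * complex.Re (\sum_j wirtinger rho y j * h j 0).
  rewrite linform_Re; congr (2 * complex.Re _); apply: eq_bigr => j _.
  by rewrite wirtingerE.
pose Sp := holform (fun j k => (XX p j k - YY p j k) / 4)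
                   (fun j k => - (XY p j k + YX p j k) / 4).
have hpE h : hess rho h p = 2 * (complex.Re (Sp h) + complex.Re (levi_form rho p h)).
  rewrite hessE quadform_split -mulrDr; congr (2 * (_ + complex.Re _)).
  apply: eq_bigr => j _; apply: eq_bigr => k _.
  by congr (_ * _ * _); rewrite levi_coefE.
have cd1 j : {for p, continuous (fun y => X y j)} /\ {for p, continuous (fun y => Y y j)}.
  by have [_ H] := C1 _ Up; split; [exact: (H (delta_mx j 0)).2|
    exact: (H ('i *: delta_mx j 0)).2].
have cd2 j k : [/\ {for p, continuous (fun y => XX y j k)},
    {for p, continuous (fun y => XY y j k)}, {for p, continuous (fun y => YX y j k)} &
    {for p, continuous (fun y => YY y j k)}].
  have [_ Hx] := C2' (delta_mx k 0) _ Up; have [_ Hy] := C2' ('i *: delta_mx k 0) _ Up.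
  split; [exact: (Hx (delta_mx j 0)).2|exact: (Hy (delta_mx j 0)).2|
    exact: (Hx ('i *: delta_mx j 0)).2|exact: (Hy ('i *: delta_mx j 0)).2].
have [c_rho _] := C1 _ Up.
have {}Mc h : c * enorm h ^+ 2 <= complex.Re (levi_form rho p h) + 2 * M * cabs (Wp h) ^+ 2.
  exact: Mc.

clearbody XX XY YX YY X Y.
have [E E0 [HX HY HXX]] : exists2 E : R, 0 <= E & [/\ forall j, `|X p j| <= E,
    forall j, `|Y p j| <= E & forall j k, [/\ `|XX p j k| <= E, `|XY p j k| <= E,
    `|YX p j k| <= E & `|YY p j k| <= E]].
  have [e1 p1 h1] := finite_bound (X p); have [e2 p2 h2] := finite_bound (Y p).
  have [e3 p3 h3] := finite_bound (fun jk : 'I_n * 'I_n => XX p jk.1 jk.2).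
  have [e4 p4 h4] := finite_bound (fun jk : 'I_n * 'I_n => XY p jk.1 jk.2).
  have [e5 p5 h5] := finite_bound (fun jk : 'I_n * 'I_n => YX p jk.1 jk.2).
  have [e6 p6 h6] := finite_bound (fun jk : 'I_n * 'I_n => YY p jk.1 jk.2).
  exists (e1 + e2 + e3 + e4 + e5 + e6); first by rewrite !addr_ge0.
  split=> [j|j|j k].
  - by apply: le_trans (h1 j) _; clear - p1 p2 p3 p4 p5 p6; lra.
  - by apply: le_trans (h2 j) _; clear - p1 p2 p3 p4 p5 p6; lra.
  - have := h3 (j, k); have := h4 (j, k); have := h5 (j, k); have := h6 (j, k).
    move=> /= g6 g5 g4 g3; split; [apply: le_trans g3 _|apply: le_trans g4 _|
      apply: le_trans g5 _|apply: le_trans g6 _];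
      by clear - p1 p2 p3 p4 p5 p6; lra.
pose B := n%:R * 2 * E + n%:R * n%:R * 4 * E + 1.
have nn0 : 0 <= n%:R * n%:R * 4 * E :> R by rewrite !mulr_ge0.
have nn1 : 0 <= n%:R * 2 * E :> R by rewrite !mulr_ge0.
have B0 : 0 <= B by rewrite !addr_ge0.
pose T := 1 + 2 * M * (1 + 2 * (B + 1)) * B + M * (2 * B + 1).
have T0 : 0 < T.
  rewrite /T -addrA ltr_pwDl// addr_ge0// !mulr_ge0// ?addr_ge0 ?mulr_ge0//.
  by rewrite addr_ge0.
pose eta := Num.min 1 (Num.min (1 / (M + 1)) (c / 2 / T)).
have M1 : 0 < M + 1 by rewrite ltr_wpDl.
have eta0 : 0 < eta by rewrite !lt_min ltr01 !divr_gt0.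
have eta1 : eta <= 1 by rewrite ge_min lexx.
have etaM : M * eta <= 1.
  apply: (@le_trans _ _ ((M + 1) * (1 / (M + 1)))).
    apply: ler_pM => //; [exact: ltW|by rewrite lerDl|].
    by rewrite /eta !ge_min lexx orbT.
  by rewrite mulrC divfK// gt_eqF.
have etaT : eta * T <= c / 2.
  by rewrite -ler_pdivlMr// /eta !ge_min lexx !orbT.
(* If all coefficients move by at most zeta = eta / D, then differentials move by at most eta |h|
   and Hessians by at most eta |h|^2. *)
pose D := n%:R * n%:R * 4 + n%:R * 2 + 1 : R.
have D0 : 0 < D by rewrite ltr_wpDl// addr_ge0// !mulr_ge0.
pose zeta := eta / D.
have zeta0 : 0 < zeta by rewrite divr_gt0.
have zD1 : n%:R * 2 * zeta <= eta.
  rewrite /zeta mulrA ler_pdivrMr// mulrC; apply: ler_wpM2l; first exact: ltW.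
  by rewrite /D addrAC lerDr addr_ge0// !mulr_ge0.
have zD2 : n%:R * n%:R * 4 * zeta <= eta.
  rewrite /zeta mulrA ler_pdivrMr// mulrC; apply: ler_wpM2l; first exact: ltW.
  by rewrite /D -addrA lerDl addr_ge0// !mulr_ge0.
have [e0 e00 he0] : exists2 e : R, 0 < e & forall y, enorm (y - p) < e ->
    [/\ U y, `|rho y - rho p| <= eta,
     (forall j, `|X y j - X p j| <= zeta /\ `|Y y j - Y p j| <= zeta) &
     (forall j k, [/\ `|XX y j k - XX p j k| <= zeta, `|XY y j k - XY p j k| <= zeta,
       `|YX y j k - YX p j k| <= zeta & `|YY y j k - YY p j k| <= zeta])].
  apply/nbhs_enorm.
  have n1 := open_nbhs_nbhs (conj oU Up).
  have n2 := continuous_close eta0 c_rho.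
  have n3 : nbhs p [set y | forall j, `|X y j - X p j| <= zeta /\ `|Y y j - Y p j| <= zeta].
    apply: filter_forall1 => j; have [c1 c2] := cd1 j.
    exact: filterI (continuous_close zeta0 c1) (continuous_close zeta0 c2).
  have n4 : nbhs p [set y | forall j k, [/\ `|XX y j k - XX p j k| <= zeta,
      `|XY y j k - XY p j k| <= zeta,
       `|YX y j k - YX p j k| <= zeta & `|YY y j k - YY p j k| <= zeta]].
    apply: filter_forall2 => j k; have [c1 c2 c3 c4] := cd2 j k.
    apply: (filterS _ (filterI
      (filterI (continuous_close zeta0 c1) (continuous_close zeta0 c2))
      (filterI (continuous_close zeta0 c3) (continuous_close zeta0 c4)))).
    by move=> y [[a1 a2] [a3 a4]]; split.
  apply: (filterS _ (filterI (filterI n1 n2) (filterI n3 n4))).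
  by move=> y [[a1 a2] [a3 a4]]; split.
(* For |z - p| < eps and |h| < 2 eps, the whole segment from z to z + h lies within 3 eps < e0 of
   p. *)
pose eps := Num.min (e0 / 4) eta.
have eps0 : 0 < eps by rewrite lt_min eta0 divr_gt0.
have epse : eps <= e0 / 4 by rewrite ge_min lexx.
have epseta : eps <= eta by rewrite ge_min lexx orbT.
have seg z h (s : R) : enorm (z - p) < eps -> enorm h < 2 * eps -> 0 <= s <= 1 ->
    enorm (z + real_scale s h - p) < e0.
  move=> hz hh /andP[s0 s1]; rewrite addrAC.
  apply: le_lt_trans (enormD _ _) _; rewrite enorm_real_scale ger0_norm//.
  have : s * enorm h <= enorm h by rewrite ler_piMl// enorm_ge0.
  by move=> hs; clear - hz hh epse hs e00; lra.
have seg0 z : enorm (z - p) < eps -> enorm (z - p) < e0.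
  by move=> hz; apply: lt_le_trans hz _; move: epse e00; clear; lra.
have dclose z h : enorm (z - p) < e0 ->
    `|linform (X z) (Y z) h - linform (X p) (Y p) h| <= eta * enorm h.
  move=> /he0[_ _ H _]; apply: le_trans (linform_close _ H) _.
  by apply: ler_wpM2r => //; exact: enorm_ge0.
have hclose z h : enorm (z - p) < e0 ->
    `|hess rho h z - hess rho h p| <= eta * enorm h ^+ 2.
  move=> /he0[_ _ _ H]; rewrite !hessE; apply: le_trans (quadform_close _ H) _.
  by apply: ler_wpM2r => //; exact: sqr_ge0.
have hbound h : `|hess rho h p| <= n%:R * n%:R * 4 * E * enorm h ^+ 2.
  by rewrite hessE; exact: quadform_bound.
have dbound h : `|linform (X p) (Y p) h| <= n%:R * 2 * E * enorm h.
  exact: linform_bound.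
exists rho, eps, (c / 2), (B + 1); split=> //; first by rewrite divr_gt0.
- by rewrite ltr_wpDl.
- move=> z /seg0/he0[Uz _ _ _]; split=> hz.
    have H : [set z | U z /\ rho z < 0] z by rewrite -OmU.
    exact: H.2.
  have H : (Om `&` U) z by rewrite OmU.
  exact: H.1.
split.
  move=> z w hz hw; have wz : enorm (w - z) < 2 * eps.
    apply: le_lt_trans (enorm_triangle p _ _) _; rewrite (enormB p).
    by move: hz hw; clear; lra.
  have sg s : 0 <= s <= 1 -> U (z + real_scale s (w - z)).
    by move=> hs; have [] := he0 _ (seg z (w - z) s hz wz hs).
  have [s s01] := mvt_line C1 sg.
  rewrite (addrC z (w - z)) subrK => ->; rewrite ddirE; last exact: sg.
  rewrite -(subrK (linform (X p) (Y p) (w - z)) (linform _ _ _)).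
  apply: le_trans (ler_normD _ _) _.
  have := dclose _ (w - z) (seg z (w - z) s hz wz s01).
  have := dbound (w - z).
  have := enorm_ge0 (w - z).
  set N := enorm (w - z) => N0 h1 h2; apply: le_trans (lerD h2 h1) _.
  rewrite -mulrDl; apply: ler_wpM2r => //.
  by rewrite /B; move: eta1 nn0; clear; lra.
move=> z hz Omz.
(* These are the Taylor coefficients of rho + M rho^2: its differential is (1 + 2 M rho) d rho with
   d rho = 2 Re w, and M (2 Re w)^2 = 2 M |w|^2 + 2 M Re w^2 contributes its last term to the
   quadratic part. *)
exists (fun j => cpx (2 * (1 + 2 * M * rho z)) 0 * wirtinger rho z j).
exists (fun j k => cpx ((XX p j k - YY p j k) / 4) (- (XY p j k + YX p j k) / 4) +
   cpx (2 * M) 0 * (wirtinger rho p j * wirtinger rho p k)).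
move=> h hh Omzh.
have [Uz rz _ _] := he0 _ (seg0 _ hz).
have h2 : enorm h < 2 * eps by apply: lt_trans hh _; rewrite ltr_pMl// ltr1n.
have sgz : enorm (z + h - p) < e0.
  have := seg z h 1 hz h2; rewrite real_scale1; apply.
  by rewrite ler01 lexx.
have [Uzh rzh _ _] := he0 _ sgz.
have sU s : 0 <= s <= 1 -> U (z + real_scale s h).
  by move=> hs; have [] := he0 _ (seg z h s hz h2 hs).
have rz0 : rho z < 0.
  have H : [set z | U z /\ rho z < 0] z by rewrite -OmU.
  exact: H.2.
have rzh0 : rho (z + h) < 0.
  have H : [set z | U z /\ rho z < 0] (z + h) by rewrite -OmU.
  exact: H.2.
have tl : rho z + ddir h rho z + (hess rho h p - eta * enorm h ^+ 2) / 2 <= rho (z + h).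
  apply: (taylor_lower oU C2 sU) => s hs.
  have := hclose _ h (seg z h s hz h2 hs); rewrite ler_norml => /andP[+ _].
  by rewrite lerBrDr (addrC (- _)).
have tb := @taylor_bound R n U rho z h (B * enorm h ^+ 2) oU C2 sU.
rewrite rp !subr0 in rz rzh.
set W := \sum_j wirtinger rho z j * h j 0.
have ReH : complex.Re
   (\sum_j cpx (2 * (1 + 2 * M * rho z)) 0 * wirtinger rho z j * h j 0 +
    \sum_j \sum_k (cpx ((XX p j k - YY p j k) / 4) (- (XY p j k + YX p j k) / 4) +
        cpx (2 * M) 0 * (wirtinger rho p j * wirtinger rho p k)) * h j 0 * h k 0) =
  (1 + 2 * M * rho z) * linform (X z) (Y z) h + complex.Re (Sp h) +
    2 * M * complex.Re (Wp h ^+ 2).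
  rewrite (_ : \sum_j cpx (2 * (1 + 2 * M * rho z)) 0 * wirtinger rho z j * h j 0 =
    cpx (2 * (1 + 2 * M * rho z)) 0 * W); last first.
    by rewrite mulr_sumr; apply: eq_bigr => j _; rewrite mulrA.
  rewrite (_ : \sum_j \sum_k _ = Sp h + cpx (2 * M) 0 * Wp h ^+ 2); last first.
    rewrite /Wp linear_sqr_quadratic mulr_sumr -big_split; apply: eq_bigr => j _ /=.
    rewrite mulr_sumr -big_split; apply: eq_bigr => k _ /=.
    move: (cpx (_ / 4) _) (cpx (2 * M) 0) (wirtinger rho p j) (wirtinger rho p k)
      (h j 0) (h k 0) => a b d e f g; ring.
  rewrite !cReD !(cReM (cpx _ _)) !Re_cpx !Im_cpx !mul0r !subr0 WE -/W.
  by move: (complex.Re W : R) (complex.Re (Sp h) : R) (complex.Re (Wp h ^+ 2) : R) => *; ring.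
rewrite ReH.
refine (@levi_peak_real R (rho z) (rho (z + h)) (linform (X z) (Y z) h)
  (linform (X p) (Y p) h) (enorm h ^+ 2) (enorm h) eta B M c (complex.Re (Sp h))
  (complex.Re (levi_form rho p h)) (cabs (Wp h) ^+ 2) (complex.Re (Wp h ^+ 2)) T
  M0 B0 _ etaM _ erefl _ _ _ _ _ _ (Mc h) _ erefl etaT).
- by rewrite eta1 ltW.
- rewrite enorm_ge0 /=; apply: (le_trans (ltW h2)).
  by rewrite ler_pM2l.
- by move: rz rz0; rewrite ler_norml => /andP[-> _] /ltW ->.
- by move: rzh rzh0; rewrite ler_norml => /andP[-> _] /ltW ->.
- have := tl; rewrite ddirE// hpE; apply: le_trans.
  have := sqr_ge0 (enorm h); move: (enorm h ^+ 2) => q q0.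
  have : 0 <= eta * q by rewrite mulr_ge0// ltW.
  by move: (eta * q) (complex.Re (Sp h) + _) (linform _ _ _) (rho z); clear => *; lra.
- rewrite -(ddirE h _ Uz); apply: tb => s hs.
  rewrite -(subrK (hess rho h p) (hess rho h _)).
  apply: le_trans (ler_normD _ _) _.
  apply: le_trans (lerD (hclose _ h (seg z h s hz h2 hs)) (hbound h)) _.
  rewrite -mulrDl; apply: ler_wpM2r; first exact: sqr_ge0.
  by rewrite /B; move: eta1 nn1; clear; lra.
- exact: dclose (seg0 _ hz).
- apply: le_trans (dbound h) _; apply: ler_wpM2r; first exact: enorm_ge0.
  by rewrite /B; move: nn0; clear; lra.
- rewrite WE -/(Wp h) cabs_sqr [Wp h ^+ 2]expr2 cReM.
  by move: (complex.Re (Wp h) : R) (complex.Im (Wp h) : R) => a b; ring.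
Qed.

End LeviPeakMain.

Section KobayashiAtStronglyPseudoconvex.
Variables (R : realType) (n : nat).
Local Notation C := (Cplx R).
Implicit Types (h z p w v : 'cV[C]_n) (Om : set 'cV[C]_n).

(** Boundedness of [Om] makes its discs uniformly Lipschitz near 0. A disc restricted to a small
    radius, chosen once for all, therefore stays where a local estimate is valid. *)
Lemma disc_displacement Om (phi : C -> 'cV[C]_n) (M : R) :
  (forall z, Om z -> enorm z <= M) -> holomorphic_disc Om phi ->
  forall x : C, cabs x <= 1 / 2 ->
    enorm (phi x - phi 0) <= n%:R * (8 * M) * cabs x.
Proof.
move=> hM /holomorphic_discP hphi x x2; rewrite -mulrA; apply: enorm_le_coord => i.
have d (y : C) : cabs y < 1 -> derivable (fun y => phi y i 0) y 1.
  by move=> /hphi[dy _]; have [] := is_derive_component i dy.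
have b (y : C) : cabs y < 1 -> cabs (phi y i 0) <= M.
  by move=> /hphi[_ Oy]; exact: le_trans (cabs_le_enorm _ _) (hM _ Oy).
by have := disc_lipschitz d b x2; rewrite !mxE.
Qed.

Lemma derivable_fin_sum (I : finType) (F : I -> C -> C) (x : C) :
  (forall i, derivable (F i) x 1) -> derivable (fun y => \sum_i F i y) x 1.
Proof.
move=> dF; have : forall r : seq I, derivable (fun y => \sum_(i <- r) F i y) x 1.
  elim=> [|i r IH].
    rewrite (_ : (fun y => _) = fun=> 0); first exact: derivable_cst.
    by apply/funext => y; rewrite big_nil.
  rewrite (_ : (fun y => _) = F i + (fun y => \sum_(j <- r) F j y)).
    exact: derivableD (dF i) IH.
  by apply/funext => y; rewrite big_cons.
exact.
Qed.

Lemma is_derive_fin_sum (I : finType) (F : I -> C -> C) (F' : I -> C) (x : C) :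
  (forall i, is_derive x 1 (F i) (F' i)) ->
  is_derive x 1 (fun y => \sum_i F i y) (\sum_i F' i).
Proof.
move=> dF; have : forall r : seq I,
   is_derive x 1 (fun y => \sum_(i <- r) F i y) (\sum_(i <- r) F' i).
  elim=> [|i r IH].
    rewrite (_ : (fun y => _) = fun=> 0); last by apply/funext => y; rewrite big_nil.
    by rewrite big_nil; exact: is_derive_cst.
  rewrite big_cons (_ : (fun y => _) = F i + (fun y => \sum_(j <- r) F j y)).
    exact: is_deriveD (dF i) IH.
  by apply/funext => y; rewrite big_cons.
exact.
Qed.

Lemma derivable_mul (f g : C -> C) (x : C) :
  derivable f x 1 -> derivable g x 1 -> derivable (fun y => f y * g y) x 1.
Proof. by move=> df dg; exact: (derivableM df dg). Qed.

Lemma derivable_add (f g : C -> C) (x : C) :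
  derivable f x 1 -> derivable g x 1 -> derivable (fun y => f y + g y) x 1.
Proof. by move=> df dg; exact: (derivableD df dg). Qed.

(** In place of the mean value inequality for |h|^2, the function x Hol(x) + s Lin(x), with s = 2 c
    r^2 and Lin = sum of L_j^* h_j, is put into [quotient_principle]; its derivative at 0 is 2 c r^2
    |L|^2. On |x| = r the hypothesis gives Re Hol <= - m - c |h|^2, and 2 r^2 Re (Lin / x) <= r^2
    |L|^2 + |h|^2, so the terms with |h|^2 cancel. *)
Lemma disc_derivative_levi (phi : C -> 'cV[C]_n) (A : 'I_n -> C)
    (B : 'I_n -> 'I_n -> C) (m c r : R) :
  0 < r < 1 -> 0 <= c ->
  (forall x : C, cabs x < 1 -> derivable phi x 1) ->
  (forall x : C, cabs x = r -> let h := phi x - phi 0 in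
    m + complex.Re (\sum_j A j * h j 0 + \sum_j \sum_k B j k * h j 0 * h k 0) +
      c * enorm h ^+ 2 <= 0) ->
  c * r ^+ 2 * enorm (derive1 phi 0) ^+ 2 <= - m.
Proof.
move=> r01 c0 dphi H; case/andP: (r01) => r0 r1.
set L := derive1 phi 0.
pose F i x := phi x i 0 - phi 0 i 0.
pose Hol x := \sum_j A j * F j x + \sum_j \sum_k B j k * F j x * F k x.
pose Lin x := \sum_j (L j 0)^* * F j x.
pose s : C := cpx (2 * c * r ^+ 2) 0.
pose f x := x * Hol x + s * Lin x.
have F0 i : F i 0 = 0 by rewrite /F subrr.
have Hol0 : Hol 0 = 0.
  rewrite /Hol big1 ?add0r => [|j _]; last by rewrite F0 mulr0.
  by rewrite big1// => j _; rewrite big1// => k _; rewrite F0 mulr0 mul0r.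
have Lin0 : Lin 0 = 0 by rewrite /Lin big1// => j _; rewrite F0 mulr0.
have f0 : f 0 = 0 by rewrite /f Hol0 Lin0 !mulr0 addr0.
have dF i x : cabs x < 1 -> is_derive x 1 (F i) (derive1 phi x i 0).
  move=> x1; have d := is_derive_component i (dphi x x1).
  have := is_deriveB d (is_derive_cst (phi 0 i 0) x 1).
  by rewrite subr0.
have dF' i x : cabs x < 1 -> derivable (F i) x 1 by move=> /(dF i)[].
have dHol x : cabs x < 1 -> derivable Hol x 1.
  move=> x1; apply: derivable_add; apply: derivable_fin_sum => j.
    by apply: derivable_cmul; exact: dF'.
  apply: derivable_fin_sum => k; apply: derivable_mul; last exact: dF'.
  by apply: derivable_cmul; exact: dF'.
have dLin x : cabs x < 1 -> is_derive x 1 Lin (\sum_j (L j 0)^* * derive1 phi x j 0).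
  move=> x1; apply: is_derive_fin_sum => j.
  exact: (@is_deriveZ _ _ _ (F j) ((L j 0)^*) x 1 _ (dF j x x1)).
have df x : cabs (x - 0) < 1 -> derivable f x 1.
  rewrite subr0 => x1; apply: derivable_add.
    by apply: derivable_mul; [exact: derivable_id|exact: dHol].
  by apply: derivable_cmul; have [] := dLin x x1.
have c01 : cabs (0 : C) < 1 by rewrite cabs0.
have df0 : is_derive (0 : C) 1 f (cpx (2 * c * r ^+ 2 * enorm L ^+ 2) 0).
  have d1 := is_deriveM (is_derive_id (0 : C) 1) (derivableP (dHol 0 c01)).
  have d2 := @is_deriveZ _ _ _ Lin s 0 1 _ (dLin 0 c01).
  have d3 : is_derive (0 : C) 1 f _ := is_deriveD d1 d2.
  apply: (is_derive_eq d3); clear d1 d2 d3.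
  rewrite Hol0 /GRing.scale /= mul0r add0r mul0r add0r.
  rewrite enorm_sqr (_ : cpx _ 0 = s * cpx (\sum_i cabs (L i 0) ^+ 2) 0); last first.
    by apply: complex_ext; rewrite ?cReM ?cImM /= !(mulr0, mul0r, subr0, addr0).
  congr (s * _).
  have -> : cpx (\sum_i cabs (L i 0) ^+ 2) 0 = \sum_i cpx (cabs (L i 0) ^+ 2) 0 :> C.
    by apply: (@rmorph_sum _ _ (real_complex R)).
  apply: eq_bigr => j _; rewrite mulrC -normCK normc_cabs.
  by rewrite -[cpx _ 0]/((real_complex R) _) rmorphXn.
have hq : forall x, cabs x = r -> complex.Re ((1 / x + 0 * x + 0) * (f (0 + x) - f 0)) <=
    - m + c * r ^+ 2 * enorm L ^+ 2.
  move=> x xr; have x0 : x != 0 by rewrite -cabs_gt0 xr.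
  rewrite add0r f0 subr0 mul0r !addr0.
  have -> : 1 / x * f x = Hol x + s * (Lin x / x) by rewrite /f; field.
  rewrite cReD; have := H x xr; set h := phi x - phi 0 => /=.
  have hF i : h i 0 = F i x by rewrite /h !mxE.
  have -> : \sum_j A j * h j 0 + \sum_j \sum_k B j k * h j 0 * h k 0 = Hol x.
    rewrite /Hol; congr (_ + _); apply: eq_bigr => j _; first by rewrite hF.
    by apply: eq_bigr => k _; rewrite !hF.
  have : complex.Re (s * (Lin x / x)) <= c * (r ^+ 2 * enorm L ^+ 2 + enorm h ^+ 2).
    have key j : 2 * r ^+ 2 * complex.Re ((L j 0)^* * F j x / x) <=
        r ^+ 2 * cabs (L j 0) ^+ 2 + cabs (F j x) ^+ 2.
      have : complex.Re ((L j 0)^* * F j x / x) <= cabs (L j 0) * cabs (F j x) / r.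
        apply: le_trans (ler_norm _) _; apply: le_trans (Re_le_cabs _) _.
        by rewrite !cabsM cabs_conj cabsV xr.
      set a := cabs (L j 0); set b := cabs (F j x) => hh.
      have r20 : 0 <= 2 * r ^+ 2 by rewrite mulr_ge0// sqr_ge0.
      apply: le_trans (ler_wpM2l r20 hh) _.
      rewrite (_ : 2 * r ^+ 2 * (a * b / r) = 2 * (r * a) * b); last first.
        by field; rewrite gt_eqF.
      have := sqr_ge0 (r * a - b); rewrite -subr_ge0.
      by rewrite (_ : (r * a - b) ^+ 2 = r ^+ 2 * a ^+ 2 + b ^+ 2 - 2 * (r * a) * b)//; ring.
    have -> : complex.Re (s * (Lin x / x)) =
        c * \sum_j 2 * r ^+ 2 * complex.Re ((L j 0)^* * F j x / x).
      rewrite cReM Re_cpx Im_cpx mul0r subr0 /Lin mulr_suml cRe_sum -mulr_sumr.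
      by move: (\sum_j _) => u; ring.
    have -> : r ^+ 2 * enorm L ^+ 2 + enorm h ^+ 2 =
        \sum_j (r ^+ 2 * cabs (L j 0) ^+ 2 + cabs (F j x) ^+ 2).
      rewrite big_split /= -mulr_sumr !enorm_sqr; congr (_ + _).
      by apply: eq_bigr => j _; rewrite hF.
    by apply: ler_wpM2l => //; apply: ler_sum => j _; exact: key.
  move: (complex.Re (Hol x) : R) (complex.Re (s * _) : R) => a b.
  rewrite mulrDr mulrA; move: (c * r ^+ 2 * enorm L ^+ 2) (c * enorm h ^+ 2).
  by clear => u v; lra.
have := @quotient_principle R f 0 1 0 0 _ r 1 _ r01 df df0 hq.
rewrite mul1r Re_cpx (_ : 2 * c * r ^+ 2 * enorm L ^+ 2 =
  2 * (c * r ^+ 2 * enorm L ^+ 2)); last by ring.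
by move: (c * r ^+ 2 * enorm L ^+ 2); clear => u; lra.
Qed.

Lemma kobm_strongly_pseudoconvex Om p : bounded_domain Om -> bdry Om p ->
  strongly_levi_pseudoconvex_at Om p ->
  exists eps K : R, [/\ 0 < eps, 0 < K & forall z v, enorm (z - p) < eps -> Om z ->
    enorm v <= K * Num.sqrt (delta Om z) * kobm Om z v].
Proof.
move=> [oOm _ [z0 Oz0] [M hM]] bp sp.
have nOp : ~ Om p by case/(bdryP _ oOm): bp.
have M0 : 0 <= M by apply: le_trans (hM _ Oz0); exact: enorm_ge0.
have [rho [eps [c [K [eps0 c0 K0 Om_rho [lip peak]]]]]] := levi_peak oOm bp sp.
pose N := n%:R * (8 * M) + 1.
have N0 : 0 < N by rewrite ltr_wpDl// !mulr_ge0.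
(* On |x| = r the displacement h of any disc of [Om] is at most N r <= eps / 2, as the Levi
   polynomial requires. *)
pose r := Num.min (1 / 2) (eps / 2 / N).
have r0 : 0 < r by rewrite lt_min !divr_gt0.
have r2 : r <= 1 / 2 by rewrite ge_min lexx.
have r1 : r < 1 by apply: le_lt_trans r2 _; clear; lra.
have rN : N * r <= eps / 2 by rewrite mulrC -ler_pdivlMr// ge_min lexx orbT.
have cr : 0 < c * r ^+ 2 by rewrite mulr_gt0// exprn_gt0.
exists (eps / 2), (Num.sqrt (K / (c * r ^+ 2))); split.
- by rewrite divr_gt0.
- by rewrite sqrtr_gt0 divr_gt0.
move=> z v hz Oz.
have hz' : enorm (z - p) < eps by apply: lt_trans hz _; move: eps0; clear; lra.
have dz : 0 < delta Om z by exact: delta_gt0 nOp.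
(* An exterior point w near p has rho w >= 0, and the Lipschitz bound applies. A farther w is
   replaced by p, which is also exterior and no farther from z than w. *)
have rhod : - rho z <= K * delta Om z.
  rewrite mulrC -ler_pdivrMr//; apply: (@delta_ge _ _ _ _ p) => // w nOw.
  rewrite ler_pdivrMr// mulrC.
  have key u : ~ Om u -> enorm (u - p) < eps -> - rho z <= K * enorm (z - u).
    move=> nOu hu; have ru : 0 <= rho u.
      by rewrite leNgt; apply/negP => /(Om_rho _ hu).
    rewrite enormB; apply: le_trans (lip z u hz' hu).
    by apply: le_trans (ler_norm _); rewrite lerBrDr addNr.
  have [wp|wp] := ltP (enorm (w - p)) eps; first exact: key.
  have pp : enorm (p - p) < eps by rewrite subrr enorm0.
  apply: le_trans (key p nOp pp) _; rewrite ler_pM2l//.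
  have := enorm_triangle z w p; rewrite (enormB w z).
  by move: wp hz; clear; lra.
have Kcr : 0 < K / (c * r ^+ 2) by rewrite divr_gt0.
rewrite -sqrtrM; last exact: ltW.
refine (@kobm_ge R n Om z (@enorm R n) (Num.sqrt (K / (c * r ^+ 2) * delta Om z)) v oOm Oz _ _ _).
- by rewrite sqrtr_gt0 mulr_gt0// divr_gt0.
- exact: enormZ.
move=> phi hphi phi0.
have hphi' := (holomorphic_discP _ _).1 hphi.
have [A [B AB]] := peak z hz' Oz.
have dd : c * r ^+ 2 * enorm (derive1 phi 0) ^+ 2 <= - rho z.
  have r01 : 0 < r < 1 by rewrite r0.
  refine (@disc_derivative_levi phi A B (rho z) c r r01 (ltW c0)
    (fun x hx => (hphi' x hx).1) _).
  move=> x xr /=; apply: AB.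
    have xr2 : cabs x <= 1 / 2 by rewrite xr.
    apply: le_lt_trans (disc_displacement hM hphi xr2) _; rewrite xr.
    apply: (@le_lt_trans _ _ (N * r)).
      by apply: ler_wpM2r; [exact: ltW|rewrite lerDl].
    by apply: le_lt_trans rN _; move: eps0; clear; lra.
  rewrite phi0 addrC subrK.
  by have [] := hphi' x; rewrite ?xr.
rewrite -(ger0_norm (enorm_ge0 (derive1 phi 0))) -sqrtr_sqr ler_sqrt; last first.
  by rewrite mulr_ge0 ?divr_ge0// ltW.
rewrite mulrAC ler_pdivlMr// mulrC; exact: le_trans dd rhod.
Qed.

End KobayashiAtStronglyPseudoconvex.

(** * Upper bound for the Kobayashi distance *)

Section SmoothStep.
Variable R : realType.
Implicit Types (s t : R).

Definition clamp01 t : R := Num.max 0 (Num.min t 1).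
(** Clamping the cubic 3 t^2 - 2 t^3 leaves a C^1 function, since its derivative vanishes at 0 and
    1. Segments parametrised by it start and end at rest, as [reach] demands. *)
Definition smoothstep t : R := clamp01 t ^+ 2 * (3 - 2 * clamp01 t).
Definition smoothstep' t : R := 6 * (clamp01 t * (1 - clamp01 t)).

Lemma clamp01_itv t : 0 <= clamp01 t <= 1.
Proof. by rewrite /clamp01 le_max lexx ge_max ler01 ge_min lexx orbT. Qed.

Lemma clamp01_le0 t : t <= 0 -> clamp01 t = 0.
Proof.
by move=> t0; rewrite /clamp01 (min_l (le_trans t0 ler01)) max_l.
Qed.

Lemma clamp01_ge1 t : 1 <= t -> clamp01 t = 1.
Proof. by move=> t1; rewrite /clamp01 min_r// max_r. Qed.

Lemma clamp01_id t : 0 <= t <= 1 -> clamp01 t = t.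
Proof. by move=> /andP[t0 t1]; rewrite /clamp01 min_l// max_r. Qed.

Lemma clamp01_lip s t : `|clamp01 s - clamp01 t| <= `|s - t|.
Proof.
wlog st : s t / s <= t.
  by move=> H; case/orP: (le_total s t) => /H//; rewrite distrC (distrC s).
rewrite distrC (distrC s) !ger0_norm ?subr_ge0//; last first.
  by rewrite /clamp01 ge_max le_max lexx /= le_max; case: (leP s 1) => s1;
    case: (leP t 1) => t1 //; rewrite ?st ?ler01 ?orbT//; lra.
have [s0|s0] := leP s 0; first have [t0|t0] := leP t 0.
- by rewrite !clamp01_le0// subrr subr_ge0.
- rewrite (clamp01_le0 s0) subr0; have [t1|/ltW t1] := leP t 1.
    by rewrite clamp01_id ?(ltW t0)//; lra.
  by rewrite clamp01_ge1//; lra.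
have [t1|/ltW t1] := leP t 1.
  by rewrite !clamp01_id//; apply/andP; split; lra.
rewrite (clamp01_ge1 t1); have [s1|/ltW s1] := leP s 1.
  by rewrite clamp01_id ?(ltW s0)//; lra.
by rewrite clamp01_ge1//; lra.
Qed.

Lemma smoothstep_derive t : is_derive t 1 smoothstep (smoothstep' t).
Proof.
apply: eps_is_derive => e e0; exists (e / 9); first by rewrite divr_gt0.
move=> s st; set a := clamp01 s; set b := clamp01 t.
have ab : `|a - b| <= `|s - t| by exact: clamp01_lip.
have /andP[a0 a1] : 0 <= a <= 1 := clamp01_itv s.
have /andP[b0 b1] : 0 <= b <= 1 := clamp01_itv t.
have bound1 : `|(a - b) ^+ 2 * (3 - 2 * a - 4 * b)| <= 3 * `|s - t| ^+ 2.
  rewrite normrM normrX mulrC; apply: ler_pM => //.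
    by rewrite ler_norml; lra.
  by rewrite ler_pXn2r// nnegrE.
have bound2 : `|6 * (b * (1 - b)) * ((a - b) - (s - t))| <= 6 * `|s - t| ^+ 2.
  have [t0|t0] := leP t 0.
    by rewrite /b clamp01_le0// mul0r mulr0 mul0r normr0 mulr_ge0// exprn_ge0.
  have [t1|/ltW t1] := leP t 1; last first.
    by rewrite /b clamp01_ge1// subrr mulr0 mulr0 mul0r normr0 mulr_ge0// exprn_ge0.
  have bt : b = t by rewrite /b clamp01_id// (ltW t0).
  have [s0|s0] := leP s 0.
    rewrite /a clamp01_le0// bt real_normK ?num_real//.
    have -> : 0 - t - (s - t) = - s by ring.
    have -> : 6 * (t * (1 - t)) * - s = 6 * (t * (1 - t) * - s) by ring.
    rewrite ger0_norm; last by rewrite !mulr_ge0//; lra.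
    rewrite ler_pM2l//.
    have ts : 0 <= t * - s by rewrite mulr_ge0 ?oppr_ge0// ltW.
    apply: (@le_trans _ _ (t * - s)).
      by rewrite mulrAC ler_piMr//; lra.
    rewrite -subr_ge0 (_ : _ - _ = s ^+ 2 + t * - s + t ^+ 2); last by ring.
    by rewrite !addr_ge0// sqr_ge0.
  have [s1|/ltW s1] := leP s 1.
    rewrite /a clamp01_id ?(ltW s0)// bt subrr mulr0 normr0.
    by rewrite mulr_ge0// exprn_ge0.
  rewrite /a clamp01_ge1// bt real_normK ?num_real//.
  have -> : 1 - t - (s - t) = - (s - 1) by ring.
  have -> : 6 * (t * (1 - t)) * - (s - 1) = - (6 * (t * (1 - t) * (s - 1))) by ring.
  rewrite normrN ger0_norm; last by rewrite !mulr_ge0//; lra.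
  rewrite ler_pM2l//.
  have h1 : t * (1 - t) * (s - 1) <= (1 - t) * (s - 1).
    by rewrite -mulrA ler_piMl// mulr_ge0//; lra.
  apply: le_trans h1 _; rewrite expr2.
  by apply: ler_pM; lra.
have -> : smoothstep s - smoothstep t - smoothstep' t * (s - t) =
  (a - b) ^+ 2 * (3 - 2 * a - 4 * b) + 6 * (b * (1 - b)) * ((a - b) - (s - t)).
  by rewrite /smoothstep /smoothstep' -/a -/b; ring.
apply: le_trans (ler_normD _ _) _; apply: le_trans (lerD bound1 bound2) _.
rewrite -mulrDl expr2 mulrA; apply: ler_wpM2r => //.
by move: st; rewrite ltr_pdivlMr//; move: (`|_|); clear => u; lra.
Qed.

Lemma continuous_smoothstep' : continuous smoothstep'.
Proof.
have cc : continuous clamp01.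
  move=> t; apply/cvgrPdist_le => e e0; apply/nbhs_ballP; exists e => //= s.
  by rewrite /ball /= => /ltW; apply: le_trans; exact: clamp01_lip.
move=> t; apply: cvgM; first exact: cvg_cst.
apply: cvgM; first exact: cc.
by apply: cvgB; [exact: cvg_cst|exact: cc].
Qed.

Lemma smoothstep'_itv t : 0 <= smoothstep' t <= 2.
Proof.
have /andP[a0 a1] := clamp01_itv t; rewrite /smoothstep'.
rewrite !mulr_ge0 ?subr_ge0//=.
have := sqr_ge0 (2 * clamp01 t - 1).
have -> : (2 * clamp01 t - 1) ^+ 2 = 1 - 4 * (clamp01 t * (1 - clamp01 t)) by ring.
by move: (clamp01 t * _); clear => u; lra.
Qed.

Lemma smoothstep_itv t : 0 <= smoothstep t <= 1.
Proof.
have /andP[a0 a1] := clamp01_itv t; rewrite /smoothstep.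
rewrite mulr_ge0 ?sqr_ge0//=; last by lra.
have -> : clamp01 t ^+ 2 * (3 - 2 * clamp01 t) =
  1 - (1 - clamp01 t) ^+ 2 * (1 + 2 * clamp01 t) by ring.
by rewrite lerBlDr lerDl mulr_ge0 ?sqr_ge0//; lra.
Qed.

Lemma smoothstep_le0 t : t <= 0 -> smoothstep t = 0.
Proof. by move=> t0; rewrite /smoothstep clamp01_le0// expr0n mul0r. Qed.

Lemma smoothstep_ge1 t : 1 <= t -> smoothstep t = 1.
Proof. by move=> t1; rewrite /smoothstep clamp01_ge1//; ring. Qed.

End SmoothStep.

(** * Paths of bounded Kobayashi speed *)

Section Paths.
Variables (R : realType) (n : nat).
Local Notation C := (Cplx R).
Local Notation mu := (@lebesgue_measure R).
Implicit Types (z w u v : 'cV[C]_n) (Om : set 'cV[C]_n).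

(** The integral of a nonnegative function is a supremum over simple minorants, so it is monotone
    without measurability; this is what makes [kobd] accessible. *)
Lemma ge0_le_lower_integral (D : set R) (f g : R -> \bar R) :
  (forall x, D x -> (0 <= f x)%E) -> (forall x, D x -> (f x <= g x)%E) ->
  (\int[mu]_(x in D) f x <= \int[mu]_(x in D) g x)%E.
Proof.
move=> f0 fg; have g0 x : D x -> (0 <= g x)%E.
  by move=> Dx; exact: le_trans (f0 x Dx) (fg x Dx).
rewrite !ge0_integralE//; apply: le_ereal_sup => _ [h hf <-]; exists h => //.
by move=> x; apply: le_trans (hf x) _; exact: lee_restrict.
Qed.

Lemma is_velocity_lim (g : R -> 'cV[C]_n) (t : R) v : is_velocity g t v -> velocity g t = v.
Proof. by move=> h; apply: cvg_lim h. Qed.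

Lemma is_velocity_continuous (g : R -> 'cV[C]_n) (t : R) v :
  is_velocity g t v -> {for t, continuous g}.
Proof.
move=> /is_velocity_eps/(_ 1 ltr01)[d d0 hd] B /nbhs_enorm[e e0 hB].
have N0 : 0 < enorm v + 1 by rewrite ltr_wpDl// enorm_ge0.
apply/nbhs_ballP; exists (Num.min d (e / (enorm v + 1))) => /=.
  by rewrite lt_min d0 divr_gt0.
move=> s; rewrite /ball /= distrC lt_min => /andP[sd se]; apply: hB.
rewrite -(subrK (real_scale (s - t) v) (g s - g t)).
apply: le_lt_trans (enormD _ _) _; rewrite enorm_real_scale.
apply: (@le_lt_trans _ _ (`|s - t| * (enorm v + 1))).
  by rewrite mulrDr mulr1 addrC lerD2l; have := hd s sd; rewrite mul1r.
by rewrite -ltr_pdivlMr.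
Qed.

(* The path is C^1 on the whole line and constant outside [0, 1], so that two such
   paths can be concatenated without a corner. *)
Definition reach Om z w (B : R) : Prop := exists gam g : R -> 'cV[C]_n,
  [/\ continuous g, forall t, is_velocity gam t (g t),
      (forall t, t <= 0 -> gam t = z) /\ (forall t, 1 <= t -> gam t = w) &
      forall t, Om (gam t) /\ kobm Om (gam t) (g t) <= B].

Lemma reach_ge0 Om z w B : reach Om z w B -> 0 <= B.
Proof.
by move=> [gam [g [_ _ _ /(_ 0)[_ h]]]]; apply: le_trans h; exact: kobm_ge0.
Qed.

Lemma reach_kobd Om z w B : reach Om z w B -> (kobd Om z w <= B%:E)%E.
Proof.
move=> rzw; have B0 := reach_ge0 rzw.
move: rzw => [gam [g [cg vg [g0 g1] hg]]].
have cgam : continuous gam by move=> t; exact: is_velocity_continuous (vg t).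
have pgam : path_in Om z w gam.
  split.
  - split; first exact: continuous_subspaceT.
    exists 1%N, (fun i => i%:R); split=> // i.
    rewrite ltnS leqn0 => /eqP ->; split; first exact: ltr01.
    exists g; first exact: (continuous_subspaceT cg).
    by move=> t _; exact: (vg t).
  - by move=> t _; have [] := hg t.
  - exact: g0.
  - exact: g1.
apply: (@le_trans _ _ (\int[mu]_(t in `[0%R, 1%R]) (kobm Om (gam t) (velocity gam t))%:E)%E).
  by apply: ereal_inf_lbound; exists gam.
apply: (@le_trans _ _ (\int[mu]_(t in `[0%R, 1%R]) B%:E)%E).
  apply: ge0_le_lower_integral => t _; first by rewrite lee_fin kobm_ge0.
  by rewrite lee_fin (is_velocity_lim (vg t)); have [] := hg t.
rewrite integral_cst//= lebesgue_measure_itv /= lte_fin ltr01 oppr0 adde0.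
by rewrite mule1.
Qed.

Lemma reach_sym Om z w B : reach Om z w B -> reach Om w z B.
Proof.
move=> [gam [g [cg vg [g0 g1] hg]]].
exists (fun t => gam (1 - t)), (fun t => - g (1 - t)); split.
- move=> t; apply: cvgN; apply: (@continuous_comp _ _ _ (fun t : R => 1 - t) g).
    by apply: cvgB; [exact: cvg_cst|exact: cvg_id].
  exact: cg.
- move=> t; apply/is_velocity_eps => e e0.
  have [d d0 hd] := (is_velocity_eps _ _ _).1 (vg (1 - t)) e e0.
  exists d => // s st.
  have E : (1 - s) - (1 - t) = - (s - t) by ring.
  have := hd (1 - s); rewrite E normrN => /(_ st).
  by rewrite /real_scale rmorphN /= scaleNr scalerN.
- by split=> t ht; [apply: g1|apply: g0]; lra.
- move=> t; have [h1 h2] := hg (1 - t); split=> //.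
  apply: le_trans h2.
  rewrite /kobm; set S1 := (X in inf X); set S2 := (X in _ <= inf X).
  suff -> : S1 = S2 by [].
  rewrite /S1 /S2; apply/seteqP; split=> _ [xi [phi [p1 p2 p3]] <-].
    by exists (- xi); [exists phi; split=> //; rewrite scaleNr p3 opprK|rewrite cabsN].
  by exists (- xi); [exists phi; split=> //; rewrite scaleNr p3|rewrite cabsN].
Qed.

Lemma velocity_of_const (gam : R -> 'cV[C]_n) (t : R) v x (sg : R) : sg ^+ 2 = 1 ->
  (forall s, 0 <= s -> gam (t + sg * s) = x) -> is_velocity gam t v -> v = 0.
Proof.
move=> sg2 cst /is_velocity_eps hv; apply/eqP; rewrite -enorm_eq0 eq_le enorm_ge0 andbT.
apply/ler_addgt0Pr => e e0; rewrite add0r.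
have [d d0 hd] := hv e e0.
have sg1 : `|sg| = 1 by apply/eqP; rewrite -sqrp_eq1// real_normK ?num_real// sg2.
have d2 : 0 < d / 2 by rewrite divr_gt0.
have := hd (t + sg * (d / 2)); rewrite addrAC subrr add0r normrM sg1 mul1r gtr0_norm//.
rewrite ltr_pdivrMr// ltr_pMr// ltr1n => /(_ isT).
have -> : gam t = x by have := cst 0 (lexx _); rewrite mulr0 addr0.
rewrite cst ?(ltW d2)// subrr sub0r enormN enorm_real_scale normrM sg1 mul1r gtr0_norm//.
by rewrite mulrC ler_pM2r.
Qed.

Lemma is_velocity_affine (gam : R -> 'cV[C]_n) (t : R) v (a b : R) :
  is_velocity gam (a * t + b) v -> is_velocity (fun t => gam (a * t + b)) t (real_scale a v).
Proof.
move=> /is_velocity_eps hv; apply/is_velocity_eps => e e0.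
have a1 : 0 < `|a| + 1 by rewrite ltr_wpDl.
have [d d0 hd] := hv (e / (`|a| + 1)) (divr_gt0 e0 a1).
exists (d / (`|a| + 1)); first by rewrite divr_gt0.
move=> s st.
have E : a * s + b - (a * t + b) = a * (s - t) by ring.
have := hd (a * s + b); rewrite E normrM => hd'.
have {hd'}/hd' : `|a| * `|s - t| < d.
  move: st; rewrite ltr_pdivlMr// => /(le_lt_trans _); apply.
  by rewrite mulrC ler_wpM2l// lerDl.
rewrite real_scaleA (mulrC (s - t)) => /le_trans; apply.
rewrite mulrA; apply: ler_wpM2r => //.
by rewrite mulrAC ler_pdivrMr// ler_pM2l// lerDl.
Qed.

Lemma is_velocityD (g1 g2 : R -> 'cV[C]_n) (t : R) v1 v2 x :
  is_velocity g1 t v1 -> is_velocity g2 t v2 ->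
  is_velocity (fun t => g1 t + g2 t - x) t (v1 + v2).
Proof.
move=> /is_velocity_eps h1 /is_velocity_eps h2; apply/is_velocity_eps => e e0.
have e2 : 0 < e / 2 by rewrite divr_gt0.
have [d1 d10 hd1] := h1 _ e2; have [d2 d20 hd2] := h2 _ e2.
exists (Num.min d1 d2); first by rewrite lt_min d10.
move=> s; rewrite lt_min => /andP[s1 s2].
have -> : g1 s + g2 s - x - (g1 t + g2 t - x) - real_scale (s - t) (v1 + v2) =
  (g1 s - g1 t - real_scale (s - t) v1) + (g2 s - g2 t - real_scale (s - t) v2).
  rewrite /real_scale scalerDr; apply/matrixP => i j; rewrite !mxE; ring.
apply: le_trans (enormD _ _) _; rewrite (splitr e) mulrDl.
by rewrite lerD// ?hd1 ?hd2.
Qed.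

Lemma kobmZ Om z v (a : R) (r : R) : 0 < r -> (forall w, enorm (w - z) < r -> Om w) ->
  kobm Om z (real_scale a v) <= `|a| * kobm Om z v.
Proof.
move=> r0 hr; have [->|a0] := eqVneq a 0.
  rewrite normr0 mul0r; apply: le_trans (kobm_le _ r0 hr) _.
  by rewrite real_scale0 enorm0 mul0r.
have na : 0 < `|a| by rewrite normr_gt0.
rewrite mulrC -ler_pdivrMr//; apply: lb_le_inf.
  have [phi [h1 h2 h3]] := affine_disc v r0 hr.
  by exists (cabs (cpx (enorm v / r) 0)), (cpx (enorm v / r) 0) => //; exists phi.
move=> _ [xi [phi [h1 h2 h3]] <-]; rewrite ler_pdivrMr//.
apply: ge_inf; first by exists 0 => _ [x _ <-]; exact: cabs_ge0.
exists (cpx a 0 * xi); last by rewrite cabsM cabs_real mulrC.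
by exists phi; split=> //; rewrite -h3 /real_scale scalerA.
Qed.

(** Both paths run at double speed and are glued by adding them and subtracting y: on each half of
    the interval one of them rests at y. The factor 2 is the price of bounding speed instead of
    length. *)
Lemma reach_trans Om z y w B1 B2 : open Om ->
  reach Om z y B1 -> reach Om y w B2 -> reach Om z w (2 * (B1 + B2)).
Proof.
move=> oOm r1 r2; have B10 := reach_ge0 r1; have B20 := reach_ge0 r2.
move: r1 r2 => [c1 [g1 [cg1 v1 [c10 c11] h1]]] [c2 [g2 [cg2 v2 [c20 c21] h2]]].
have g1z t : 1 <= t -> g1 t = 0.
  move=> t1; apply: (@velocity_of_const c1 t _ y 1 _ _ (v1 t)); first by rewrite expr1n.
  by move=> s s0; apply: c11; rewrite mul1r; lra.
have g2z t : t <= 0 -> g2 t = 0.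
  move=> t1; apply: (@velocity_of_const c2 t _ y (-1) _ _ (v2 t)); first by rewrite sqrrN expr1n.
  by move=> s s0; apply: c20; rewrite mulN1r; lra.
exists (fun t => c1 (2 * t + 0) + c2 (2 * t + - 1) - y),
  (fun t => real_scale 2 (g1 (2 * t + 0)) + real_scale 2 (g2 (2 * t + - 1))).
have caff (b : R) : continuous (fun t : R => 2 * t + b).
  move=> t; apply: cvgD; last exact: cvg_cst.
  by apply: cvgM; [exact: cvg_cst|exact: cvg_id].
split.
- move=> t; apply: cvgD; apply: cvgZr.
    by apply: (@continuous_comp _ _ _ (fun t : R => 2 * t + 0) g1); [exact: caff|exact: cg1].
  by apply: (@continuous_comp _ _ _ (fun t : R => 2 * t + - 1) g2); [exact: caff|exact: cg2].
- by move=> t; apply: is_velocityD; apply: is_velocity_affine.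
- split=> t ht.
    by rewrite c10 ?c20 ?addrK//; lra.
  by rewrite c11 ?c21 1?addrC ?addKr ?addrK//; lra.
move=> t; have [t2|/ltW t2] := leP t (1 / 2).
  rewrite (c20 (2 * t + -1)) ?addrK ?(g2z (2 * t + -1)); try lra.
  have [hO1 k1] := h1 (2 * t + 0); split=> //.
  have [r r0 hr] := open_enorm oOm hO1.
  have -> : real_scale 2 (0 : 'cV[C]_n) = 0 by exact: scaler0.
  rewrite [real_scale 2 _ + 0]addr0; apply: le_trans (kobmZ _ _ r0 hr) _.
  by rewrite ger0_norm// ler_pM2l//; lra.
rewrite (c11 (2 * t + 0)) ?(g1z (2 * t + 0)); try lra.
rewrite (addrC y) addrK.
have [hO1 k1] := h2 (2 * t + -1); split=> //.
have [r r0 hr] := open_enorm oOm hO1.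
have -> : real_scale 2 (0 : 'cV[C]_n) = 0 by exact: scaler0.
rewrite [0 + real_scale 2 _]add0r; apply: le_trans (kobmZ _ _ r0 hr) _.
by rewrite ger0_norm// ler_pM2l//; lra.
Qed.

Lemma reach_line Om z u (a a' : R -> R) B :
  (forall t : R, is_derive t 1 a (a' t)) -> continuous a' ->
  (forall t, t <= 0 -> a t = 0) -> (forall t, 1 <= t -> a t = 1) ->
  (forall t, Om (z + real_scale (a t) u)) ->
  (forall t, kobm Om (z + real_scale (a t) u) (real_scale (a' t) u) <= B) ->
  reach Om z (z + u) B.
Proof.
move=> da ca' a0 a1 hO hk.
exists (fun t => z + real_scale (a t) u), (fun t => real_scale (a' t) u); split.
- move=> t V /nbhs_enorm[e e0 hV].
  have N0 : 0 < enorm u + 1 by rewrite ltr_wpDl// enorm_ge0.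
  have /cvgrPdist_lt/(_ _ (divr_gt0 e0 N0)) := ca' t.
  apply: filterS => s; rewrite ltr_pdivlMr// => hs; apply: hV.
  rewrite /real_scale -scalerBl -rmorphB -/(real_scale (a' s - a' t) u).
  rewrite enorm_real_scale distrC; apply: le_lt_trans hs.
  by rewrite ler_wpM2l// lerDl.
- move=> t; apply/is_velocity_eps => e e0.
  have N0 : 0 < enorm u + 1 by rewrite ltr_wpDl// enorm_ge0.
  have [d d0 hd] := is_derive_eps (da t) (divr_gt0 e0 N0).
  exists d => // s /hd hs.
  have -> : z + real_scale (a s) u - (z + real_scale (a t) u) -
    real_scale (s - t) (real_scale (a' t) u) = real_scale (a s - a t - a' t * (s - t)) u.
    rewrite real_scaleA opprD addrACA subrr add0r /real_scale -!scalerBl -!rmorphB.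
    by rewrite (mulrC (s - t)).
  rewrite enorm_real_scale.
  apply: le_trans (ler_wpM2r (enorm_ge0 u) hs) _.
  rewrite mulrAC; apply: ler_wpM2r => //.
  by rewrite mulrAC ler_pdivrMr// ler_pM2l// lerDl.
- by split=> t ht; [rewrite a0// real_scale0 addr0|rewrite a1// real_scale1].
- by [].
Qed.

Lemma reach_segment Om z w (r : R) : 0 < r ->
  (forall s : R, 0 <= s <= 1 -> forall y, enorm (y - (z + real_scale s (w - z))) < r -> Om y) ->
  reach Om z w (2 * enorm (w - z) / r).
Proof.
move=> r0 hr; rewrite -[w in reach _ _ w _](subrK z) addrC.
apply: (@reach_line _ _ _ (@smoothstep R) (@smoothstep' R)).
- by move=> t; exact: smoothstep_derive.
- exact: continuous_smoothstep'.
- by move=> t; exact: smoothstep_le0.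
- by move=> t; exact: smoothstep_ge1.
- by move=> t; apply: (hr _ (smoothstep_itv t)); rewrite subrr enorm0.
move=> t; have /andP[s0 s2] := smoothstep'_itv t.
apply: le_trans (kobm_le _ r0 (hr _ (smoothstep_itv t))) _.
rewrite ler_pM2r ?invr_gt0// enorm_real_scale ger0_norm//.
by rewrite ler_wpM2r// enorm_ge0.
Qed.

Lemma reach_ball Om z w (r : R) : 0 < r -> (forall y, enorm (y - z) < 2 * r -> Om y) ->
  enorm (w - z) < r -> reach Om z w (2 * enorm (w - z) / r).
Proof.
move=> r0 hr wz; apply: reach_segment => // s /andP[s0 s1] y hy; apply: hr.
rewrite -(subrK (z + real_scale s (w - z)) y) -addrA [X in enorm (_ + X)]addrAC.
rewrite subrr add0r; apply: le_lt_trans (enormD _ _) _.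
rewrite enorm_real_scale ger0_norm//.
have : s * enorm (w - z) <= enorm (w - z) by rewrite ler_piMl// enorm_ge0.
by move: hy wz; clear; lra.
Qed.

Lemma reach_refl Om z : open Om -> Om z -> exists B, reach Om z z B.
Proof.
move=> oOm Oz; have [r r0 hr] := open_enorm oOm Oz.
exists (2 * enorm (z - z) / (r / 2)); apply: reach_ball.
- by rewrite divr_gt0.
- by move=> y; rewrite mulrC divfK//; exact: hr.
- by rewrite subrr enorm0 divr_gt0.
Qed.

(** Points of a small ball are reachable from each other, so the set of points reachable from z is
    open and closed in [Om]. *)
Lemma reach_connected Om z w : open Om -> connected Om -> Om z -> Om w ->
  exists B, reach Om z w B.
Proof.
move=> oOm cOm Oz Ow.
pose A := [set y | exists B, reach Om z y B].
have AO y : A y -> Om y.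
  by move=> [B [gam [g [_ _ [_ g1] hg]]]]; rewrite -(g1 1 (lexx _)); have [] := hg 1.
have loc y : Om y -> exists2 r : R, 0 < r & forall x, enorm (x - y) < r -> (A y <-> A x).
  move=> Oy; have [r r0 hr] := open_enorm oOm Oy.
  exists (r / 2); first by rewrite divr_gt0.
  move=> x xy; have r20 : 0 < r / 2 by rewrite divr_gt0.
  have rxy : reach Om y x (2 * enorm (x - y) / (r / 2)).
    by apply: reach_ball => // y'; rewrite mulrC divfK//; exact: hr.
  split=> -[B hB]; eexists; first exact: reach_trans hB rxy.
  exact: reach_trans hB (reach_sym rxy).
have oA : open A.
  rewrite openE => y Ay; have [r r0 hr] := loc y (AO y Ay).
  by apply/nbhs_enorm; exists r => // x /hr[h _]; exact: h.
suff AE : A = Om by have : A w by rewrite AE.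
apply: (cOm A).
- by exists z; exact: reach_refl.
- by exists A => //; apply/seteqP; split=> y; [move=> Ay; split=> //; exact: AO|case].
- exists (closure A); first exact: closed_closure.
  apply/seteqP; split=> y; first by move=> Ay; split; [exact: AO|exact: subset_closure].
  move=> [yO /closure_enorm cl]; have [r r0 hr] := loc y yO.
  by have [x Ax /hr[_]] := cl r r0; apply.
Qed.

End Paths.

(** * Moving inwards from a C^2 boundary point *)

Section InnerCone.
Variables (R : realType) (n : nat).
Local Notation C := (Cplx R).
Implicit Types (z w u v p y : 'cV[C]_n) (Om U : set 'cV[C]_n).

Lemma C1_local U (f : 'cV[C]_n -> R) p v (b : R) : open U -> U p -> C1_on U f ->
  ddir v f p < b ->
  exists e K : R, [/\ 0 < e, 0 < K,
    forall y, enorm (y - p) < e -> U y /\ ddir v f y < b &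
    forall y w, enorm (y - p) < e -> enorm (w - p) < e ->
      `|f w - f y| <= K * enorm (w - y)].
Proof.
move=> oU Up C1 vb; have [_ H] := C1 _ Up.
have cx j : {for p, continuous (fun y => dx j f y)} by exact: (H (delta_mx j 0)).2.
have cy j : {for p, continuous (fun y => dy j f y)} by exact: (H ('i *: delta_mx j 0)).2.
pose X y j := dx j f y; pose Y y j := dy j f y.
have ddirE h y : U y -> ddir h f y = linform (X y) (Y y) h.
  by move=> Uy; rewrite (ddir_coord h oU C1 Uy).
have [E1 E10 hX] := finite_bound (X p); have [E2 E20 hY] := finite_bound (Y p).
have n1 := open_nbhs_nbhs (conj oU Up).
have n2 : nbhs p [set y | forall j, `|X y j - X p j| <= 1 /\ `|Y y j - Y p j| <= 1].
  apply: filter_forall1 => j.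
  exact: filterI (continuous_close ltr01 (cx j)) (continuous_close ltr01 (cy j)).
have b0 : 0 < (b - ddir v f p) / 2 by rewrite divr_gt0// subr_gt0.
have n3 := continuous_close b0 (H v).2.
have [e e0 he] := (nbhs_enorm _ _).1 (filterI n1 (filterI n2 n3)).
pose K := n%:R * 2 * (E1 + E2 + 1) + 1.
have K0 : 0 < K by rewrite ltr_wpDl// !mulr_ge0// !addr_ge0.
exists (e / 3), K; split=> //; first by rewrite divr_gt0.
  move=> y hy; have ye : enorm (y - p) < e by move: hy e0; clear; lra.
  have [Uy [_ h]] := he y ye; split=> //.
  by move: h vb; rewrite /= ler_norml; clear; move: (ddir _ _ _) (ddir _ _ _) => a d; lra.
move=> y w hy hw.
have wy : enorm (w - y) < 2 * (e / 3).
  apply: le_lt_trans (enorm_triangle p _ _) _; rewrite (enormB p).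
  by move: hy hw; clear; lra.
have seg s : 0 <= s <= 1 -> enorm (y + real_scale s (w - y) - p) < e.
  move=> /andP[s0 s1]; rewrite addrAC.
  apply: le_lt_trans (enormD _ _) _; rewrite enorm_real_scale ger0_norm//.
  have : s * enorm (w - y) <= enorm (w - y) by rewrite ler_piMl// enorm_ge0.
  by move: hy wy e0; clear; lra.
have [s s01] := mvt_line C1 (fun s hs => (he _ (seg s hs)).1).
rewrite (addrC y (w - y)) subrK => ->.
have [Us [hs _]] := he _ (seg s s01).
rewrite (ddirE _ _ Us); apply: le_trans (@linform_bound R n _ _ (E1 + E2 + 1) _ _ _) _.
- move=> j; rewrite -(subrK (X p j) (X _ j)) (le_trans (ler_normD _ _))//.
  by have := (hs j).1; have := hX j; move: E20; clear; lra.
- move=> j; rewrite -(subrK (Y p j) (Y _ j)) (le_trans (ler_normD _ _))//.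
  by have := (hs j).2; have := hY j; move: E10; clear; lra.
by apply: ler_wpM2r; [exact: enorm_ge0|rewrite lerDl].
Qed.

(** The vector u points in a direction of decrease of rho. If s |u| <= delta / 2, the ball of radius
    delta about z contains the points y in question. Otherwise rho falls along the segment by at
    least a multiple of s, which absorbs the Lipschitz variation from its end to y. *)
Lemma inner_cone Om p U rho : open Om -> bdry Om p -> defining_function Om p U rho ->
  exists (e kap : R) u, [/\ 0 < e, 0 < kap & forall z, enorm (z - p) < e -> Om z ->
    forall s : R, 0 <= s <= 1 -> forall y,
      enorm (y - (z + real_scale s u)) < kap * (delta Om z + s) -> Om y].
Proof.
move=> oOm bp [oU Up [C1 _] OmU grad].
have [v vneg] : exists v, ddir v rho p < 0.
  have [v] := grad p Up bp; rewrite neq_lt => /orP[v0|v0]; first by exists v.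
  by exists (real_scale (-1) v); rewrite (ddirZ _ _ C1 Up) mulN1r oppr_lt0.
have v0 : 0 < enorm v.
  rewrite enorm_gt0; apply/eqP => v0; move: vneg.
  by rewrite v0 (ddir0 C1 Up) ltxx.
pose beta := - ddir v rho p / 2.
have beta0 : 0 < beta by rewrite divr_gt0// oppr_gt0.
have vb : ddir v rho p < - beta by rewrite /beta; move: vneg; clear; lra.
have [e0 [K [e00 K0 hd hl]]] := C1_local oU Up C1 vb.
pose s0 := e0 / 4 / enorm v.
have s00 : 0 < s0 by rewrite !divr_gt0.
pose u := real_scale s0 v.
have eu : enorm u = e0 / 4.
  by rewrite /u enorm_real_scale ger0_norm ?(ltW s00)// /s0 divfK// gt_eqF.
pose b := Num.min (s0 * beta / K) (e0 / 4).
have b0 : 0 < b by rewrite lt_min !divr_gt0// mulr_gt0.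
have e40 : 0 < e0 / 4 by rewrite divr_gt0.
(* The first two bounds serve the case s |u| <= delta / 2. In the other case delta < 2 s |u|, and
   the third gives kap (delta + s) <= b s. *)
pose kap := Num.min (1 / 4) (Num.min (enorm u / 2) (b / (2 * enorm u + 1))).
have u1 : 0 < 2 * enorm u + 1 by rewrite eu; move: e40; clear; lra.
have kap0 : 0 < kap by rewrite !lt_min !divr_gt0// eu.
have k1 : kap <= 1 / 4 by rewrite ge_min lexx.
have k2 : kap <= enorm u / 2 by rewrite !ge_min lexx orbT.
have k3 : kap * (2 * enorm u + 1) <= b.
  by rewrite -ler_pdivlMr// !ge_min lexx !orbT.
exists (e0 / 4), kap, u; split=> // z hz Oz s /andP[ss0 ss1] y hy.
have ze : enorm (z - p) < e0 by move: hz e00; clear; lra.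
have [Uz _] := hd z ze.
have rz0 : rho z < 0.
  have H : [set z | U z /\ rho z < 0] z by rewrite -OmU.
  exact: H.2.
have su : s * enorm u <= e0 / 4 by rewrite eu ler_piMl// ltW.
have [hs|hs] := leP (s * enorm u) (delta Om z / 2).
  apply: (@delta_ball _ _ _ z).
  apply: le_lt_trans (enorm_triangle (z + real_scale s u) _ _) _.
  rewrite (addrC z) addrK enorm_real_scale ger0_norm//.
  rewrite (addrC _ z).
  have d0 : 0 <= delta Om z.
    have : 0 <= delta Om z / 2 by apply: le_trans hs; rewrite mulr_ge0// enorm_ge0.
    by clear; lra.
  have : kap * delta Om z <= 1 / 4 * delta Om z by rewrite ler_wpM2r.
  have : kap * s <= enorm u / 2 * s by rewrite ler_wpM2r.
  move: hy hs; rewrite mulrDr; move: (delta Om z) (enorm (y - _)) => d a.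
  by clear; lra.
have ys : enorm (y - (z + real_scale s u)) < b * s.
  apply: lt_le_trans hy _; rewrite mulrDr.
  apply: (@le_trans _ _ (kap * (2 * enorm u + 1) * s)); last by rewrite ler_wpM2r.
  rewrite mulrDr mulr1 mulrDl lerD2r -mulrA ler_pM2l//.
  by move: hs; clear; lra.
have sg (r : R) : 0 <= r <= 1 -> enorm (z + real_scale r (real_scale s u) - p) < e0.
  move=> /andP[r0 r1]; rewrite addrAC; apply: le_lt_trans (enormD _ _) _.
  rewrite (enorm_real_scale r) (enorm_real_scale s) !ger0_norm//.
  have : r * (s * enorm u) <= s * enorm u by rewrite ler_piMl// mulr_ge0// enorm_ge0.
  by move: hz su e00; clear; lra.
have hU r (hr : 0 <= r <= 1) := (hd _ (sg r hr)).1.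
have [r r01] := mvt_line C1 hU.
have real_u : real_scale s u = real_scale (s * s0) v by rewrite /u real_scaleA.
rewrite {2}real_u (ddirZ _ _ C1 (hU r r01)) => E.
have [_ dneg] := hd _ (sg r r01).
have sz : enorm (z + real_scale s u - p) < e0.
  by have := sg 1; rewrite real_scale1; apply; rewrite ler01 lexx.
have yp : enorm (y - p) < e0.
  apply: le_lt_trans (enorm_triangle (z + real_scale s u) _ _) _.
  have : enorm (z + real_scale s u - p) < e0 / 4 + e0 / 4.
    rewrite addrAC; apply: le_lt_trans (enormD _ _) _.
    rewrite enorm_real_scale ger0_norm//; move: hz su; clear; lra.
  have : b * s <= e0 / 4.
    by apply: (@le_trans _ _ b); [rewrite ler_piMr// ltW|rewrite ge_min lexx orbT].
  by move: ys e00; clear; lra.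
have := hl _ _ sz yp; rewrite ler_norml => /andP[_ hry].
have [Uy _] := hd y yp.
have ry : rho y < 0.
  have h1 : K * enorm (y - (z + real_scale s u)) <= s * s0 * beta.
    apply: (@le_trans _ _ (K * (b * s))); first by rewrite ler_pM2l// ltW.
    rewrite mulrA (_ : s * s0 * beta = K * (s0 * beta / K) * s); last first.
      by field; rewrite gt_eqF.
    by rewrite ler_wpM2r// ler_pM2l// ge_min lexx.
  have h2 : s * s0 * ddir v rho (z + real_scale r (real_scale s u)) <= - (s * s0 * beta).
    rewrite -mulrN; apply: ler_wpM2l; last exact: ltW.
    by rewrite mulr_ge0// ltW.
  move: E hry rz0 h1 h2; move: (s * s0 * ddir _ _ _) (rho y) (rho z) (K * _) (s * s0 * beta).
  by move: (rho _); clear => *; lra.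
by have : (Om `&` U) y; [rewrite OmU|case].
Qed.

Lemma reach_le Om z w B B' : reach Om z w B -> B <= B' -> reach Om z w B'.
Proof.
move=> [gam [g [h1 h2 h3 h4]]] BB; exists gam, g; split=> // t.
by have [? h] := h4 t; split=> //; exact: le_trans BB.
Qed.

Lemma reach_near_bdry Om p U rho z0 : bounded_domain Om -> bdry Om p ->
  defining_function Om p U rho -> Om z0 ->
  exists e K : R, [/\ 0 < e, 0 < K & forall z, enorm (z - p) < e -> Om z ->
    reach Om z z0 (K * (1 + ln (1 + 1 / delta Om z)))].
Proof.
move=> [oOm cOm _ _] bp def Oz0.
have [e0 [kap [u [e00 kap0 cone]]]] := inner_cone oOm bp def.
have [clp nOp] := (bdryP _ oOm).1 bp.
pose e := Num.min e0 (kap / 4).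
have e_gt0 : 0 < e by rewrite lt_min e00 divr_gt0.
have ee0 : e <= e0 by rewrite ge_min lexx.
have ek : e <= kap / 4 by rewrite ge_min lexx orbT.
(* A fixed reference point: for every z near p the points z + u and z1 + u are closer than kap / 2,
   so one connecting path from z1 + u to z0 serves all z. *)
have [z1 Oz1 z1p] := (closure_enorm _ _).1 clp e e_gt0.
have d0 z : Om z -> 0 < delta Om z by move=> Oz; exact: delta_gt0 nOp.
have unit01 : 0 <= (1 : R) <= 1 by rewrite ler01 lexx.
have Ozu z : enorm (z - p) < e -> Om z -> forall y, enorm (y - (z + u)) < kap -> Om y.
  move=> zp Oz y hy; apply: (cone z _ Oz 1 unit01); first exact: lt_le_trans ee0.
  rewrite real_scale1; apply: lt_le_trans hy _; rewrite ler_pMr// lerDr.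
  by rewrite ltW// d0.
have Oz1u : Om (z1 + u) by apply: (Ozu z1) => //; rewrite subrr enorm0.
have [B3 r3] := reach_connected oOm cOm Oz1u Oz0.
have B30 := reach_ge0 r3.
(* Two uses of [reach_trans] give 2 (2 (2 Lam |u| / kap + 2) + B3), which is at most K (1 + Lam). *)
pose K := 8 * enorm u / kap + 8 + 2 * B3 + 1.
have uk0 : 0 <= enorm u / kap by rewrite divr_ge0 ?enorm_ge0// ltW.
have K0 : 0 < K by rewrite /K -mulrA; move: uk0 B30; clear; lra.
exists e, K; split=> // z zp Oz.
set d := delta Om z; have dz : 0 < d by exact: d0.
pose Lam := ln (1 + 1 / d).
have d1 : 1 < 1 + 1 / d by rewrite ltrDl divr_gt0.
have Lam0 : 0 <= Lam by rewrite ln_ge0// ltW.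
have eL : expR Lam = 1 + 1 / d by rewrite lnK// posrE (lt_trans ltr01).
(* At height a the metric in direction u is at most |u| / (kap (d + a)). This parametrisation makes
   d + a = d exp (Lam S), where S is the smoothstep, so a' / (d + a) = Lam S' <= 2 Lam; and a
   reaches 1 because exp Lam = 1 + 1 / d. *)
pose a (t : R) := d * (expR (Lam * smoothstep t) - 1).
pose a' (t : R) := d * (expR (Lam * smoothstep t) * (Lam * smoothstep' t)).
have a01 t : 0 <= a t <= 1.
  have /andP[s0 s1] := smoothstep_itv t; rewrite /a; apply/andP; split.
    by rewrite mulr_ge0 ?(ltW dz)// subr_ge0 -expR0 ler_expR mulr_ge0.
  have : expR (Lam * smoothstep t) <= 1 + 1 / d by rewrite -eL ler_expR ler_piMr.
  by rewrite -lerBlDl -(ler_pM2l dz) (mulrC d (1 / d)) divfK// gt_eqF.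
have r1 : reach Om z (z + u) (2 * Lam * enorm u / kap).
  apply: (@reach_line _ _ _ _ _ a a').
  - move=> t; rewrite /a /a'.
    have dS : is_derive t 1 (fun t => Lam * smoothstep t) (Lam * smoothstep' t).
      exact: (@is_deriveZ _ _ _ (@smoothstep R) Lam t 1 _ (smoothstep_derive t)).
    have dE := @is_derive1_comp _ (@expR R) (fun t => Lam * smoothstep t) t _ _
      (is_derive_expR (Lam * smoothstep t)) dS.
    have dB := is_deriveB dE (is_derive_cst (1 : R) t 1).
    have := @is_deriveZ _ _ _ _ d t 1 _ dB.
    by rewrite subr0.
  - move=> t; apply: cvgM; first exact: cvg_cst.
    apply: cvgM.
      apply: (@continuous_comp _ _ _ (fun t => Lam * smoothstep t) (@expR R)).
        apply: cvgM; first exact: cvg_cst.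
        exact: is_derive_continuous (smoothstep_derive t).
      exact: continuous_expR.
    by apply: cvgM; [exact: cvg_cst|exact: continuous_smoothstep'].
  - by move=> t t0; rewrite /a smoothstep_le0// mulr0 expR0 subrr mulr0.
  - move=> t t1; rewrite /a smoothstep_ge1// mulr1 eL addrAC subrr add0r.
    by rewrite mulrC divfK// gt_eqF.
  - move=> t; apply: (cone z _ Oz _ (a01 t)); first exact: lt_le_trans ee0.
    rewrite subrr enorm0 mulr_gt0//; have /andP[? _] := a01 t.
    by rewrite ltr_wpDr.
  move=> t; have /andP[at0 at1] := a01 t.
  have r0 : 0 < kap * (d + a t) by rewrite mulr_gt0// ltr_wpDr.
  have hr := cone z (lt_le_trans zp ee0) Oz _ (a01 t).
  apply: le_trans (kobm_le _ r0 hr) _.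
  rewrite enorm_real_scale.
  have /andP[s'0 s'2] := smoothstep'_itv t.
  have E0 : 0 < expR (Lam * smoothstep t) by exact: expR_gt0.
  have da : d + a t = d * expR (Lam * smoothstep t) by rewrite /a; ring.
  rewrite da ger0_norm; last first.
    apply: mulr_ge0; first exact: ltW.
    by apply: mulr_ge0; [exact: ltW|exact: mulr_ge0].
  have -> : a' t * enorm u / (kap * (d * expR (Lam * smoothstep t))) =
     smoothstep' t * (Lam * enorm u / kap).
    by rewrite /a'; field; rewrite !gt_eqF.
  rewrite (_ : 2 * Lam * enorm u / kap = 2 * (Lam * enorm u / kap)); last by rewrite !mulrA.
  apply: ler_wpM2r => //; apply: divr_ge0; last exact: ltW.
  by rewrite mulr_ge0// enorm_ge0.
have zz1 : enorm (z1 + u - (z + u)) < kap / 2.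
  rewrite opprD addrACA subrr addr0.
  apply: le_lt_trans (enorm_triangle p _ _) _; rewrite (enormB p).
  by move: zp z1p ek; clear; lra.
have r2 : reach Om (z + u) (z1 + u) 2.
  have k20 : 0 < kap / 2 by rewrite divr_gt0.
  apply: (reach_le (reach_ball k20 _ zz1)).
    move=> y hy; apply: (Ozu z zp Oz); move: hy.
    by rewrite mulrC (divfK (lt0r_neq0 (ltr0Sn _ 1))).
  by rewrite ler_pdivrMr// ler_pM2l// ltW.
apply: (reach_le (reach_trans oOm (reach_trans oOm r1 r2) r3)).
rewrite -/Lam /K.
have -> : 2 * Lam * enorm u / kap = 2 * Lam * (enorm u / kap) by rewrite mulrA.
have -> : 8 * enorm u / kap = 8 * (enorm u / kap) by rewrite mulrA.
move: (enorm u / kap) uk0 => q q0.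
have h1 : 0 <= q * Lam by rewrite mulr_ge0.
have h2 : 0 <= B3 * Lam by rewrite mulr_ge0.
by clear - q0 Lam0 B30 h1 h2; lra.
Qed.

End InnerCone.

(** * Visibility *)

Section AbsoluteContinuity.
Variable R : realType.
Local Notation mu := (@lebesgue_measure R).

(** The supremum of the x with P a x is reached from the left and cannot lie below b. The local
    hypothesis only concerns intervals having the point t as an end, which suits one-point
    derivative estimates. *)
Lemma cousin (P : R -> R -> Prop) (a b : R) : a <= b ->
  (forall x y z, a <= x -> x <= y -> y <= z -> z <= b -> P x y -> P y z -> P x z) ->
  (forall t, a <= t <= b -> exists2 d : R, 0 < d &
    (forall x, a <= x <= t -> t - x < d -> P x t) /\
    (forall y, t <= y <= b -> y - t < d -> P t y)) ->
  P a b.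
Proof.
move=> ab add loc.
pose S := [set x | a <= x <= b /\ P a x].
have Sa : S a.
  split; first by rewrite lexx.
  have [|d d0 [h _]] := loc a; first by rewrite lexx.
  by apply: h; rewrite ?lexx// subrr.
have Sub : ubound S b by move=> x [/andP[]].
have hs : has_sup S by split; [exists a|exists b].
set s := sup S.
have as_ : a <= s by apply: ub_le_sup => //; exists b.
have sb : s <= b by apply: ge_sup => //; exists a.
have [|d d0 [hl hr]] := loc s; first by rewrite as_ sb.
have [x [/andP[ax xb] Pax] xs] := sup_adherent d0 hs.
have xs' : x <= s by apply: ub_le_sup => //; [exists b|split=> //; rewrite ax].
have Pas : P a s.
  apply: (add a x s) => //; apply: hl; first by rewrite ax.
  by move: xs; rewrite -/s; clear; lra.
have [<-//|sb'] : s = b \/ s < b by move: sb; rewrite le_eqVlt => /predU1P[]; [left|right].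
pose y := Num.min b (s + d / 2).
have sy : s < y by rewrite lt_min sb' ltrDl divr_gt0.
have yb : y <= b by rewrite ge_min lexx.
have : S y.
  split; first by rewrite (le_trans as_ (ltW sy)).
  apply: (add a s y) => //; first exact: ltW.
  apply: hr; first by rewrite ltW.
  by have : y <= s + d / 2 by [rewrite ge_min lexx orbT]; move: d0; clear; lra.
move=> /(ub_le_sup (ex_intro _ b Sub)); rewrite -/s leNgt sy.
by [].
Qed.

(* [l] lists the end points of successive intervals contained in [U]. *)
Fixpoint chain (U : set R) (x y : R) (l : seq (R * R)) : Prop :=
  if l is cd :: l' then [/\ x <= cd.1, cd.1 <= cd.2,
    forall t, cd.1 <= t <= cd.2 -> U t & chain U cd.2 y l'] else x <= y.

Lemma chain_le U x y l : chain U x y l -> x <= y.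
Proof.
elim: l x => [//|[c d] l IH] x /= [xc cd _ /IH dy].
exact: le_trans xc (le_trans cd dy).
Qed.

Lemma chain_weaken U x x' y l : x <= x' -> chain U x' y l -> chain U x y l.
Proof.
by case: l => [|[c d] l] xx' /=; [exact: le_trans|case=> h1 h2 h3 h4; split=> //;
  exact: le_trans h1].
Qed.

Lemma chain_cat U x y z l l' : chain U x y l -> chain U y z l' -> chain U x z (l ++ l').
Proof.
elim: l x => [|[c d] l IH] x /=; first exact: chain_weaken.
by move=> [h1 h2 h3 h4] h5; split=> //; exact: IH.
Qed.

Lemma chain_nth U x y l i : chain U x y l -> (i < size l)%N ->
  x <= (nth (0, 0) l i).1 /\ (nth (0, 0) l i).1 <= (nth (0, 0) l i).2 /\
  (nth (0, 0) l i).2 <= y.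
Proof.
elim: l x i => [//|[c d] l IH] x [|i] /= [h1 h2 _ h4].
  by move=> _; split=> //; split=> //; exact: chain_le h4.
rewrite ltnS => il; have [k1 [k2 k3]] := IH _ _ h4 il; split=> //.
exact: le_trans h1 (le_trans h2 k1).
Qed.

Lemma chain_disjoint U x y l i j : chain U x y l -> (i < j)%N -> (j < size l)%N ->
  (nth (0, 0) l i).2 <= (nth (0, 0) l j).1.
Proof.
elim: l x i j => [//|[c d] l IH] x [|i] [|j] //= [_ _ _ h4].
  by rewrite ltnS => _ jl; have [] := chain_nth h4 jl.
by rewrite !ltnS; exact: IH h4.
Qed.

Lemma chain_length U x y l : open U -> chain U x y l ->
  ((\sum_(cd <- l) (cd.2 - cd.1))%:E <= mu (U `&` `]x, y]%classic))%E.
Proof.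
move=> oU; have mU : measurable U by exact: measurable_realfun.open_measurable.
elim: l x => [|[c d] l IH] x /=; first by rewrite big_nil measure_ge0.
move=> [xc cd hU h]; rewrite big_cons /= EFinD.
have dy := chain_le h.
apply: (@le_trans _ _ (mu `]c, d]%classic + mu (U `&` `]d, y]%classic))%E).
  apply: leeD; last exact: IH.
  rewrite lebesgue_measure_itv /= lte_fin; case: ltP => [cd'|dc]; first by rewrite -EFinB.
  by rewrite lee_fin subr_le0.
rewrite -measureU //; last 2 first.
- exact: measurableI.
- rewrite -subset0 => t [/=]; rewrite !in_itv /= => /andP[_ td] [_ /andP[dt _]].
  by move: td; rewrite leNgt dt.
apply: le_measure; rewrite ?inE.
- by apply: measurableU => //; exact: measurableI.
- exact: measurableI.
move=> t [/=|[Ut]]; rewrite /= !in_itv /= => /andP[h1 h2].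
  split; first by apply: hU; rewrite (ltW h1).
  by rewrite (le_lt_trans xc h1) (le_trans h2 dy).
split=> //; rewrite h2 andbT.
exact: le_lt_trans (le_trans xc cd) h1.
Qed.

(** This stands in for integrating the derivative. The exceptional null set is covered by an open U
    of measure less than the d of absolute continuity. Off U the velocity bound controls small
    increments by those of [Gam]; the increments over intervals inside U add up to less than
    [e1]. *)
Lemma absolutely_continuous_bound n (sg : R -> 'cV[Cplx R]_n) (L a b : R)
    (Gam Gam' : R -> R) :
  0 <= a -> a <= b -> b <= L ->
  absolutely_continuous_on `[0, L]%R sg ->
  (forall t : R, a <= t <= b -> is_derive t 1 Gam (Gam' t)) ->
  (forall t, a <= t <= b -> 0 <= Gam' t) ->
  {ae mu, forall t, a <= t <= b -> exists2 v, is_velocity sg t v & enorm v <= Gam' t} ->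
  enorm (sg b - sg a) <= Gam b - Gam a.
Proof.
move=> a0 ab bL ac dG G0 [N [mN N0 hN]].
have Gmono x y : a <= x -> x <= y -> y <= b -> Gam x <= Gam y.
  move=> ax xy yb; rewrite -subr_ge0.
  have [|c /andP[xc cy] ->] := @mvt_closed R Gam Gam' x y xy.
    by move=> t /andP[xt ty]; apply: dG; rewrite (le_trans ax xt) (le_trans ty yb).
  by rewrite mulr_ge0 ?subr_ge0// G0// (le_trans ax xc) (le_trans cy yb).
apply/ler_addgt0Pr => e e0.
pose K := b - a + 1; have K0 : 0 < K by rewrite /K; move: ab; clear; lra.
pose e1 := e / K; have e10 : 0 < e1 by rewrite divr_gt0.
have [d d0 hd] := ac e1 e10.
have mNoo : (mu N < +oo)%E by rewrite N0 ltry.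
have [U [oU NU mUd]] := lebesgue_regularity_outer mN mNoo d0.
have mU : measurable U by exact: measurable_realfun.open_measurable.
have muU : (mu U < d%:E)%E.
  apply: le_lt_trans mUd.
  have {1}-> : U = (U `\` N) `|` N by rewrite setDKU.
  have h2 : (mu ((U `\` N) `|` N) <= mu (U `\` N) + mu N)%E.
    by apply: measureU2 => //; exact: measurableD.
  by apply: le_trans h2 _; rewrite N0 adde0.
pose S (l : seq (R * R)) := \sum_(cd <- l) enorm (sg cd.2 - sg cd.1).
(* The list l records the intervals charged to U; concatenation of lists makes P additive, as
   [cousin] requires. *)
pose P x y := exists2 l, chain U x y l &
  enorm (sg y - sg x) <= Gam y - Gam x + e1 * (y - x) + S l.
have : P a b.
  apply: cousin => //.
    move=> x y z _ _ _ _ [l1 c1 h1] [l2 c2 h2]; exists (l1 ++ l2).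
      exact: chain_cat c1 c2.
    rewrite /S big_cat /= -/(S l1) -/(S l2).
    apply: le_trans (enorm_triangle (sg y) _ _) _.
    by move: h1 h2; move: (S l1) (S l2) => s1 s2; clear; lra.
  move=> t /[dup] tab /andP[at_ tb]; have [tU|tU] := pselect (U t).
    have [r r0 hr] : exists2 r : R, 0 < r & forall s, `|t - s| < r -> U s.
      have /nbhs_ballP[r /= r0 hr] := open_nbhs_nbhs (conj oU tU).
      by exists r => // s st; exact: hr.
    exists r => //; split.
      move=> x /andP[ax xt] txr; exists [:: (x, t)].
        split=> //=; move=> s /andP[xs st]; apply: hr.
        by rewrite ger0_norm ?subr_ge0//; move: txr xs; clear; lra.
      rewrite /S big_seq1 /= lerDr addr_ge0 ?subr_ge0 ?Gmono//.
      by rewrite mulr_ge0 ?subr_ge0// ltW.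
    move=> y /andP[ty yb] ytr; exists [:: (t, y)].
      split=> //=; move=> s /andP[ts sy]; apply: hr.
      by rewrite distrC ger0_norm ?subr_ge0//; move: ytr sy; clear; lra.
    rewrite /S big_seq1 /= lerDr addr_ge0 ?subr_ge0 ?Gmono//.
    by rewrite mulr_ge0 ?subr_ge0// ltW.
  have [v hv vG] : exists2 v, is_velocity sg t v & enorm v <= Gam' t.
    apply: contrapT => h; apply/tU/NU/hN => /= h'; apply: h; exact: h'.
  have e2 : 0 < e1 / 2 by rewrite divr_gt0.
  have [r1 r10 h1] := (is_velocity_eps _ _ _).1 hv _ e2.
  have [r2 r20 h2] := is_derive_eps (dG t tab) e2.
  have key s : `|s - t| < Num.min r1 r2 ->
      enorm (sg s - sg t) <= Gam' t * `|s - t| + e1 / 2 * `|s - t| /\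
      `|Gam s - Gam t - Gam' t * (s - t)| <= e1 / 2 * `|s - t|.
    rewrite lt_min => /andP[s1 s2]; split; last exact: h2.
    rewrite -(subrK (real_scale (s - t) v) (sg s - sg t)).
    apply: le_trans (enormD _ _) _; rewrite addrC lerD//; last exact: h1.
    by rewrite enorm_real_scale mulrC ler_wpM2r.
  exists (Num.min r1 r2); first by rewrite lt_min r10.
  split.
    move=> x /andP[ax xt] tx; exists [::] => //=.
    have := key x; rewrite distrC ger0_norm ?subr_ge0// => /(_ tx)[k1 k2].
    rewrite /S big_nil addr0 enormB; move: k1 k2; rewrite ler_norml.
    move=> k1 /andP[k2 k3]; apply: le_trans k1 _; move: k3; clear.
    by move: (Gam' t) => g; lra.
  move=> y /andP[ty yb] yt; exists [::] => //=.
  have := key y; rewrite ger0_norm ?subr_ge0// => /(_ yt)[k1 k2].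
  rewrite /S big_nil addr0; move: k1 k2; rewrite ler_norml.
  move=> k1 /andP[k2 k3]; apply: le_trans k1 _; move: k2; clear.
  by move: (Gam' t) => g; lra.
move=> [l cl hl].
have Sl : S l < e1.
  rewrite /S (big_nth (0, 0)) big_mkord.
  apply: (hd _ (fun i : 'I_(size l) => (nth (0, 0) l i).1)
               (fun i : 'I_(size l) => (nth (0, 0) l i).2)).
  - move=> i; have [h1 [h2 h3]] := chain_nth cl (ltn_ord i).
    by rewrite !in_itv /=; split=> //; apply/andP; split; move: h1 h2 h3 a0 bL; clear; lra.
  - move=> i j; rewrite -val_eqE neq_ltn => /orP[ij|ji].
      by left; exact: chain_disjoint cl ij (ltn_ord j).
    by right; exact: chain_disjoint cl ji (ltn_ord i).
  rewrite -(big_mkord xpredT (fun i => (nth (0, 0) l i).2 - (nth (0, 0) l i).1)).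
  rewrite -(big_nth (0, 0) xpredT (fun cd : R * R => cd.2 - cd.1)).
  rewrite -lte_fin; apply: le_lt_trans (chain_length oU cl) _.
  apply: le_lt_trans muU; apply: le_measure; rewrite ?inE//.
  exact: measurableI.
apply: le_trans hl _; rewrite -addrA lerD2l.
have -> : e = e1 * (b - a) + e1 by rewrite /e1 /K; field; rewrite gt_eqF.
by rewrite lerD2l ltW.
Qed.

End AbsoluteContinuity.

(** * Crossing an annulus *)

Section Crossing.
Variable R : realType.

(** For each forbidden radius the interval is cut down to the quarter at the end away from it, which
    leaves a gap at least as long as that quarter. Later cuts only widen the gap relative to the
    interval. *)
Lemma avoid_radii (T : Type) (f : T -> R) (rs : seq T) (s1 s2 : R) : s1 < s2 ->
  exists t1 t2 : R, [/\ s1 <= t1, t2 <= s2, t2 - t1 = (s2 - s1) / 4 ^+ size rs &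
    forall i, (i < size rs)%N -> forall x0, let r := f (nth x0 rs i) in
      r <= t1 - (t2 - t1) \/ t2 + (t2 - t1) <= r].
Proof.
elim: rs s1 s2 => [|r rs IH] s1 s2 s12.
  by exists s1, s2; split=> //=; rewrite expr0 divr1.
have [s1' [s2' [h1 h2 h12 E gap]]] : exists s1' s2', [/\ s1 <= s1', s2' <= s2, s1' < s2',
    s2' - s1' = (s2 - s1) / 4 &
    f r <= s1' - (s2' - s1') \/ s2' + (s2' - s1') <= f r].
  have [rm|mr] := leP (f r) ((s1 + s2) / 2).
    exists (s2 - (s2 - s1) / 4), s2.
    by split; [lra|lra|lra|lra|left; lra].
  exists s1, (s1 + (s2 - s1) / 4).
  by split; [lra|lra|lra|lra|right; lra].
have [t1 [t2 [k1 k2 kE kgap]]] := IH _ _ h12.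
have pos4 : 0 < (4 : R) ^+ size rs by rewrite exprn_gt0.
have ge1 : 1 <= (4 : R) ^+ size rs by rewrite exprn_ege1// ler1n.
have le12 : t2 - t1 <= s2' - s1'.
  by rewrite kE ler_pdivrMr// ler_peMr// subr_ge0 ltW.
exists t1, t2; split.
- exact: le_trans k1.
- exact: le_trans h2.
- by rewrite kE E /= exprS -mulrA -invfM.
move=> [|i] /= hi x0; last exact: kgap.
by case: gap => gap; [left|right]; move: gap k1 k2 le12; clear; lra.
Qed.

Lemma first_hit (u : R -> R) (L c : R) : 0 <= L -> u 0 < c -> c <= u L ->
  (forall t, 0 <= t <= L -> forall e, 0 < e -> exists2 d, 0 < d &
    forall s, 0 <= s <= L -> `|s - t| < d -> `|u s - u t| < e) ->
  exists2 b, 0 <= b <= L & u b = c /\ forall t, 0 <= t <= b -> u t <= c.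
Proof.
move=> L0 u0 uL cont.
pose B := [set t | 0 <= t <= L /\ c <= u t].
have BL : B L by split; rewrite // L0 lexx.
have lb : lbound B 0 by move=> t [/andP[]].
have hi : has_inf B by split; [exists L|exists 0].
set b := inf B.
have b0 : 0 <= b by apply: lb_le_inf => //; exists L.
have bL : b <= L by apply: ge_inf => //; exists 0.
have bI : 0 <= b <= L by rewrite b0.
have below t : 0 <= t -> t < b -> u t < c.
  move=> t0 tb; rewrite ltNge; apply/negP => ct.
  have : B t by split=> //; rewrite t0 (le_trans (ltW tb)).
  by move=> /(ge_inf (ex_intro _ 0 lb)); rewrite leNgt tb.
have ub : u b = c.
  apply/eqP; rewrite eq_le; apply/andP; split; rewrite leNgt; apply/negP => h.
    have [|d d0 hd] := cont b bI (u b - c); first by rewrite subr_gt0.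
    have bpos : 0 < b.
      by rewrite lt_def b0 andbT; apply/eqP => bb; move: h u0; rewrite bb; lra.
    pose s := Num.max 0 (b - d / 2).
    have s0 : 0 <= s by rewrite le_max lexx.
    have sb : s < b by rewrite gt_max bpos ltrBlDr ltrDl divr_gt0.
    have sd : b - d / 2 <= s by rewrite le_max lexx orbT.
    have := hd s; rewrite s0 (le_trans (ltW sb) bL) => /(_ isT).
    rewrite distrC ger0_norm ?subr_ge0 ?(ltW sb)// => /(_ ltac:(move: sd d0; clear; lra)).
    have := below s s0 sb; rewrite ltr_norml; clear; lra.
  have [|d d0 hd] := cont b bI (c - u b); first by rewrite subr_gt0.
  have [t [/andP[t0 tL] ct] td] := inf_adherent d0 hi.
  have bt : b <= t by apply: ge_inf => //; [exists 0|split=> //; rewrite t0].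
  have := hd t; rewrite t0 tL => /(_ isT); rewrite ger0_norm ?subr_ge0//.
  move=> /(_ ltac:(move: td; rewrite -/b; clear; lra)); rewrite ltr_norml.
  by move: ct; clear; lra.
exists b => //; split=> // t /andP[t0]; rewrite le_eqVlt => /predU1P[->|tb].
  by rewrite ub.
exact/ltW/below.
Qed.

(** The time b is the first at which u equals t2; going back from b, that is, for - u (b - t), the
    first time of level - t1 gives the other end. *)
Lemma crossing (u : R -> R) (L t1 t2 : R) : 0 <= L -> t1 < t2 -> u 0 <= t1 -> t2 <= u L ->
  (forall t, 0 <= t <= L -> forall e, 0 < e -> exists2 d, 0 < d &
    forall s, 0 <= s <= L -> `|s - t| < d -> `|u s - u t| < e) ->
  exists a b : R, [/\ 0 <= a, a <= b, b <= L, u a = t1 /\ u b = t2 &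
    forall t, a <= t <= b -> t1 <= u t <= t2].
Proof.
move=> L0 t12 u0 uL cont.
have [b /andP[b0 bL] [ub hb]] := first_hit L0 (le_lt_trans u0 t12) uL cont.
have [|||a /andP[a0 ab] [ua ha]] := @first_hit (fun t => - u (b - t)) b (- t1) b0.
- by rewrite subr0 ub ltrN2.
- by rewrite subrr lerN2.
- move=> t /andP[t0 tb] e e0.
  have [|d d0 hd] := cont (b - t) _ e e0.
    by move: t0 tb bL; clear; lra.
  exists d => // s /andP[s0 sb] st.
  have := hd (b - s); rewrite (_ : b - s - (b - t) = - (s - t)); last by ring.
  rewrite normrN => /(_ ltac:(move: s0 sb bL; clear; lra) st).
  by rewrite -normrN (_ : - (u (b - s) - u (b - t)) = - u (b - s) - - u (b - t))//; ring.
exists (b - a), b; split.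
- by rewrite subr_ge0.
- by rewrite gerBl.
- by [].
- by split=> //; move: ua => /eqP; rewrite eqr_opp => /eqP.
move=> t /andP[at_ tb]; apply/andP; split; last first.
  by apply: hb; rewrite tb (le_trans _ at_)// subr_ge0.
have := ha (b - t); rewrite (_ : b - (b - t) = t); last by ring.
rewrite lerN2; apply; move: at_ tb; clear; lra.
Qed.

End Crossing.

Section Displacement.
Variables (R : realType) (n : nat).
Local Notation C := (Cplx R).
Implicit Types (z v w : 'cV[C]_n) (Om : set 'cV[C]_n).

Lemma is_derive_expR_affine (A r t0 t : R) :
  is_derive t 1 (fun s => A * expR (r * (s - t0))) (A * r * expR (r * (t - t0))).
Proof.
have h : is_derive t 1 (fun s => r * (s - t0)) r.
  have -> : (fun s => r * (s - t0)) = (r \*: (fun s : R => s - t0)).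
    by apply/funext => s.
  by apply: is_derive_eq; rewrite subr0 [LHS]mulr1.
have h2 := @is_derive1_comp _ expR (fun s => r * (s - t0)) t _ _ (is_derive_expR _) h.
have := is_deriveZ A h2.
by move=> H; apply: (is_derive_eq H); rewrite -mulrA; congr (A * _); rewrite mulrC.
Qed.

(* Along such a curve the growth of the Kobayashi distance makes the distance to
   the boundary decay exponentially, on both sides of a point where that
   distance is almost maximal, so the Euclidean speed is integrable there. *)
Lemma almost_geodesic_displacement Om z0 (lam kap M eta L : R) sg (a b : R) :
  open Om -> (exists w, ~ Om w) -> 1 <= lam -> 1 <= M -> 0 < eta ->
  let eps := eta ^+ 4 * expR (- ((kap + 10 * M) / (4 * M))) in eps <= 1 ->
  almost_geodesic Om lam kap `[0, L]%R sg -> 0 <= a -> a <= b -> b <= L ->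
  (forall t, a <= t <= b -> [/\ delta Om (sg t) <= eps,
     forall v, enorm v <= M * Num.sqrt (delta Om (sg t)) * kobm Om (sg t) v &
     reach Om (sg t) z0 (M * (1 + ln (1 + 1 / delta Om (sg t))))]) ->
  enorm (sg b - sg a) <= 32 * M ^+ 2 * lam ^+ 2 * eta.
Proof.
move=> oOm [w0 nw0] lam1 M1 eta0 eps eps1 [sgO sgk sgac sgv] a0 ab bL H.
pose D t := delta Om (sg t).
have inI t : a <= t <= b -> t \in `[0, L]%R.
  by move=> /andP[h1 h2]; rewrite in_itv /= (le_trans a0 h1) (le_trans h2 bL).
have D0 t : a <= t <= b -> 0 < D t.
  by move=> /inI /sgO Ot; exact: delta_gt0 nw0.
have De t : a <= t <= b -> D t <= eps by move=> /H[].
have M0 : 0 < M by exact: lt_le_trans M1.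
have lam0 : 0 < lam by exact: lt_le_trans lam1.
(* Maximality up to the factor 2 comes from the supremum alone and costs only the constant ln 2 <=
   1. *)
have [t0 t0I maxD] : exists2 t0, a <= t0 <= b & forall t, a <= t <= b -> D t <= 2 * D t0.
  pose S := [set D t | t in [set t | a <= t <= b]].
  have aI : a <= a <= b by rewrite lexx.
  have hS : has_sup S.
    by split; [exists (D a), a|exists eps => _ [t tI <-]; exact: De].
  have s0 : 0 < sup S.
    by apply: lt_le_trans (D0 a aI) _; apply: sup_upper_bound => //; exists a.
  have [|_ [t0 t0I <-] h] := sup_adherent (eps := sup S / 2) _ hS; first by rewrite divr_gt0.
  exists t0 => // t tI; have : D t <= sup S by apply: sup_upper_bound => //; exists t.
  by move: h; move: (sup S) (D t) (D t0); clear; intros; lra.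
pose ell t := - ln (D t).
have Dell t : a <= t <= b -> D t = expR (- ell t).
  by move=> /D0 h; rewrite /ell opprK lnK.
have ln2 : ln (2 : R) <= 1.
  by rewrite (le_trans (le_ln1Dx _)) // ?ltrN1x// ; lra.
have rch t : a <= t <= b -> reach Om (sg t) z0 (M * (1 + ln (1 + 1 / D t))) /\
    ln (1 + 1 / D t) <= 1 + ell t.
  move=> tI; split; first by case: (H t tI).
  have d0 := D0 t tI; have d1 : D t <= 1 by exact: le_trans (De t tI) eps1.
  have : ln (1 + 1 / D t) <= ln (2 / D t).
    rewrite ler_ln ?posrE ?divr_gt0 ?addr_gt0 ?divr_gt0//.
    by rewrite -(@ler_pM2r _ (D t))// mulrDl !divfK ?gt_eqF// mul1r; move: d1; clear; lra.
  rewrite lnM ?posrE ?invr_gt0// lnV ?posrE// -/(ell t) => h.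
  by move: h ln2; rewrite -/(ell t); clear; lra.
(* Joining sg t to sg t0 through z0 gives lam^-1 |t - t0| - kap <= 2 M (2 ell t + 5), because ell t0
   <= ell t + 1. Solved for ell t, this produces k and k'. *)
pose k := (4 * M * lam)^-1; pose k' := (kap + 10 * M) / (4 * M).
have k0 : 0 < k by rewrite invr_gt0 !mulr_gt0.
have ellt t : a <= t <= b -> k * `|t - t0| - k' <= ell t.
  move=> tI; have [r1 l1] := rch t tI; have [r2 l2] := rch t0 t0I.
  have r12 := reach_kobd (reach_trans oOm r1 (reach_sym r2)).
  have /andP[+ _] := sgk t t0 (inI t tI) (inI t0 t0I).
  move=> /le_trans/(_ r12); rewrite lee_fin distrC => h.
  have l3 : ell t0 <= ell t + 1.
    have : ln (D t) <= ln (2 * D t0) by rewrite ler_ln ?posrE ?mulr_gt0 ?D0// maxD.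
    rewrite lnM ?posrE ?D0// /ell; move: ln2; move: (ln 2) (ln (D t)) (ln (D t0)).
    by clear; intros; lra.
  have h2 : lam^-1 * `|t - t0| - kap <= 4 * M * ell t + 10 * M.
    apply: le_trans h _; rewrite -mulrDr.
    have -> : 4 * M * ell t + 10 * M = 2 * (M * (2 * ell t + 5)) by ring.
    rewrite ler_pM2l// ler_pM2l//; move: l1 l2 l3; move: (ln _) (ln _) (ell t) (ell t0).
    by clear; intros; lra.
  have -> : k * `|t - t0| - k' = (lam^-1 * `|t - t0| - kap - 10 * M) / (4 * M).
    by rewrite /k /k'; field; rewrite !gt_eqF.
  by rewrite ler_pdivrMr ?mulr_gt0//; move: h2; clear; lra.
(* In D^2 one factor is bounded by eps and the other by exp (k' - k |t - t0|). The factor exp (- k')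
   in eps is there to cancel exp k', leaving eta^4 exp (- k |t - t0|). *)
have sqD t : a <= t <= b -> Num.sqrt (D t) <= eta * expR (- (k / 4) * `|t - t0|).
  move=> tI; set X := (X in _ <= X).
  have X0 : 0 < X by rewrite mulr_gt0 ?expR_gt0.
  have d0 := D0 t tI.
  have : D t ^+ 2 <= (X ^+ 2) ^+ 2.
    rewrite -exprM (_ : (2 * 2)%N = 4%N)// /X exprMn -expRM_natl.
    have -> : expR (4%:R * (- (k / 4) * `|t - t0|)) = expR (- k') * expR (- (k * `|t - t0| - k')).
      by rewrite -expRD; congr expR; field.
    rewrite mulrA -/k' -/eps expr2; apply: ler_pM; [exact: ltW|exact: ltW|exact: De|].
    by rewrite [leLHS]Dell// ler_expR lerN2 ellt.
  rewrite ler_pXn2r ?nnegrE ?sqr_ge0 ?(ltW d0)// => h.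
  by rewrite -(ger0_norm (ltW X0)) -sqrtr_sqr ler_wsqrtr.
pose A := M * lam * eta.
have A0 : 0 < A by rewrite !mulr_gt0.
pose G' t := A * expR (- (k / 4) * `|t - t0|).
have vel : {ae @lebesgue_measure R, forall t, a <= t <= b ->
    exists2 v, is_velocity sg t v & enorm v <= G' t}.
  apply: (@filterS _ _ (ae_filter_ringOfSetsType (@lebesgue_measure R)) _ _ _ sgv) => t h tI; have [v vt kv] := h (inI t tI).
  exists v => //; have [_ /(_ v) hv _] := H t tI; apply: le_trans hv _.
  rewrite /G' /A -/(D t).
  have -> : M * lam * eta * expR (- (k / 4) * `|t - t0|) =
    M * (eta * expR (- (k / 4) * `|t - t0|)) * lam by ring.
  apply: ler_pM => //; rewrite ?mulr_ge0 ?sqrtr_ge0 ?(ltW M0)// ?kobm_ge0//.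
  by rewrite ler_pM2l// sqD.
have /andP[at0 t0b] := t0I.
have k40 : 0 < k / 4 by rewrite divr_gt0.
have B0 : 0 < A / (k / 4) by rewrite divr_gt0.
(* The comparison function is an explicit primitive of G' on one side of t0. Each side contributes 4
   A / k = 16 M^2 lam^2 eta. *)
have right : enorm (sg b - sg t0) <= A / (k / 4).
  refine (le_trans (@absolutely_continuous_bound _ _ sg L t0 b
    (fun s => - (A / (k / 4)) * expR (- (k / 4) * (s - t0))) G'
    (le_trans a0 at0) t0b bL sgac _ _ _) _).
  - move=> t /andP[t1 t2]; apply: (is_derive_eq (is_derive_expR_affine _ _ _ _)).
    rewrite /G' ger0_norm ?subr_ge0//; congr (_ * _); field; rewrite gt_eqF//.
  - by move=> t _; rewrite mulr_ge0 ?expR_ge0 ?ltW.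
  - apply: (@filterS _ _ (ae_filter_ringOfSetsType (@lebesgue_measure R)) _ _ _ vel) => t h /andP[t1 t2]; apply: h.
    by rewrite (le_trans at0).
  rewrite subrr mulr0 expR0 mulr1 opprK gerDr.
  by rewrite mulNr oppr_le0 mulr_ge0 ?expR_ge0 ?ltW.
have left_ : enorm (sg t0 - sg a) <= A / (k / 4).
  refine (le_trans (@absolutely_continuous_bound _ _ sg L a t0
    (fun s => (A / (k / 4)) * expR ((k / 4) * (s - t0))) G'
    a0 at0 (le_trans t0b bL) sgac _ _ _) _).
  - move=> t /andP[t1 t2]; apply: (is_derive_eq (is_derive_expR_affine _ _ _ _)).
    rewrite /G' distrC ger0_norm ?subr_ge0// divfK ?gt_eqF//.
    by rewrite mulNr -mulrN opprB.
  - by move=> t _; rewrite mulr_ge0 ?expR_ge0 ?ltW.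
  - apply: (@filterS _ _ (ae_filter_ringOfSetsType (@lebesgue_measure R)) _ _ _ vel) => t h /andP[t1 t2]; apply: h.
    by rewrite t1 (le_trans t2).
  rewrite subrr mulr0 expR0 mulr1 gerBl.
  by rewrite mulr_ge0 ?expR_ge0 ?ltW.
apply: le_trans (enorm_triangle (sg t0) _ _) _.
rewrite (le_trans (lerD right left_))// le_eqVlt; apply/orP; left; apply/eqP.
by rewrite /A /k; field; rewrite !gt_eqF.
Qed.

End Displacement.

Section Visibility.
Variables (R : realType) (n : nat).
Local Notation C := (Cplx R).
Implicit Types (z v w p q : 'cV[C]_n) (Om : set 'cV[C]_n).

Lemma absolutely_continuous_uniform (I : interval R) (sg : R -> 'cV[C]_n) (e : R) :
  absolutely_continuous_on I sg -> 0 < e -> exists2 d : R, 0 < d &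
  forall s t, s \in I -> t \in I -> `|s - t| < d -> enorm (sg s - sg t) < e.
Proof.
move=> ac /ac[d d0 hd]; exists d => // s t.
have key x y : x \in I -> y \in I -> x <= y -> y - x < d -> enorm (sg y - sg x) < e.
  move=> xI yI xy yx.
  have := hd 1%N (fun=> x) (fun=> y); rewrite !big_ord_recl !big_ord0 !addr0; apply => //.
  by move=> i j; rewrite !ord1.
move=> sI tI; have [st|ts] := leP s t.
  by rewrite distrC ger0_norm ?subr_ge0// enormB; exact: key.
by rewrite ger0_norm ?subr_ge0 ?(ltW ts)//; exact: key (ltW ts).
Qed.

Lemma closure_bounded Om (M : R) : (forall z, Om z -> enorm z <= M) ->
  forall z, closure Om z -> enorm z <= M.
Proof.
move=> hM z /closure_enorm h; rewrite leNgt; apply/negP => Mz.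
have [|w Ow wz] := h (enorm z - M); first by rewrite subr_gt0.
have := hM _ Ow; have := enorm_triangle w z 0; rewrite !subr0 enormB.
by move: wz Mz; clear; lra.
Qed.

Lemma disjoint_closures (V W : set 'cV[C]_n) (M : R) : (forall z, V z -> enorm z <= M) ->
  closure V `&` closure W = set0 ->
  exists2 d : R, 0 < d & forall v w, V v -> W w -> d <= enorm (v - w).
Proof.
move=> bV VW.
have cV : compact (closure V).
  by apply: (heine_borel (M := M)); [exact: closed_closure|exact: closure_bounded].
have [||N hN] := @compact_uniform _ _ _
    (fun N v => 0 < N /\ forall w, W w -> N^-1 <= enorm (v - w)) cV.
- move=> N N' v NN' [N0 h]; have N'0 : 0 < N' by exact: lt_le_trans NN'.
  by split=> // w /h; apply: le_trans; rewrite lef_pV2 ?posrE.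
- move=> v cVv; have /existsNP[e /not_implyP[e0 he]] :
      ~ forall e : R, 0 < e -> exists2 w, W w & enorm (w - v) < e.
    move=> /closure_enorm cWv; have : (closure V `&` closure W) v by split.
    by rewrite VW.
  exists (2 / e), (e / 2); split; first by rewrite divr_gt0.
  move=> v' v'v; split; first by rewrite divr_gt0.
  move=> w Ww; rewrite invf_div leNgt; apply/negP => h; apply: he; exists w => //.
  have := enorm_triangle v' v w; rewrite [enorm (w - v)]enormB [enorm (v - v')]enormB.
  by move: h v'v; clear; lra.
have [[v0 Vv0]|nV] := pselect (exists v, V v); last first.
  by exists 1 => // v w Vv; case: nV; exists v.
have [N0 _] := hN _ (subset_closure Vv0).
exists N^-1; first by rewrite invr_gt0.
by move=> v w /subset_closure/hN[_ +] => /[apply].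
Qed.

Lemma bdry_closed_away Om (rs : seq 'cV[C]_n) (c M : R) : open Om ->
  (forall z, Om z -> enorm z <= M) ->
  compact [set p | bdry Om p /\ forall q, q \in rs -> c <= enorm (p - q)].
Proof.
move=> oOm hM; apply: (heine_borel (M := M)); last first.
  by move=> z [[cz _] _]; exact: (closure_bounded hM).
apply: closed_enorm => z hz; split.
  apply/(bdryP _ oOm); split.
    apply/closure_enorm => e e0; have [|p [/(bdryP _ oOm)[/closure_enorm cp _] _] pz] := hz (e / 2).
      by rewrite divr_gt0.
    have [|w Ow wp] := cp (e / 2); first by rewrite divr_gt0.
    exists w => //; have := enorm_triangle p w z; move: pz wp; clear; lra.
  move=> Oz; have [e e0 he] := open_enorm oOm Oz.
  by have [p [/(bdryP _ oOm)[_ +] _] /he] := hz e e0.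
move=> q hq; rewrite leNgt; apply/negP => zq.
have [|p [_ /(_ q hq)]] := hz (c - enorm (z - q)); first by rewrite subr_gt0.
by have := enorm_triangle z p q; move: zq; clear; lra.
Qed.


Lemma strongly_pseudoconvex_off_finite_visibility Om (Q : set 'cV[C]_n) :
  (0 < n)%N -> bounded_domain Om -> finite_set Q ->
  (forall p, (bdry Om `\` Q) p -> C2_boundary_at Om p) ->
  (forall p, (bdry Om `\` Q) p -> strongly_levi_pseudoconvex_at Om p) ->
  visibility_domain Om.
Proof.
move=> n0 bOm /finite_seqP[rs QE] C2 SP; split=> // lam kap lam1 kap0.
move=> xi eta _ _ _ V W [U1 _ VE] _ _ _ VW.
have [w0 nw0] := bounded_domain_compl n0 bOm.
have [oOm _ [z0 Oz0] [M1 hM1]] := bOm.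
have [d d0 hd] : exists2 d : R, 0 < d & forall v w, V v -> W w -> d <= enorm (v - w).
  apply: (disjoint_closures (M := M1)) VW => z; rewrite VE => -[_].
  exact: closure_bounded.
pose c := d / 4 ^+ size rs.
have c0 : 0 < c by rewrite divr_gt0// exprn_gt0.
have cX := @bdry_closed_away Om rs (c / 2) M1 oOm hM1.
pose good (M : R) z := (forall v, enorm v <= M * Num.sqrt (delta Om z) * kobm Om z v) /\
  reach Om z z0 (M * (1 + ln (1 + 1 / delta Om z))).
have lnge0 z : Om z -> 0 <= 1 + ln (1 + 1 / delta Om z).
  move=> Oz; rewrite addr_ge0// ln_ge0// lerDl divr_ge0// ltW//.
  exact: delta_gt0 nw0.
have goodS M M' z : Om z -> M <= M' -> good M z -> good M' z.
  move=> Oz MM' [h1 h2]; split=> [v|].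
    apply: le_trans (h1 v) _; rewrite ler_wpM2r ?kobm_ge0// ler_wpM2r//.
  by apply: reach_le h2 _; rewrite ler_wpM2r// lnge0.
(* Here M bounds the constants of both estimates, while M^-1 is the radius of validity, so one
   compactness argument yields all of them. *)
have [||M2 hM2] := @compact_uniform _ _ _ (fun M p => 0 < M /\
    forall z, enorm (z - p) < M^-1 -> Om z -> good M z) cX.
- move=> M M' p MM' [M0 h]; have M'0 : 0 < M' by exact: lt_le_trans MM'.
  split=> // z zp Oz; apply: (goodS M) => //; apply: h => //.
  by apply: lt_le_trans zp _; rewrite lef_pV2 ?posrE.
- move=> p [bp hp].
  have pQ : (bdry Om `\` Q) p.
    split=> //; rewrite QE /= => /hp; rewrite subrr enorm0; move: c0; clear; lra.
  have [U [rho def]] := C2 p pQ.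
  have [e1 [K1 [e10 K10 h1]]] := kobm_strongly_pseudoconvex bOm bp (SP p pQ).
  have [e2 [K2 [e20 K20 h2]]] := reach_near_bdry bOm bp def Oz0.
  pose e := Num.min e1 e2.
  have e0 : 0 < e by rewrite lt_min e10.
  pose M := Num.max (Num.max K1 K2) (2 / e).
  have M0 : 0 < M by rewrite !lt_max K10.
  exists M, (e / 2); split; first by rewrite divr_gt0.
  move=> w wp; split=> // z zw Oz.
  have ze : enorm (z - p) < e.
    have : M^-1 <= e / 2 by rewrite -invf_div lef_pV2 ?posrE ?divr_gt0// le_max lexx orbT.
    by have := enorm_triangle w z p; move: zw wp; clear; lra.
  have [ze1 ze2] : enorm (z - p) < e1 /\ enorm (z - p) < e2.
    by move: ze; rewrite lt_min => /andP[].
  have [KM1 KM2] : K1 <= M /\ K2 <= M by rewrite !le_max !lexx !orbT.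
  split=> [v|].
    apply: le_trans (h1 z v ze1 Oz) _; rewrite ler_wpM2r ?kobm_ge0// ler_wpM2r//.
  by apply: reach_le (h2 z ze2 Oz) _; rewrite ler_wpM2r// lnge0.
pose M := Num.max M2 1.
have M0 : 0 < M by rewrite lt_max ltr01 orbT.
have M1_ : 1 <= M by rewrite le_max lexx orbT.
have lam0 : 0 < lam by exact: lt_le_trans lam1.
(* As eps <= et, these bounds ensure in turn that eps <= 1, that a point with delta < eps has a
   boundary point within M^-1, that this boundary point is still c / 2 away from the exceptional
   ones, and that the displacement 32 M^2 lam^2 et is at most c / 2. *)
pose et := Num.min (Num.min 1 M^-1) (Num.min (c / 2) (c / (64 * M ^+ 2 * lam ^+ 2))).
have et0 : 0 < et.
  by rewrite !lt_min ltr01 invr_gt0 M0 !divr_gt0// !mulr_gt0// exprn_gt0.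
have [et1 etM etc etd] : [/\ et <= 1, et <= M^-1, et <= c / 2 &
    et <= c / (64 * M ^+ 2 * lam ^+ 2)].
  by split; rewrite !ge_min lexx ?orbT.
pose eps := et ^+ 4 * expR (- ((kap + 10 * M) / (4 * M))).
have eps0 : 0 < eps by rewrite mulr_gt0 ?exprn_gt0 ?expR_gt0.
have eps_et : eps <= et.
  apply: (@le_trans _ _ (et ^+ 4)).
    rewrite ler_piMr ?exprn_ge0 ?(ltW et0)// -expR0 ler_expR oppr_le0 divr_ge0//.
      by rewrite addr_ge0// mulr_ge0// ltW.
    by rewrite mulr_ge0// ltW.
  by rewrite exprS ler_piMr ?(ltW et0)// exprn_ile1// ltW.
exists [set z | forall w, ~ Om w -> eps <= enorm (z - w)]; split.
- exact: compact_deep.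
- move=> z hz; apply: contrapT => /hz; rewrite subrr enorm0; move: eps0; clear; lra.
move=> L sg L0 gsg Vs Ws; apply: contrapT => avoid.
have [sgO sgk sgac sgv] := gsg.
have Dlt t : 0 <= t <= L -> delta Om (sg t) < eps.
  move=> tI; rewrite ltNge; apply/negP => h; apply: avoid; exists t => // w nw.
  exact: le_trans h (delta_le _ nw).
(* The annulus is centred at sg 0 and has width c. The distances of the exceptional points from sg 0
   miss its range of radii by at least c. *)
have [t1 [t2 [t10 t2d tE gap]]] := avoid_radii (fun q => enorm (q - sg 0)) rs d0.
rewrite subr0 -/c in tE.
pose u t := enorm (sg t - sg 0).
have uB q t : `|u t - enorm (q - sg 0)| <= enorm (sg t - q).
  rewrite ler_norml; apply/andP; split.
    have := enorm_triangle (sg t) q (sg 0); rewrite [enorm (q - sg t)]enormB /u; clear; lra.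
  have := enorm_triangle q (sg t) (sg 0); rewrite /u; clear; lra.
have [||||a [b [a0 ab bL [ua ub] hab]]] := @crossing R u L t1 t2 L0.
- by move: tE c0; clear; lra.
- by rewrite /u subrr enorm0.
- by apply: le_trans t2d _; rewrite /u enormB; exact: hd.
- move=> t tI e e0; have [r r0 hr] := absolutely_continuous_uniform sgac e0.
  exists r => // s sI st; apply: le_lt_trans (uB _ _) _; exact: hr.
have cab : c <= enorm (sg b - sg a).
  have := uB (sg a) b; rewrite -/(u a) ua ub -tE; apply: le_trans; exact: ler_norm.
have disp : enorm (sg b - sg a) <= 32 * M ^+ 2 * lam ^+ 2 * et.
  refine (@almost_geodesic_displacement _ _ Om z0 lam kap M et L sg a b oOm
  (ex_intro (fun w => ~ Om w) w0 nw0) lam1 M1_ et0 (le_trans eps_et et1) gsg a0 ab bL _).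
  move=> t /andP[at_ tb].
  have tI : 0 <= t <= L by rewrite (le_trans a0 at_) (le_trans tb bL).
  have Ot : Om (sg t) by exact: sgO.
  have [p bp tp] := near_bdry oOm Ot nw0 (Dlt t tI).
  have Xp : forall q, q \in rs -> c / 2 <= enorm (p - q).
    move=> q qrs.
    have qc : c <= enorm (sg t - q).
      apply: le_trans (uB q t); have /andP[h1 h2] : t1 <= u t <= t2 by apply: hab; rewrite at_ tb.
      have := gap (index q rs); rewrite index_mem => /(_ qrs q); rewrite nth_index// tE => hq.
      move: h1 h2; rewrite -/(u t) => h1 h2; case: hq => hq.
        by apply: le_trans (ler_norm _); move: hq h1; clear; lra.
      by rewrite distrC; apply: le_trans (ler_norm _); move: hq h2; clear; lra.
    have := enorm_triangle p (sg t) q; move: qc tp eps_et etc; clear; lra.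
  have [M20 gM2] := hM2 p (conj bp Xp).
  have [h1 h2] : good M (sg t).
    apply: (goodS M2) => //; first by rewrite le_max lexx.
    apply: gM2 => //; apply: lt_le_trans tp (le_trans eps_et (le_trans etM _)).
    by rewrite lef_pV2 ?posrE// le_max lexx.
  by split=> //; exact/ltW/Dlt.
have : 32 * M ^+ 2 * lam ^+ 2 * et <= c / 2.
  move: etd; rewrite ler_pdivlMr ?mulr_gt0 ?exprn_gt0//.
  by rewrite [32 * _ * _ * _]mulrC; move: (M ^+ 2) (lam ^+ 2); clear => x y; lra.
by move: cab c0 disp; clear; lra.
Qed.
End Visibility.

(** * Failure of the Goldilocks condition *)

Section PiecewiseIntegral.
Variable R : realType.
Local Notation mu := (@lebesgue_measure R).

Lemma increment_le_integral_funepos (f F : R -> R) (a b : R) : a < b ->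
  {within `[a, b], continuous f} -> {within `[a, b], continuous F} ->
  (forall x : R, a < x < b -> is_derive x 1 F (f x)) ->
  ((F b - F a)%:E <= \int[mu]_(x in `]a, b[) ((EFin \o f)^\+ x))%E.
Proof.
move=> ab cf cF dF.
have mf : measurable_fun `[a, b] f by apply: subspace_continuous_measurable_fun.
pose g : R -> \bar R := EFin \o f.
have mfp : measurable_fun `[a, b] g^\+%E.
  by apply: measurable_funepos; exact/measurable_EFinP.
have sub : `]a, b[ `<=` `[a, b]%classic by exact: subset_itv_oo_cc.
have sub2 : `]a, b] `<=` `[a, b]%classic by exact: subset_itv_oc_cc.
rewrite lebesgue_integral_nonneg.integral_itv_bndo_bndc; last by apply: measurable_funS mfp.
rewrite lebesgue_integral_nonneg.integral_itv_obnd_cbnd; last by apply: measurable_funS mfp.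
have [_ F1 F2] := (continuous_within_itvP F ab).1 cF.
have := @continuous_FTC2 _ f F a b ab cf; rewrite EFinB => <-.
- by rewrite integralE geeDl// oppe_le0 integral_ge0.
- by split=> // x; rewrite in_itv /= => /dF[].
- by move=> x; rewrite in_itv /= => /dF h; rewrite derive1E derive_val.
Qed.

Lemma subdivision_mono (m : nat) (t : nat -> R) i j :
  (forall k, (k < m)%N -> t k < t k.+1) -> (i <= j <= m)%N -> t i <= t j.
Proof.
move=> tlt /andP[]; elim: j => [|j IH]; first by rewrite leqn0 => /eqP->.
rewrite leq_eqVlt => /predU1P[->//|ij jm].
by rewrite (le_trans (IH ij (ltnW jm)))// ltW// tlt.
Qed.

(** [F] need not be measurable, so pieces cannot be split off its integral by additivity. A
    measurable minorant is built piece by piece instead, as the sum of the positive parts of f on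
    the open intervals, and only at the end compared with [F]. *)
Lemma piecewise_increment_le_integral (F psi : R -> R) (m : nat) (t : nat -> R) :
  t 0%N = 0 -> (forall i, (i < m)%N -> t i < t i.+1) -> (forall s, 0 <= F s) ->
  {within `[0, t m], continuous psi} ->
  (forall i, (i < m)%N -> exists2 f : R -> R, {within `[t i, t i.+1], continuous f} &
    forall s : R, t i < s < t i.+1 -> is_derive s 1 psi (f s) /\ f s <= F s) ->
  ((psi (t m) - psi 0)%:E <= \int[mu]_(s in `[0%R, t m]) (F s)%:E)%E.
Proof.
move=> t0 tlt F0 cpsi hf.
have tmono i j := @subdivision_mono m t i j tlt.
have tge0 i : (i <= m)%N -> 0 <= t i by move=> im; rewrite -t0 tmono.
suff [e [me e0 eF eoff epsi]] : exists e : R -> \bar R, [/\ measurable_fun setT e,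
    forall s, (0 <= e s)%E, forall s, (e s <= (F s)%:E)%E,
    forall s, ~ (0 <= s <= t m) -> e s = 0%E &
    ((psi (t m) - psi 0)%:E <= \int[mu]_s e s)%E].
  apply: le_trans epsi _; rewrite [leRHS]integral_mkcond.
  apply: ge0_le_lower_integral => s _ //; rewrite patchE.
  case: ifPn => [_//|/negP]; rewrite inE /= in_itv /= => /eoff->//.
elim: {-2}m (leqnn m) => [_|k IH km].
  exists (cst 0%E); split=> //.
  by rewrite t0 subrr integral0.
have [e [me e0 eF eoff epsi]] := IH (ltnW km).
have [f cf df] := hf k km.
pose g : R -> \bar R := EFin \o f.
pose h : R -> \bar R := (g^\+)%E \_ `]t k, t k.+1[.
have h0 s : (0 <= h s)%E by rewrite /h patchE; case: ifP.
have cpsik : {within `[t k, t k.+1], continuous psi}.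
  apply: continuous_subspaceW cpsi; move=> s /=; rewrite !in_itv /= => /andP[s1 s2].
  rewrite (le_trans (tge0 k (ltnW km)) s1) (le_trans s2)// tmono//.
  by rewrite km leqnn.
have mh : measurable_fun setT h.
  apply/(measurable_restrictT _ _).1; first exact: measurable_itv.
  apply: (@measurable_funS _ _ _ _ `[t k, t k.+1]) => //.
    exact: subset_itv_oo_cc.
  apply: measurable_funepos; apply/measurable_EFinP.
  exact: subspace_continuous_measurable_fun.
exists (fun s => (e s + h s)%E); split.
- exact: emeasurable_funD.
- by move=> s; rewrite adde_ge0.
- move=> s; rewrite /h patchE; case: ifPn => [|_]; last by rewrite adde0.
  rewrite inE /= in_itv /= => /andP[s1 s2]; rewrite eoff ?add0e; last first.
    by move=> /andP[_]; rewrite leNgt s1.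
  have [_ fF] : is_derive s 1 psi (f s) /\ f s <= F s by apply: df; rewrite s1.
  by rewrite funeposE ge_max /= !lee_fin fF F0.
- move=> s hs; rewrite eoff ?add0e; last first.
    by move=> /andP[s1 s2]; apply: hs; rewrite s1 (le_trans s2)// ltW// tlt.
  rewrite /h patchE; case: ifPn => // /[!inE] /=; rewrite in_itv /= => /andP[s1 s2].
  by case: hs; rewrite (le_trans (tge0 k (ltnW km)) (ltW s1)) ltW.
rewrite ge0_integralD//.
rewrite (_ : psi (t k.+1) - psi 0 = (psi (t k) - psi 0) + (psi (t k.+1) - psi (t k))); last by ring.
rewrite EFinD leeD//; rewrite -integral_mkcond.
apply: increment_le_integral_funepos => //; first exact: tlt.
by move=> x /df[].
Qed.

End PiecewiseIntegral.

Section Barrier.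
Variable R : realType.
Implicit Types (a s x : R).

(* The first factor cuts x ^ -s off at x = a while keeping it C^1, so that a
   function of the last coordinate near the tip extends by zero to Om. *)
Definition barrier a s x := Num.max 0 (a - x) ^+ 2 * x `^ (- s).

Definition barrier' a s x := Num.max 0 (a - x) ^+ 2 * (- s * x `^ (- s - 1)) +
  x `^ (- s) * (- (2 * Num.max 0 (a - x))).

Lemma is_derive_pos_part_sqr a x :
  is_derive x 1 (fun y => Num.max 0 (a - y) ^+ 2) (- (2 * Num.max 0 (a - x))).
Proof.
apply: eps_is_derive => e e0; exists e => // y yx.
have key : `|Num.max 0 (a - y) ^+ 2 - Num.max 0 (a - x) ^+ 2 -
    - (2 * Num.max 0 (a - x)) * (y - x)| <= `|y - x| * `|y - x|.
  rewrite -normrM ler_norml; move: (sqr_ge0 (a - x)) (sqr_ge0 (a - y)) (sqr_ge0 (y - x)).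
  rewrite !expr2 => h1 h2 h3; rewrite [`|_|]ger0_norm//.
  by have [|] := leP 0 (a - y); have [|] := leP 0 (a - x) => *; nra.
by apply: le_trans key _; rewrite ler_wpM2r// ltW.
Qed.

Lemma is_derive_barrier a s x : 0 < x -> is_derive x 1 (barrier a s) (barrier' a s x).
Proof.
move=> x0; have h2 := @is_derive1_powR _ (- s) x x0.
by have := is_deriveM (is_derive_pos_part_sqr a x) h2.
Qed.

Lemma continuous_barrier' a s x : 0 < x -> {for x, continuous (barrier' a s)}.
Proof.
move=> x0; have cp r : {for x, continuous (fun y : R => y `^ r)}.
  by apply: is_derive_continuous (is_derive1_powR _ x0).
have cm : {for x, continuous (fun y => Num.max 0 (a - y))}.
  apply/cvgrPdist_le => e e0; apply/nbhs_ballP; exists e => //= y.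
  rewrite /ball /= => /ltW; apply: le_trans; rewrite [`|x - y|]distrC.
  rewrite ler_norml; move: (ler_norm (y - x)) (ler_norm (- (y - x))); rewrite normrN.
  by have [|] := leP 0 (a - y); have [|] := leP 0 (a - x); clear => *; apply/andP; split; lra.
rewrite /barrier'; apply: cvgD; apply: cvgM.
- by rewrite expr2; apply: cvgM.
- by apply: cvgM; [exact: cvg_cst|exact: cp].
- exact: cp.
- by apply: cvgN; apply: cvgM; [exact: cvg_cst|exact: cm].
Qed.

Lemma barrier_ge a s x : a <= x -> barrier a s x = 0.
Proof. by move=> ax; rewrite /barrier max_l ?subr_le0// expr0n mul0r. Qed.

Lemma barrier'_ge a s x : a <= x -> barrier' a s x = 0.
Proof.
by move=> ax; rewrite /barrier' max_l ?subr_le0// expr0n mul0r mulr0 oppr0 mulr0 addr0.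
Qed.

(** For s = p - 1 this is a multiple of x^(-p), which cancels the x^p in the estimate of the metric
    near the tip. *)
Lemma barrier'_bound a s x : 0 <= s -> a <= 1 -> 0 < x ->
  `|barrier' a s x| <= (s + 2) * x `^ (- (1 + s)).
Proof.
move=> s0 a1 x0.
have [ax|xa] := leP a x.
  by rewrite barrier'_ge// normr0 mulr_ge0 ?powR_ge0// addr_ge0.
rewrite /barrier' max_r ?subr_ge0 ?(ltW xa)//.
have -> : - s - 1 = - (1 + s) by ring.
have -> : x `^ (- s) = x * x `^ (- (1 + s)).
  by rewrite -{2}[x]powRr1 ?ltW// -powRD ?(gt_eqF x0) ?implybT//; congr (_ `^ _); ring.
set w := x `^ _; have w0 : 0 < w by exact: powR_gt0.
have -> : (a - x) ^+ 2 * (- s * w) + x * w * - (2 * (a - x)) =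
  - (((a - x) ^+ 2 * s + 2 * (x * (a - x))) * w) by ring.
have ax0 : 0 <= a - x by rewrite subr_ge0 ltW.
rewrite normrN ger0_norm; last first.
  by rewrite mulr_ge0 ?(ltW w0)// addr_ge0// ?mulr_ge0 ?sqr_ge0// ltW.
rewrite ler_wpM2r ?(ltW w0)// lerD//.
  by rewrite ler_piMl// exprn_ile1//; lra.
by rewrite ler_piMr// mulr_ile1 ?(ltW x0)//; lra.
Qed.

Lemma barrier_lower a s x : 0 < a -> x <= a / 2 ->
  a ^+ 2 / 4 * x `^ (- s) <= barrier a s x.
Proof.
move=> a0 xa; rewrite ler_wpM2r ?powR_ge0// max_r; last by lra.
have -> : a ^+ 2 / 4 = (a / 2) ^+ 2 by field.
by rewrite ler_pXn2r ?nnegrE//; move: a0 xa; clear; lra.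
Qed.

End Barrier.

Section KobayashiLowerBound.
Variables (R : realType) (n : nat).
Local Notation C := (Cplx R).
Local Notation mu := (@lebesgue_measure R).
Implicit Types (z v w : 'cV[C]_n) (Om : set 'cV[C]_n).

Lemma within_continuous_eps (A : set R) (f : R -> R) :
  (forall x, A x -> forall e : R, 0 < e -> exists2 d : R, 0 < d &
    forall y, A y -> `|y - x| < d -> `|f y - f x| < e) -> {within A, continuous f}.
Proof.
move=> h; apply/subspace_continuousP => x Ax; apply/cvgrPdist_lt => e e0.
have [d d0 hd] := h x Ax e e0; apply/nbhs_ballP; exists d => //= y.
by rewrite /ball /= distrC => yx Ay; rewrite distrC; exact: hd.
Qed.

Lemma within_continuous_enorm (A : set R) (g : R -> 'cV[C]_n) (x e : R) :
  {within A, continuous g} -> A x -> 0 < e -> exists2 d : R, 0 < d &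
    forall y, A y -> `|y - x| < d -> enorm (g y - g x) < e.
Proof.
move=> /subspace_continuousP h Ax e0.
have [|d d0 hd] := (nbhs_ballP _ _).1 (h x Ax [set w | enorm (w - g x) < e] _).
  by apply/nbhs_enorm; exists e.
by exists d => // y Ay yx; apply: hd => //; rewrite /ball /= distrC.
Qed.

(** A test function whose differential is dominated by the metric. Joint continuity of dPhi makes
    the derivative of Phi along each C^1 piece continuous up to its ends, hence a measurable
    minorant of the integrand. *)
Lemma kobd_ge Om z w (Phi : 'cV[C]_n -> R) (dPhi : 'cV[C]_n -> 'cV[C]_n -> R) :
  open Om ->
  (forall x, Om x -> forall e : R, 0 < e -> exists2 d : R, 0 < d &
    forall x', Om x' -> enorm (x' - x) < d -> `|Phi x' - Phi x| < e) ->
  (forall x v, Om x -> forall e : R, 0 < e -> exists2 d : R, 0 < d &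
    forall x' v', Om x' -> enorm (x' - x) < d -> enorm (v' - v) < d ->
      `|dPhi x' v' - dPhi x v| < e) ->
  (forall (gam : R -> 'cV[C]_n) (t : R) v, Om (gam t) -> is_velocity gam t v ->
    is_derive t 1 (Phi \o gam) (dPhi (gam t) v)) ->
  (forall x v, Om x -> dPhi x v <= kobm Om x v) ->
  ((Phi w - Phi z)%:E <= kobd Om z w)%E.
Proof.
move=> oOm cPhi cdPhi dP bP; apply: le_ereal_inf_tmp => _ [gam [[cgam [m [t [t0 tm pieces]]]] gO g0 g1] <-].
have cPg : {within `[0, 1], continuous (Phi \o gam)}.
  apply: within_continuous_eps => x xI e e0.
  have [d d0 hd] := cPhi (gam x) (gO x xI) e e0.
  have [d' d'0 hd'] := within_continuous_enorm cgam xI d0.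
  by exists d' => // y yI yx; apply: hd; [exact: gO|exact: hd'].
rewrite -g0 -g1 -t0 -tm.
have := @piecewise_increment_le_integral _ (fun s => kobm Om (gam s) (velocity gam s))
  (Phi \o gam) m t t0; rewrite tm t0; apply => //.
- by move=> i im; have [] := pieces i im.
- by move=> s; exact: kobm_ge0.
have tI i : (i <= m)%N -> 0 <= t i <= 1.
  move=> im; have tlt k : (k < m)%N -> t k < t k.+1 by move=> /pieces[].
  rewrite -t0 -tm; apply/andP; split; apply: (subdivision_mono tlt) => //.
  by rewrite im leqnn.
move=> i im; have [tlt [g cg vg]] := pieces i im.
have sub s : `[t i, t i.+1]%classic s -> s \in `[0, 1]%R.
  rewrite /= !in_itv /= => /andP[s1 s2].
  have /andP[h1 _] := tI i (ltnW im); have /andP[_ h2] := tI i.+1 im.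
  by rewrite (le_trans h1 s1) (le_trans s2 h2).
exists (fun s => dPhi (gam s) (g s)).
  apply: within_continuous_eps => x xI e e0.
  have [d d0 hd] := cdPhi (gam x) (g x) (gO x (sub x xI)) e e0.
  have [d1 d10 hd1] := within_continuous_enorm cgam (sub x xI) d0.
  have [d2 d20 hd2] := within_continuous_enorm cg xI d0.
  exists (Num.min d1 d2); first by rewrite lt_min d10.
  move=> y yI; rewrite lt_min => /andP[y1 y2].
  by apply: hd; [exact/gO/sub|apply: hd1 => //; exact: sub|exact: hd2].
move=> s /andP[s1 s2].
have vs := vg s ltac:(by rewrite in_itv /= s1 s2).
have Os : Om (gam s) by apply/gO/sub; rewrite /= in_itv /= !ltW.
by split; [exact: dP|rewrite (is_velocity_lim vs); exact: bP].
Qed.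

End KobayashiLowerBound.

(** * The metric and the distance near a cusp *)

Section CuspMetric.
Variables (R : realType) (n : nat).
Local Notation C := (Cplx R).
Implicit Types (z v w q : 'cV[C]_n) (Om : set 'cV[C]_n).

Lemma unitary_enorm (T : 'M[C]_n) v : T \is unitarymx -> enorm (T *m v) = enorm v.
Proof.
move=> UT; pose dot (u : 'cV[C]_n) : C := ((u^T ^ Num.conj)%sesqui *m u) 0 0.
have dotE u : complex.Re (dot u) = enorm u ^+ 2.
  rewrite /dot mxE cRe_sum enorm_sqr.
  apply: eq_bigr => i _; rewrite !mxE cabs_sqr cReM cRe_conj cIm_conj; ring.
have UT' : (T^T ^ Num.conj)%sesqui *m T = 1%:M.
  by apply: mulmx1C; exact/unitarymxP.
have dotT : dot (T *m v) = dot v.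
  rewrite /dot trmx_mul map_mxM -mulmxA [X in _ *m X]mulmxA UT' mul1mx.
  by [].
have := dotE (T *m v); rewrite dotT dotE => /eqP.
by rewrite eq_sym eqrXn2 ?enorm_ge0// => /eqP.
Qed.

Lemma cusp_kobm Om q (T : 'M[C]_n) (l : 'I_n) (M rho p K : R) :
  open Om -> (forall z, Om z -> enorm z <= M) -> 0 < rho -> 0 <= p -> 0 < K ->
  T \is unitarymx ->
  (forall z, Om z -> enorm (z - q) < rho -> 0 < complex.Re ((T *m (z - q)) l 0) /\
    `|complex.Im ((T *m (z - q)) l 0)| <= K * complex.Re ((T *m (z - q)) l 0) `^ p) ->
  exists2 B : R, 0 < B & forall z v, Om z -> enorm (z - q) < rho / 2 ->
    cabs ((T *m v) l 0) <= B * complex.Re ((T *m (z - q)) l 0) `^ p * kobm Om z v.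
Proof.
move=> oOm hM rho0 p0 K0 UT hreg.
pose D : R := n%:R * (8 * `|M|) + 1.
have D0 : 0 < D by rewrite ltr_wpDl// !mulr_ge0.
(* For |x| <= r a disc starting within rho / 2 of q moves by at most D r <= rho / 2, so it stays
   where the cusp inequalities hold. *)
pose r := Num.min (1 / 2) (rho / (2 * D)).
have r0 : 0 < r by rewrite lt_min !divr_gt0// mulr_gt0.
have r2 : r <= 1 / 2 by rewrite ge_min lexx.
have rD : D * r <= rho / 2.
  have : r <= rho / (2 * D) by rewrite ge_min lexx orbT.
  rewrite ler_pdivlMr ?mulr_gt0// => h; rewrite ler_pdivlMr//.
  by rewrite (_ : D * r * 2 = r * (2 * D))//; ring.
(* Harnack gives Re g <= exp 8 * X for |x| <= 1/2, hence |Im g| <= K (exp 8 * X)^p there. The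
   imaginary part estimate with radius 1/2 contributes 16, and rescaling the disc by r contributes 1
   / r. *)
exists (16 * K * expR 8 `^ p / r).
  by rewrite divr_gt0// !mulr_gt0// powR_gt0 ?expR_gt0.
move=> z v Oz zq.
have zrho : enorm (z - q) < rho by apply: lt_trans zq _; move: rho0; clear; lra.
have [X0 _] := hreg z Oz zrho.
set X := complex.Re _ in X0 *.
apply: (@kobm_ge _ _ _ _ (fun v => cabs ((T *m v) l 0))) => //.
- by rewrite !mulr_gt0 ?invr_gt0 ?powR_gt0 ?expR_gt0.
- by move=> a u; rewrite -scalemxAr mxE cabsM.
move=> phi hphi phi0.
have hphi' := (holomorphic_discP _ _).1 hphi.
pose f (y : C) : C := (T *m (phi y - q)) l 0.
have df (y : C) : cabs y < 1 -> is_derive y 1 f ((T *m derive1 phi y) l 0).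
  move=> y1; have [dy _] := hphi' y y1.
  have -> : f = fun y => \sum_j (T l j * (phi y j 0 - q j 0)).
    by apply/funext => x; rewrite /f mxE; apply: eq_bigr => j _; rewrite !mxE.
  rewrite mxE; apply: is_derive_fin_sum => j.
  have d1 := is_derive_component j dy.
  have d2 := is_deriveB d1 (is_derive_cst (q j 0 : C) y 1).
  have d3 := is_deriveZ (T l j) d2.
  by apply: (is_derive_eq d3); rewrite subr0.
pose s : C := cpx r 0.
have cs (x : C) : cabs x < 1 -> cabs (s * x) <= 1 / 2 /\ cabs (s * x) <= r.
  move=> x1; rewrite cabsM /s cabs_real ger0_norm ?(ltW r0)//.
  have h : r * cabs x <= r by rewrite ler_piMr// ltW.
  by split=> //; exact: le_trans h r2.
pose g x := f (0 + s * x).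
have dg (x : C) : cabs x < 1 -> is_derive x 1 g (s * (T *m derive1 phi (0 + s * x)) l 0).
  move=> x1; apply: is_derive_affine; apply: df; rewrite add0r.
  by have [h _] := cs x x1; apply: le_lt_trans h _; lra.
have greg (x : C) : cabs x < 1 -> 0 < complex.Re (g x) /\
    `|complex.Im (g x)| <= K * complex.Re (g x) `^ p.
  move=> x1; have [h1 h2] := cs x x1; rewrite /g /f add0r; apply: hreg.
    by have [|_] := hphi' (s * x); first by apply: le_lt_trans h1 _; lra.
  have := disc_displacement (fun z Oz => le_trans (hM z Oz) (ler_norm M)) hphi h1.
  rewrite phi0 => h3.
  have h4 : enorm (phi (s * x) - z) <= rho / 2.
    apply: le_trans h3 (le_trans _ rD).
    rewrite (le_trans (ler_wpM2l _ h2))// ?mulr_ge0//.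
    by rewrite ler_wpM2r ?(ltW r0)// lerDl.
  have := enorm_triangle z (phi (s * x)) q; move: h4 zq; clear; lra.
have g0 : complex.Re (g 0) = X by rewrite /g /f mulr0 addr0 phi0.
have c01 : cabs (0 : C) < 1 by rewrite cabs0.
have har (x : C) : cabs x <= 1 / 2 -> complex.Re (g x) <= expR 8 * X.
  rewrite -g0; apply: harnack => y y1; first by have [] := dg y y1.
  by have [/ltW] := greg y y1.
have half : 0 < 1 / 2 :> R by lra.
have := @imaginary_part_estimate _ g 0 _ (1 / 2) half _ (dg 0 c01)
  (K * (expR 8 * X) `^ p).
rewrite mulr0 addr0 cabsM /s cabs_real (ger0_norm (ltW r0)) => est.
rewrite (_ : 16 * K * _ `^ p / r * _ = 16 * (K * (expR 8 * X) `^ p) / r); last first.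
  rewrite powRM ?expR_ge0 ?(ltW X0)//; ring.
rewrite ler_pdivlMr// mulrC.
apply: le_trans (est _ _) _.
- by move=> x; rewrite subr0 => x2; have [] := dg x _ => //; move: x2; lra.
- move=> x; rewrite subr0 => x2.
  have [|h1 h2] := greg x; first by move: x2; lra.
  apply: le_trans h2 _; rewrite ler_pM2l//.
  rewrite ge0_ler_powR// ?nnegrE ?(ltW h1)//; last by apply: har; exact: ltW.
  by rewrite mulr_ge0 ?expR_ge0 ?ltW.
by rewrite le_eqVlt; apply/orP; left; apply/eqP; field.
Qed.

End CuspMetric.

Section CuspAxis.
Variables (R : realType) (n : nat).
Local Notation C := (Cplx R).
Implicit Types (z v w q : 'cV[C]_n) (Om : set 'cV[C]_n).

(** With x = exp (- u) this says that x^(-s) is not O(log (1/x)) as x tends to 0. *)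
Lemma expR_beats_affine (c1 c2 c3 s u0 : R) : 0 < c1 -> 0 < s ->
  exists2 u, u0 <= u & c2 + c3 * u < c1 * expR (u * s).
Proof.
move=> c10 s0; pose N := `|c2| + `|c3|.
have N0 : 0 <= N by rewrite addr_ge0.
have D0 : 0 < c1 * s ^+ 2 by rewrite mulr_gt0// exprn_gt0.
pose u := Num.max (Num.max u0 1) (4 * (N + 1) / (c1 * s ^+ 2)).
have u1 : 1 <= u by rewrite !le_max lexx orbT.
have u00 : 0 <= u by exact: le_trans u1.
have uN : 4 * (N + 1) <= u * (c1 * s ^+ 2).
  by rewrite -ler_pdivrMr// le_max lexx orbT.
exists u; first by rewrite !le_max lexx.
have e1 : (u * s / 2) ^+ 2 <= expR (u * s).
  have -> : expR (u * s) = expR (u * s / 2) ^+ 2 by rewrite -expRM_natl; congr expR; field.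
  have us : 0 <= u * s / 2 by rewrite divr_ge0// mulr_ge0// ltW.
  by rewrite ler_pXn2r ?nnegrE ?expR_ge0// (le_trans _ (expR_ge1Dx _))// lerDr.
apply: (@lt_le_trans _ _ (c1 * (u * s / 2) ^+ 2)); last by rewrite ler_pM2l.
have -> : c1 * (u * s / 2) ^+ 2 = u * (u * (c1 * s ^+ 2)) / 4 by field.
have h1 : c2 + c3 * u <= N * u.
  rewrite mulrDl lerD//; last by rewrite ler_wpM2r// ler_norm.
  by rewrite (le_trans (ler_norm _))// ler_peMr.
have h2 : u * (4 * (N + 1)) <= u * (u * (c1 * s ^+ 2)) by rewrite ler_wpM2l.
by move: h1 h2 u1; move: (u * (u * _)) => Y; clear; nra.
Qed.

(** The point has rotated coordinates (0, ..., 0, x). The radius r = (x/2)^p / K is at most x/2, so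
    in the ball of radius r the last coordinate has real part between x/2 and 3x/2, where psi is at
    least r. *)
Lemma cusp_axis_points Om (V : set 'cV[C]_n) q (T : 'M[C]_n) (l : 'I_n) (A K p : R)
    (psi : R -> R) (x : R) :
  (exists w, ~ Om w) -> T \is unitarymx -> 1 <= p -> 1 <= K ->
  (forall y : R, 0 <= y <= A -> y `^ p / K <= psi y) ->
  [set T *m (z - q) | z in Om `&` V] = cusp_region l A psi ->
  0 < x -> x <= 1 -> 2 * x < A ->
  exists z, [/\ Om z, complex.Re ((T *m (z - q)) l 0) = x, enorm (z - q) = x &
    (x / 2) `^ p / K <= delta Om z].
Proof.
move=> [w0 nw0] UT p1 K1 hpsi E x0 x1 xA.
have K0 : 0 < K by exact: lt_le_trans K1.
have invT u : T *m (invmx T *m u) = u by rewrite mulKVmx// unitarymx_unit.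
have inj u u' : T *m u = T *m u' -> u = u'.
  by move=> h; rewrite -(mulKmx (unitarymx_unit UT) u) h mulKmx// unitarymx_unit.
have regOm z : cusp_region l A psi (T *m (z - q)) -> Om z.
  rewrite -E => -[z' [Oz' _] /inj h].
  by rewrite -(subrK q z) -h subrK.
pose w : 'cV[C]_n := (cpx x 0 : C) *: delta_mx l 0.
have wk k : w k 0 = if k == l then cpx x 0 else 0.
  by rewrite !mxE eqxx andbT; case: eqP => _; rewrite ?mulr1 ?mulr0.
pose z := q + invmx T *m w.
have Tz : T *m (z - q) = w by rewrite /z addrC addKr invT.
pose r := (x / 2) `^ p / K.
have x20 : 0 < x / 2 by rewrite divr_gt0.
have r0 : 0 < r by rewrite divr_gt0// powR_gt0.
have rx : r <= x / 2.
  rewrite ler_pdivrMr// (@le_trans _ _ (x / 2))//; last by rewrite ler_peMr// ltW.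
  rewrite -{2}[x / 2](@powRr1 _ (x / 2)) ?(ltW x20)//; apply: ger_powR => //.
  by rewrite x20; move: x1; clear; lra.
have ball z' : enorm (z' - z) < r -> Om z'.
  move=> zz; apply: regOm; pose u := T *m (z' - q).
  have uw : enorm (u - w) < r.
    by rewrite -Tz /u -mulmxBr unitary_enorm// opprB addrA subrK.
  have cuw k : (u - w) k 0 = u k 0 - w k 0 by rewrite !mxE.
  have Re1 : `|complex.Re (u l 0) - x| < r.
    apply: le_lt_trans uw; apply: le_trans (cabs_le_enorm _ l).
    apply: le_trans (Re_le_cabs _); rewrite cuw wk eqxx.
    by rewrite (_ : complex.Re (u l 0 - _) = complex.Re (u l 0) - x)//; case: (u l 0).
  move: Re1; rewrite ltr_norml => /andP[Re1 Re2].
  rewrite /cusp_region /= -/u; split; first by apply/andP; split; lra.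
  apply: (@le_lt_trans _ _ (enorm (u - w) ^+ 2)).
    rewrite enorm_sqr [leRHS](bigD1 l)//=; apply: lerD.
      rewrite cuw wk eqxx cabs_sqr; apply: ler_wpDl; first exact: sqr_ge0.
      by rewrite cImD cImN Im_cpx oppr0 addr0.
    by apply: ler_sum => k kl; rewrite cuw wk (negbTE kl) subr0.
  rewrite ltr_pXn2r ?nnegrE ?enorm_ge0//.
    apply: lt_le_trans uw _; apply: le_trans (hpsi _ _); last by apply/andP; split; lra.
    rewrite ler_wpM2r ?invr_ge0 ?(ltW K0)// ge0_ler_powR ?nnegrE//; lra.
  apply: le_trans (hpsi _ _); last by apply/andP; split; lra.
  by rewrite divr_ge0 ?powR_ge0// ltW.
exists z; split.
- by apply: ball; rewrite subrr enorm0.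
- by rewrite Tz wk eqxx.
- rewrite -(unitary_enorm _ UT) Tz enormZ cabs_real ger0_norm ?(ltW x0)//.
  have /eqP : enorm (delta_mx l 0 : 'cV[C]_n) ^+ 2 = 1 ^+ 2.
    rewrite enorm_sqr (bigD1 l)//= big1 ?addr0; last first.
      by move=> k kl; rewrite mxE (negbTE kl) cabs0 expr0n.
    by rewrite mxE !eqxx cabs1 !expr1n.
  by rewrite eqrXn2 ?enorm_ge0// => /eqP ->; rewrite mulr1.
apply: (@delta_ge _ _ Om z w0) => // w' nw'; rewrite leNgt; apply/negP => h.
by apply: nw'; apply: ball; rewrite enormB.
Qed.

End CuspAxis.

Section CuspDistance.
Variables (R : realType) (n : nat).
Local Notation C := (Cplx R).
Implicit Types (z v w q : 'cV[C]_n) (Om : set 'cV[C]_n).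

Lemma is_derive_local_eq (f g : R -> R) (x a d : R) : 0 < d ->
  (forall y, `|y - x| < d -> f y = g y) -> is_derive x 1 f a -> is_derive x 1 g a.
Proof.
move=> d0 fg /is_derive_eps df; apply: eps_is_derive => e e0.
have [d' d'0 hd'] := df e e0; exists (Num.min d d'); first by rewrite lt_min d0.
move=> y; rewrite lt_min => /andP[y1 y2]; rewrite -!fg//; last by rewrite subrr normr0.
exact: hd'.
Qed.

Lemma is_velocity_form (T : 'M[C]_n) q (l : 'I_n) (gam : R -> 'cV[C]_n) (t : R) v :
  T \is unitarymx -> is_velocity gam t v ->
  is_derive t 1 (fun s => complex.Re ((T *m (gam s - q)) l 0)) (complex.Re ((T *m v) l 0)).
Proof.
move=> UT /is_velocity_eps hv; apply: eps_is_derive => e e0.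
have [d d0 hd] := hv e e0; exists d => // s st; apply: le_trans (hd s st).
rewrite -(unitary_enorm _ UT); apply: le_trans (cabs_le_enorm _ l).
apply: le_trans (Re_le_cabs _).
have -> : T *m (gam s - gam t - real_scale (s - t) v) =
  T *m (gam s - q) - T *m (gam t - q) - real_scale (s - t) (T *m v).
  by rewrite /real_scale scalemxAr -!mulmxBr; congr (_ *m (_ - _)); rewrite opprB addrA subrK.
by rewrite !mxE !cReD !cReN cReM /= mul0r subr0 [_ * (s - t)]mulrC.
Qed.

(** The test function is a multiple of the barrier in the last coordinate, extended by zero. The
    second hypothesis on points near q says that the part where X < a lies in the half ball, so the
    barrier already vanishes in [Om] before the extension takes over. *)
Lemma cusp_kobd_lower Om q (T : 'M[C]_n) (l : 'I_n) (M rho p K a : R) :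
  open Om -> (forall z, Om z -> enorm z <= M) -> 0 < rho -> 1 < p -> 0 < K ->
  T \is unitarymx -> 0 < a -> a <= 1 ->
  (forall z, Om z -> enorm (z - q) < rho -> 0 < complex.Re ((T *m (z - q)) l 0) /\
    `|complex.Im ((T *m (z - q)) l 0)| <= K * complex.Re ((T *m (z - q)) l 0) `^ p) ->
  (forall z, Om z -> enorm (z - q) < rho -> complex.Re ((T *m (z - q)) l 0) < a ->
    enorm (z - q) < rho / 2) ->
  exists2 c : R, 0 < c & forall z1, Om z1 -> exists c0 : R,
    forall z, Om z -> enorm (z - q) < rho ->
    ((c * barrier a (p - 1) (complex.Re ((T *m (z - q)) l 0)) - c0)%:E <= kobd Om z1 z)%E.
Proof.
move=> oOm hM rho0 p1 K0 UT a0 a1 reg tip.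
have p0 : 0 <= p by rewrite ltW// (lt_trans _ p1).
have [B B0 hB] := cusp_kobm oOm hM rho0 p0 K0 UT reg.
pose X z := complex.Re ((T *m (z - q)) l 0).
pose L v := complex.Re ((T *m v) l 0).
pose s := p - 1.
have s0 : 0 < s by rewrite subr_gt0.
(* This normalisation makes the differential of the test function at most [kobm]. *)
pose c := ((s + 2) * B)^-1.
have c0 : 0 < c by rewrite invr_gt0 mulr_gt0// addr_gt0.
pose Phi z := if enorm (z - q) < rho then c * barrier a s (X z) else 0.
pose dPhi z v := if enorm (z - q) < rho then c * barrier' a s (X z) * L v else 0.
have LB v w : `|L v - L w| <= enorm (v - w).
  rewrite -(unitary_enorm _ UT); apply: le_trans (cabs_le_enorm _ l).
  by apply: le_trans (Re_le_cabs _); rewrite /L mulmxBr !mxE cReD cReN.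
have XB z w : `|X z - X w| <= enorm (z - w).
  have := LB (z - q) (w - q); rewrite (_ : z - q - (w - q) = z - w)//.
  by apply/matrixP => i j; rewrite !mxE; ring.
(* Each point has a neighbourhood on which Phi is given by one of its two formulas; for |z - q| >=
   rho, the points of [Om] within rho / 2 of z have either |z' - q| >= rho or X >= a, and both make
   Phi vanish. *)
have loc z : Om z -> (enorm (z - q) < rho /\ exists2 d : R, 0 < d &
      forall z', enorm (z' - z) < d -> enorm (z' - q) < rho) \/
    (exists2 d : R, 0 < d & forall z', Om z' -> enorm (z' - z) < d ->
      Phi z' = 0 /\ forall v, dPhi z' v = 0).
  move=> Oz; have [zq|zq] := ltP (enorm (z - q)) rho.
    left; split=> //; exists (rho - enorm (z - q)); first by rewrite subr_gt0.
    by move=> z' h; have := enorm_triangle z z' q; move: h; clear; lra.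
  right; exists (rho / 2); first by rewrite divr_gt0.
  move=> z' Oz' z'z; rewrite /Phi /dPhi; case: ifPn => // z'q.
  have [aX|Xa] := leP a (X z').
    by rewrite barrier_ge// barrier'_ge// mulr0; split=> // v; rewrite mul0r.
  have := tip z' Oz' z'q Xa; have := enorm_triangle z' z q.
  by rewrite [enorm (z - z')]enormB; move: z'z zq; clear => *; exfalso; lra.
have cX (f : R * R -> R) z v : 0 < X z -> {for (X z, L v), continuous f} ->
    forall e : R, 0 < e -> exists2 d : R, 0 < d & forall z' v',
      enorm (z' - z) < d -> enorm (v' - v) < d -> `|f (X z', L v') - f (X z, L v)| < e.
  move=> Xz /cvgrPdist_lt cf e e0; have [d d0 hd] := (nbhs_ballP _ _).1 (cf e e0).
  exists d => // z' v' h1 h2; rewrite distrC; apply: hd; split; rewrite /ball /= distrC.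
    exact: le_lt_trans (XB _ _) h1.
  exact: le_lt_trans (LB _ _) h2.
exists c => // z1 Oz1; exists (Phi z1) => z Oz zq.
have -> : c * barrier a (p - 1) (complex.Re ((T *m (z - q)) l 0)) = Phi z.
  by rewrite /Phi zq.
apply: (@kobd_ge _ _ Om z1 z Phi dPhi) => //.
- move=> x Ox e e0; have [[xq [d d0 hd]]|[d d0 hd]] := loc x Ox; last first.
    exists d => // x' Ox' x'x; rewrite (hd x' Ox' x'x).1 (hd x Ox _).1 ?subrr ?normr0//.
    by rewrite ?subrr enorm0.
  have [Xx _] := reg x Ox xq.
  have [|d' d'0 hd'] := @cX (fun y => c * barrier a s y.1) x 0 Xx _ e e0.
    apply: cvgM; first exact: cvg_cst.
    apply: (@cvg_comp _ _ _ fst (barrier a s)); first exact: cvg_fst.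
    exact: is_derive_continuous (is_derive_barrier a s Xx).
  exists (Num.min d d'); first by rewrite lt_min d0.
  move=> x' Ox'; rewrite lt_min => /andP[h1 h2]; rewrite /Phi xq hd//.
  by apply: (hd' x' 0) => //; rewrite subrr enorm0.
- move=> x v Ox e e0; have [[xq [d d0 hd]]|[d d0 hd]] := loc x Ox; last first.
    exists d => // x' v' Ox' x'x _; rewrite (hd x' Ox' x'x).2 (hd x Ox _).2 ?subrr ?normr0//.
    by rewrite ?subrr enorm0.
  have [Xx _] := reg x Ox xq.
  have [|d' d'0 hd'] := @cX (fun y => c * barrier' a s y.1 * y.2) x v Xx _ e e0.
    apply: cvgM; last exact: cvg_snd.
    apply: cvgM; first exact: cvg_cst.
    apply: (@cvg_comp _ _ _ fst (barrier' a s)); first exact: cvg_fst.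
    exact: continuous_barrier'.
  exists (Num.min d d'); first by rewrite lt_min d0.
  move=> x' v' Ox'; rewrite !lt_min => /andP[h1 h2] /andP[h3 h4]; rewrite /dPhi xq hd//.
  exact: (hd' x' v').
- move=> gam t v Ot vt; have cg := is_velocity_continuous vt.
  have [[xq [d d0 hd]]|[d d0 hd]] := loc (gam t) Ot.
    have [r r0 hr] : exists2 r : R, 0 < r & forall y, `|y - t| < r -> enorm (gam y - gam t) < d.
      have [|r r0 hr] := (nbhs_ballP _ _).1 (cg [set w | enorm (w - gam t) < d] _).
        by apply/nbhs_enorm; exists d.
      by exists r => // y yt; apply: hr; rewrite /ball /= distrC.
    have [Xx _] := reg (gam t) Ot xq.
    apply: (@is_derive_local_eq (fun y => c * barrier a s (X (gam y))) _ _ _ r r0).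
      by move=> y yt; rewrite /Phi /= hd// hr.
    rewrite /dPhi xq -mulrA.
    have d1 := is_velocity_form q l UT vt.
    have d2 := @is_derive1_comp _ (barrier a s) (fun y => X (gam y)) t _ _
      (is_derive_barrier a s Xx) d1.
    exact: (is_deriveZ c d2).
  have [e e0 he] := open_enorm oOm Ot.
  have [r r0 hr] : exists2 r : R, 0 < r &
      forall y, `|y - t| < r -> enorm (gam y - gam t) < Num.min d e.
    have [|r r0 hr] := (nbhs_ballP _ _).1 (cg [set w | enorm (w - gam t) < Num.min d e] _).
      by apply/nbhs_enorm; exists (Num.min d e); rewrite // lt_min d0.
    by exists r => // y yt; apply: hr; rewrite /ball /= distrC.
  rewrite (hd _ Ot _).2 ?subrr ?enorm0//.
  apply: (@is_derive_local_eq (fun=> 0) _ _ _ r r0).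
  move=> y /hr; rewrite lt_min => /andP[h1 h2]; apply/esym.
  by have [] := hd (gam y) (he _ h2) h1.
move=> x v Ox; rewrite /dPhi; case: ifPn => xq; last exact: kobm_ge0.
have [aX|Xa] := leP a (X x); first by rewrite barrier'_ge// mulr0 mul0r kobm_ge0.
have [Xx _] := reg x Ox xq.
apply: le_trans (ler_norm _) _; rewrite normrM normrM (ger0_norm (ltW c0)).
have h1 := barrier'_bound (ltW s0) a1 Xx.
have h2 : `|L v| <= B * X x `^ p * kobm Om x v.
  by apply: le_trans (Re_le_cabs _) _; apply: hB => //; exact: tip.
have h3 : c * `|barrier' a s (X x)| * `|L v| <=
    c * ((s + 2) * X x `^ (- (1 + s))) * (B * X x `^ p * kobm Om x v).
  by apply: ler_pM => //; [rewrite mulr_ge0// ltW|rewrite ler_pM2l].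
apply: le_trans h3 _; rewrite (_ : 1 + s = p); last by rewrite /s; ring.
rewrite powRN le_eqVlt; apply/orP; left; apply/eqP; rewrite /c; field.
by rewrite !gt_eqF ?powR_gt0// addr_gt0.
Qed.

End CuspDistance.

Section NotGoldilocks.
Variables (R : realType) (n : nat).
Local Notation C := (Cplx R).
Implicit Types (z v w q : 'cV[C]_n) (Om : set 'cV[C]_n).

(** The logarithmic upper bound on the distance is what fails, along the axis of the cusp. *)
Lemma cusp_not_goldilocks Om q : bounded_domain Om -> cusp_at Om q ->
  ~ goldilocks_domain Om.
Proof.
move=> bOm [V [p [K [A [T [psi [l [[oV _ Vq] [/andP[p1 _] K1 A0] [UT _]]]]]]]]].
move=> [[_ psi0] _ psiB _ _] E [_ _ gold].
have n0 : (0 < n)%N by exact: leq_ltn_trans (leq0n l) (ltn_ord l).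
have [w0 nw0] := bounded_domain_compl n0 bOm.
have [oOm _ [z1 Oz1] [M hM]] := bOm.
have K0 : 0 < K by exact: lt_trans K1.
have [rho rho0 hrho] := open_enorm oV Vq.
pose X z := complex.Re ((T *m (z - q)) l 0).
have key z : Om z -> enorm (z - q) < rho -> [/\ 0 < X z, X z < A,
    `|complex.Im ((T *m (z - q)) l 0)| <= K * X z `^ p &
    enorm (z - q) <= X z + K * X z `^ p].
  move=> Oz zq; have : cusp_region l A psi (T *m (z - q)).
    by rewrite -E; exists z => //; split=> //; exact: hrho.
  rewrite /cusp_region /= -/(X z) => -[/andP[Xz XA] reg].
  have XI : X z \in `[0, A]%R by rewrite in_itv /= !ltW.
  have P0 := psi0 _ XI; have /andP[_ PK] := psiB _ XI.
  set y := complex.Im _ in reg *; set S := \sum_(_ < n | _) _ in reg.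
  have S0 : 0 <= S by apply: sumr_ge0 => k _; exact: sqr_ge0.
  have yP : `|y| <= psi (X z).
    rewrite -(ler_pXn2r (n := 2)) ?nnegrE// real_normK ?num_real//.
    by apply: ltW; apply: le_lt_trans reg; rewrite lerDl.
  split=> //; first exact: le_trans yP PK.
  apply: (@le_trans _ _ (X z + psi (X z))); last by rewrite lerD2l.
  rewrite -(unitary_enorm _ UT) -(ler_pXn2r (n := 2)) ?nnegrE ?enorm_ge0//; last first.
    by rewrite addr_ge0// ltW.
  rewrite enorm_sqr (bigD1 l)//= cabs_sqr -/(X z) -/y -/S sqrrD -addrA.
  apply: (@le_trans _ _ (X z ^+ 2 + psi (X z) ^+ 2)); first by rewrite lerD2l ltW.
  by rewrite -addrA lerD2l lerDr mulrn_wge0// mulr_ge0// ltW.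
(* The cusp is thin: |z - q| <= X + K X^p, which for X < a <= 1 is at most (1 + K) X < rho / 2. *)
pose a := Num.min 1 (rho / (2 * (1 + K))).
have a0 : 0 < a by rewrite lt_min ltr01 divr_gt0// mulr_gt0// addr_gt0.
have a1 : a <= 1 by rewrite ge_min lexx.
have aK : (1 + K) * a <= rho / 2.
  have : a <= rho / (2 * (1 + K)) by rewrite ge_min lexx orbT.
  rewrite ler_pdivlMr ?mulr_gt0 ?addr_gt0// => h; rewrite ler_pdivlMr//.
  by rewrite (_ : (1 + K) * a * 2 = a * (2 * (1 + K)))//; ring.
have tip z : Om z -> enorm (z - q) < rho -> X z < a -> enorm (z - q) < rho / 2.
  move=> Oz zq Xa; have [Xz _ _ h] := key z Oz zq.
  have Xp : X z `^ p <= X z.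
    rewrite -{2}[X z](@powRr1 _ (X z)) ?(ltW Xz)//; apply: ger_powR; last exact: ltW.
    by rewrite Xz (le_trans (ltW Xa)).
  apply: le_lt_trans h _; apply: lt_le_trans aK.
  apply: (@le_lt_trans _ _ ((1 + K) * X z)); last by rewrite ltr_pM2l// addr_gt0.
  by rewrite mulrDl mul1r lerD2l ler_pM2l.
have reg z : Om z -> enorm (z - q) < rho ->
    0 < X z /\ `|complex.Im ((T *m (z - q)) l 0)| <= K * X z `^ p.
  by move=> Oz /(key z Oz)[].
have [c c0 low] := cusp_kobd_lower oOm hM rho0 p1 K0 UT a0 a1 reg tip.
have [cz hcz] := low z1 Oz1.
have [K' [al [K'0 al0 up]]] := gold z1 Oz1.
have s0 : 0 < p - 1 by rewrite subr_gt0.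
pose x1 := Num.min (a / 2) (Num.min (A / 4) (rho / 2)).
have x10 : 0 < x1 by rewrite !lt_min !divr_gt0.
(* For x = exp (- u) the lower bound is c a^2 / 4 exp (u (p - 1)) - cz, and the upper bound is
   affine in u, because log (1 / delta) <= p u + p ln 2 + ln K. The condition u >= - ln x1 makes x
   small enough for the axis point to exist. *)
have [u u1] := @expR_beats_affine R (c * (a ^+ 2 / 4)) (cz + K' + al * (p * ln 2 + ln K))
  (al * p) (p - 1) (- ln x1) (mulr_gt0 c0 (divr_gt0 (exprn_gt0 2 a0) (ltr0n R 4)))  s0.
pose x := expR (- u).
have x0 : 0 < x by exact: expR_gt0.
have xx1 : x <= x1 by rewrite -[x1]lnK ?posrE// ler_expR lerNl.
have [xa xA xrho] : [/\ x <= a / 2, x <= A / 4 & x <= rho / 2].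
  by move: xx1; rewrite !le_min => /and3P[].
have [z [Oz Xz zq dz]] : exists z, [/\ Om z, X z = x, enorm (z - q) = x &
    (x / 2) `^ p / K <= delta Om z].
  apply: (@cusp_axis_points _ _ Om V q T l A K p psi) => //.
  - by exists w0.
  - exact: ltW.
  - exact: ltW.
  - move=> y yA; have /andP[h _] := psiB y ltac:(by rewrite in_itv).
    by move: h; rewrite mul1r mulrC.
  - by move: xa a1 a0; clear; lra.
  - by move: xA A0; clear; lra.
apply/negP; rewrite -leNgt.
have zrho : enorm (z - q) < rho by rewrite zq; move: xrho rho0; clear; lra.
have h1 := le_trans (hcz z Oz zrho) (up z Oz); rewrite lee_fin -/(X z) Xz in h1.
have h2 := barrier_lower (p - 1) a0 xa.
have xs : x `^ (- (p - 1)) = expR (u * (p - 1)) by rewrite /x -expRM; congr expR; ring.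
have d0 : 0 < delta Om z by exact: delta_gt0 nw0.
have h3 : ln (1 / delta Om z) <= p * u + p * ln 2 + ln K.
  have -> : p * u + p * ln 2 + ln K = - ln ((x / 2) `^ p / K).
    rewrite lnM ?posrE ?powR_gt0 ?invr_gt0 ?divr_gt0// ln_powR lnM ?posrE ?invr_gt0//.
    by rewrite !lnV ?posrE// /x expRK; ring.
  rewrite mul1r lnV ?posrE// lerN2 ler_ln ?posrE//.
  by rewrite divr_gt0 ?powR_gt0 ?divr_gt0.
have h4 := ler_wpM2l (ltW c0) h2; rewrite xs mulrA in h4.
have h5 := ler_wpM2l (ltW al0) h3.
have -> : cz + K' + al * (p * ln 2 + ln K) + al * p * u =
  cz + K' + al * (p * u + p * ln 2 + ln K) by ring.
by move: h1 h4 h5; clear; lra.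
Qed.

End NotGoldilocks.

Theorem theorem1p4 (R : realType) (n : nat) (Omega : set 'cV[Cplx R]_n) :
  (2 <= n)%N -> caltrop Omega ->
  visibility_domain Omega /\ ~ goldilocks_domain Omega.
Proof.
move=> n2 [bOm [Q [[finQ [q Qq]] QB C2 SP cusp]]]; split.
  by apply: strongly_pseudoconvex_off_finite_visibility finQ C2 SP => //; exact: ltnW.
exact: cusp_not_goldilocks bOm (cusp q Qq).
Qed.
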